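(* Let $n\geq2$ be an integer. Every modular form on $\Gamma_0(2^n)$ can be expressed as a finite $\mathbb{C}$-linear combination of eta-quotients.
   Context: $\Gamma_0(N)=\{\left[\begin{matrix}a&b\\c&d\end{matrix}\right]\in\mathrm{SL}_2(\mathbb{Z}) : c\equiv 0\pmod N\}$. Modular forms on $\Gamma_0(2^n)$ are of integral weight with trivial character. The Dedekind eta-function is $\eta(\tau)=q^{1/24}\prod_{k=1}^\infty(1-q^k)$ for $\tau$ in the complex upper half-plane, where $q=e^{2\pi i\tau}$ and $q^{1/24}=e^{2\pi i\tau/24}$. An eta-quotient is a function of the form $\prod_{d\mid N}\eta(d\tau)^{m_d}$ with $N$ a positive integer, $d$ running over the positive divisors of $N$, and $m_d\in\mathbb{Z}$. *)

(* Defs.v *)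
From HB Require Import structures.
From mathcomp Require Import all_boot all_order all_algebra.
From mathcomp Require Import all_classical all_reals all_analysis.
From mathcomp Require Import complex.

Set Implicit Arguments.
Unset Strict Implicit.
Unset Printing Implicit Defensive.

Import Order.TTheory GRing.Theory Num.Theory.
Import numFieldNormedType.Exports.

Local Open Scope classical_set_scope.
Local Open Scope ring_scope.
Local Open Scope complex_scope.

(* The analysis library puts a topology and a normed module structure on the
   regular module K^o of any numFieldType K, and copies them to K itself only
   for abstract K; here they are copied to the concrete field of complex
   numbers. *)
HB.instance Definition _ (R : rcfType) := PseudoPointedMetric.copy R[i] R[i]^o.
HB.instance Definition _ (R : rcfType) := NormedModule.copy R[i] R[i]^o.

Section ModularForms.
Variable R : realType.
Local Notation C := R[i].

Definition upper_half_plane : set C := [set tau | 0 < complex.Im tau].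

Definition cexp (z : C) : C :=
  (expR (complex.Re z))%:C * (cos (complex.Im z) +i* sin (complex.Im z)).

(* e^{2 pi i z}; thus q = qexp tau and q^{1/24} = qexp (tau / 24). *)
Definition qexp (z : C) : C := cexp ((2 * pi)%:C * 'i * z).

Definition SL2Z : set 'M[int]_2 := [set A : 'M[int]_2 | \det A = 1].

Definition Gamma0 (N : nat) : set 'M[int]_2 :=
  SL2Z `&` [set A : 'M[int]_2 | (N%:Z %| A 1%R 0%R)%Z].

Definition automorphy (A : 'M[int]_2) (tau : C) : C :=
  (A 1 0)%:~R * tau + (A 1 1)%:~R.

Definition moebius (A : 'M[int]_2) (tau : C) : C :=
  ((A 0 0)%:~R * tau + (A 0 1)%:~R) / automorphy A tau.

Definition slash (k : int) (A : 'M[int]_2) (f : C -> C) (tau : C) : C :=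
  automorphy A tau ^ (- k) * f (moebius A tau).

(* g has a Fourier expansion in q^{1/N} without negative powers. *)
Definition holomorphic_at_infty (N : nat) (g : C -> C) : Prop :=
  exists a : nat -> C, forall tau, upper_half_plane tau ->
    series (fun m => a m * qexp (m%:R * tau / N%:R)) @ \oo --> g tau.

(* Modular forms are represented by total functions of which only the values
   on the upper half-plane are relevant. Derivability is over C, that is, the
   limit of difference quotients with complex increments. Every conjugate of
   Gamma0 N in SL2(Z) contains the translation by N, so that expansions in
   q^{1/N} are available at all cusps. *)
Record modular_form (N : nat) (k : int) (f : C -> C) : Prop := ModularForm {
  modular_form_holomorphic :
    forall tau, upper_half_plane tau -> derivable f tau 1;
  modular_form_invariant :
    forall A, Gamma0 N A ->
      forall tau, upper_half_plane tau -> slash k A f tau = f tau;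
  modular_form_cusps :
    forall A, SL2Z A -> holomorphic_at_infty N (slash k A f)
}.

Definition eta (tau : C) : C :=
  qexp (tau / 24) *
  lim ((\prod_(1 <= k < n.+1) (1 - qexp tau ^+ k)) @[n --> \oo]).

Definition eta_quotient (N : nat) (m : nat -> int) (tau : C) : C :=
  \prod_(d <- divisors N) eta (d%:R * tau) ^ m d.

Definition is_eta_quotient (g : C -> C) : Prop :=
  exists (N : nat) (m : nat -> int), (0 < N)%N /\ g = eta_quotient N m.

End ModularForms.

(* Main.v *)
Require Import Defs.
From mathcomp Require Import all_boot all_order all_algebra.
From mathcomp Require Import all_classical all_reals all_analysis.
From mathcomp Require Import complex.
From mathcomp Require Import ring lra zify.

(** Write [theta_4^4], [theta_3^4] and [theta_2^4] for the fourth powers of Jacobi's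
    theta series; with the nome [e^(pi i tau)] they are products of Euler products
    (here [th4], [th3], [th2]). They are modular forms of weight 2 on [Gamma(2)],
    without zeros on the upper half-plane, and after the substitution of [2 tau]
      [th4 (2 tau) = eta (tau) ^ 8 / eta (2 tau) ^ 4],
      [th2 (2 tau) = 16 eta (4 tau) ^ 8 / eta (2 tau) ^ 4]
    are multiples of eta quotients.

    Level 4. A form [f] on [Gamma_0(4)] becomes a form on [Gamma(2)] when [tau] is
    replaced by [tau / 2] ([mform_half]). Odd weights contain only 0. A form on
    [Gamma(2)] of weight [2 m] minus a multiple of [th4 ^ m] has no constant term
    at infinity; since [th2] vanishes only at that cusp, and to the first order,
    the difference is divisible by [th2] ([mform_split]). The weight of the quotient
    is smaller by 2, and a form of negative weight is 0 ([mform_weightN2]): its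
    modulus is at most a constant times the height, hence tends to 0 towards the
    real line. So every form on [Gamma(2)] is a polynomial in [th4] and [th2]
    ([span_Gamma2]).

    Higher levels. [Gamma_0(2N)] has index 2 in [Gamma_0(N)] for even [N]. A form on
    the smaller group is the sum of a form on the larger group and of a function [g]
    that transforms under the quadratic character of the quotient. The function
    [th4 (N tau)] transforms under the same character, so [th4 (N tau) g] is a form on
    [Gamma_0(N)] ([mform_descent]). As [1 / th4 (N tau)] is an eta quotient, induction
    on the level ends the proof ([span_level]).

    Modularity of the theta series. Translations are clear on products. The inversion
    [th4 (tau) = - tau ^ (-2) th2 (-1 / tau)] ([theta_inversion]) is proved by summing
    the alternating lattice series of [(-1) ^ (i + j) / (i tau + j + 1 / 2)] in two
    orders ([interchange]). An inner sum is a cosecant ([cosecant_expansion]), and the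
    outer sum is then a Lambert series, equal to the square of a theta series by
    Kronecker's partial fractions ([lambert_theta4], [lambert_theta2]), that is, by
    the limit of an interpolation identity between polynomials ([finite_identity]).
    The action of [SL2(Z)] follows from its generators ([thetaP]).

    Analysis at the cusps. Expansions in [q^(1/N)] are represented by approximation
    by polynomials in [q^(1/N)], uniform on each half-plane [y <= Im tau] with [y > 0]
    ([regular]). This notion is stable under the operations above, and the maximum
    principle for polynomials gives division by [q^(1/N)] ([regular_divide]) and
    the vanishing of functions that are small near the real line
    ([regular_vanish]). *)

Import Order.TTheory GRing.Theory Num.Theory.
Import numFieldNormedType.Exports.
Import ComplexField.Normc.

Local Open Scope classical_set_scope.
Local Open Scope ring_scope.
Local Open Scope complex_scope.

Set Implicit Arguments.
Unset Strict Implicit.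
Unset Printing Implicit Defensive.

(** * Modulus and convergence of complex sequences *)

Section Modulus.
Variable R : realType.
Local Notation C := R[i].
Implicit Types (z w : C) (u v : nat -> C).

Lemma normCE z : `|z| = (normc z)%:C. Proof. by []. Qed.

Lemma normc_ge0 z : 0 <= normc z.
Proof. by case: z => x y; exact: sqrtr_ge0. Qed.

Lemma normc_eq0 z : (normc z == 0) = (z == 0).
Proof.
by apply/eqP/eqP => [/eq0_normc //|->]; exact: normc0.
Qed.

Lemma normc_gt0 z : (0 < normc z) = (z != 0).
Proof. by rewrite lt0r normc_eq0 normc_ge0 andbT. Qed.

Lemma normcB z w : normc (z - w) <= normc z + normc w.
Proof. by rewrite -(normcN w); exact: le_normcD. Qed.

Lemma normcBC z w : normc (z - w) = normc (w - z).
Proof. by rewrite -normcN opprB. Qed.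

Lemma normcX z n : normc (z ^+ n) = normc z ^+ n.
Proof. by elim: n => [|n ih]; rewrite ?expr0 ?normc1 // !exprS normcM ih. Qed.

Lemma normc_real (x : R) : normc x%:C = `|x|.
Proof. by rewrite /normc /= expr0n /= addr0 sqrtr_sqr. Qed.

Lemma normc_nat n : normc (n%:R : C) = n%:R.
Proof. by rewrite -(rmorph_nat (real_complex R)) normc_real normr_nat. Qed.

Lemma normc_Re z : `|complex.Re z| <= normc z.
Proof.
case: z => x y /=; rewrite -sqrtr_sqr ler_sqrt ?lerDl ?sqr_ge0 //.
by rewrite addr_ge0 ?sqr_ge0.
Qed.

Lemma normc_Im z : `|complex.Im z| <= normc z.
Proof.
case: z => x y /=; rewrite -sqrtr_sqr ler_sqrt ?lerDr ?sqr_ge0 //.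
by rewrite addr_ge0 ?sqr_ge0.
Qed.

Lemma normc_le_ReIm z : normc z <= `|complex.Re z| + `|complex.Im z|.
Proof.
case: z => x y /=; rewrite -ler_sqr ?nnegrE ?sqrtr_ge0 ?addr_ge0 //.
rewrite sqr_sqrtr ?addr_ge0 ?sqr_ge0 // sqrrD !real_normK ?num_real //.
by rewrite lerD2r lerDl mulrn_wge0 // mulr_ge0.
Qed.

Lemma normc_sum (I : Type) (r : seq I) (P : pred I) (F : I -> C) :
  normc (\sum_(i <- r | P i) F i) <= \sum_(i <- r | P i) normc (F i).
Proof.
elim/big_rec2: _ => [|i y x _ h]; first by rewrite normc0.
by rewrite (le_trans (le_normcD _ _)) // lerD2l.
Qed.

Lemma normc_lowerD z w : normc z - normc w <= normc (z + w).
Proof.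
rewrite lerBlDr -{1}(addrK w z); apply: le_trans (le_normcD _ _) _.
by rewrite normcN.
Qed.

(** Convergence is handled with real error bounds, so that linear arithmetic
    over the reals applies to them. *)
Lemma cvgcP u (a : C) : (u @ \oo --> a) <->
  forall e : R, 0 < e -> exists N, forall n, (N <= n)%N -> normc (u n - a) <= e.
Proof.
split.
  move=> /cvgrPdist_le h e e0.
  have /h [N _ hN] : 0 < e%:C by rewrite ltcR.
  by exists N => n /hN /=; rewrite distrC normCE lecR.
move=> h; apply/cvgrPdist_le => e e0.
have er : e = (complex.Re e)%:C.
  by move: e0; rewrite ltcE /= => /andP[/eqP h1 _]; case: e h1 => x y /= ->.
have := h (complex.Re e); rewrite -ltcR -er => /(_ e0) [N hN].
by exists N => // n /hN /=; rewrite distrC normCE {2}er lecR.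
Qed.

Lemma cvgc_unique u (a b : C) : u @ \oo --> a -> u @ \oo --> b -> a = b.
Proof. by move=> h1 h2; apply: cvg_unique h1 h2. Qed.

Lemma cvgc_ext u v (a : C) : u =1 v -> u @ \oo --> a -> v @ \oo --> a.
Proof. by move=> /funext ->. Qed.

Lemma cvgc_cst (a : C) : (fun=> a) @ \oo --> a.
Proof. exact: cvg_cst. Qed.
Arguments cvgc_cst a : clear implicits.

Lemma cvgcD u v (a b : C) : u @ \oo --> a -> v @ \oo --> b ->
  (fun n => u n + v n) @ \oo --> a + b.
Proof. by move=> h1 h2; apply: cvgD h1 h2. Qed.

Lemma cvgcB u v (a b : C) : u @ \oo --> a -> v @ \oo --> b ->
  (fun n => u n - v n) @ \oo --> a - b.
Proof. by move=> h1 h2; apply: cvgB h1 h2. Qed.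

Lemma cvgcM u v (a b : C) : u @ \oo --> a -> v @ \oo --> b ->
  (fun n => u n * v n) @ \oo --> a * b.
Proof. by move=> h1 h2; apply: cvgM h1 h2. Qed.

Lemma cvgcZ u (a b : C) : u @ \oo --> a -> (fun n => b * u n) @ \oo --> b * a.
Proof. by move=> h; exact: (cvgcM (cvgc_cst b) h). Qed.

Lemma cvgcV u (a : C) : u @ \oo --> a -> a != 0 ->
  (fun n => (u n)^-1) @ \oo --> a^-1.
Proof. by move=> h1 h2; apply: cvgV h2 h1. Qed.

(** Only growth of the index is asked of the reindexing [s], so that it covers
    the shifts and dilations of the cut-off met below. *)
Lemma cvgc_sub u (a : C) (s : nat -> nat) : (forall n, (n <= s n)%N) ->
  u @ \oo --> a -> (fun n => u (s n)) @ \oo --> a.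
Proof.
move=> hs /cvgcP h; apply/cvgcP => e /h[N hN].
by exists N => n Nn; apply: hN; apply: leq_trans (hs n).
Qed.

Lemma cvgc_shift u (a : C) : (fun n => u n.+1) @ \oo --> a -> u @ \oo --> a.
Proof.
move=> /cvgcP h; apply/cvgcP => e /h[N hN]; exists N.+1 => -[//|n] Nn.
exact: hN.
Qed.

Lemma cvgc_pred u (a : C) : u @ \oo --> a -> (fun n => u n.-1) @ \oo --> a.
Proof. by move=> h; exact: (@cvgc_shift (fun n => u n.-1)). Qed.

Lemma cvgc_shiftn u (a : C) k : (fun n => u (n + k)%N) @ \oo --> a -> u @ \oo --> a.
Proof.
move=> /cvgcP h; apply/cvgcP => e /h[N hN]; exists (N + k)%N => n Nn.
have -> : n = (n - k + k)%N by rewrite subnK // (leq_trans (leq_addl _ _) Nn).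
by apply: hN; rewrite leq_subRL ?(leq_trans (leq_addl _ _) Nn) // addnC.
Qed.

Lemma cvgc_near u v (a : C) N : (forall n, (N <= n)%N -> u n = v n) ->
  u @ \oo --> a -> v @ \oo --> a.
Proof.
move=> uv /cvgcP h; apply/cvgcP => e /h[M hM]; exists (maxn N M) => n.
by rewrite geq_max => /andP[h1 h2]; rewrite -uv // hM.
Qed.

Lemma cvgc_le u (a : C) (B : R) : u @ \oo --> a ->
  (exists N, forall n, (N <= n)%N -> normc (u n) <= B) -> normc a <= B.
Proof.
move=> /cvgcP h [M hM]; apply/ler_addgt0Pr => e /h[N hN].
have /hN h1 := leq_maxl N M; have /hM h2 := leq_maxr N M.
rewrite -(subrK (u (maxn N M)) a) (le_trans (le_normcD _ _)) //.
by rewrite addrC lerD // normcBC.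
Qed.

(** Completeness of the complex numbers, from that of the reals. *)
Lemma cauchyc u : (forall e : R, 0 < e -> exists N, forall n, (N <= n)%N ->
  normc (u n - u N) <= e) -> exists a : C, u @ \oo --> a.
Proof.
move=> h.
have main (f : C -> R) : (forall z w, `|f z - f w| <= normc (z - w)) ->
    exists x : R, (fun n => f (u n)) @ \oo --> x.
  move=> hf; have : cvg ((fun n => f (u n)) @ \oo).
    apply/cauchy_cvgP/cauchy_exP => e e0.
    have /h[N hN] : 0 < e / 2 by lra.
    exists (f (u N)); exists N => // n /= Nn.
    rewrite /ball /= distrC; apply: le_lt_trans (hf _ _) _.
    by apply: le_lt_trans (hN _ Nn) _; lra.
  by move=> /cvg_ex.
have [x hx] : exists x : R, (fun n => complex.Re (u n)) @ \oo --> x.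
  apply: main => z w; rewrite -raddfB; exact: normc_Re.
have [y hy] : exists y : R, (fun n => complex.Im (u n)) @ \oo --> y.
  apply: main => z w; rewrite -raddfB; exact: normc_Im.
exists (x +i* y); apply/cvgcP => e e0.
have e20 : 0 < e / 2 by lra.
move/cvgrPdist_le : hx => /(_ _ e20)[N1 _ h1].
move/cvgrPdist_le : hy => /(_ _ e20)[N2 _ h2].
exists (maxn N1 N2) => n; rewrite geq_max => /andP[/h1 n1 /h2 n2].
apply: le_trans (normc_le_ReIm _) _.
have -> : e = e / 2 + e / 2 by lra.
apply: lerD; [move: n1|move: n2]; rewrite /= distrC; by case: (u n).
Qed.

End Modulus.

Arguments cvgc_cst {R} a.
Arguments cvgcZ {R u a} b _.

(** * Dominated convergence for sums *)

Section Tannery.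
Variable R : realType.
Local Notation C := R[i].

(** Smallness of all finite tail sums is the form in which summability of the
    dominating sequence enters [tannery]. *)
Definition small_tails (b : nat -> R) := forall e, 0 < e ->
  exists K, forall k0 M, (K <= k0)%N -> \sum_(k0 <= k < M) b k <= e.

Lemma geometric_sum (A : comPzRingType) (x : A) n :
  (1 - x) * (\sum_(0 <= i < n) x ^+ i) = 1 - x ^+ n.
Proof. by rewrite -[1 - x]opprB mulNr big_mkord -subrX1 opprB. Qed.

Lemma geometric_sum_le (r : R) m n : 0 <= r < 1 ->
  \sum_(m <= k < n) r ^+ k <= r ^+ m / (1 - r).
Proof.
move=> /andP[r0 r1]; have r2 : 0 < 1 - r by rewrite subr_gt0.
have [nm|mn] := leqP n m; first by rewrite big_geq // divr_ge0 ?exprn_ge0 // ltW.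
rewrite -{1}(add0n m) big_addn ler_pdivlMr // mulrC.
under eq_bigr do rewrite exprD; rewrite -mulr_suml mulrA geometric_sum.
by rewrite ler_piMl ?exprn_ge0 // lerBlDr lerDl exprn_ge0.
Qed.

Lemma small_tails_geometric (c r : R) : 0 <= r < 1 ->
  small_tails (fun k => c * r ^+ k).
Proof.
move=> /andP[r0 r1] e e0.
have c0 : 0 < `|c| + 1 by apply: ltr_pwDr.
have h1 : 0 < e * (1 - r) / (`|c| + 1) by rewrite divr_gt0 ?mulr_gt0 ?subr_gt0.
have : (GRing.exp r : R ^nat) @ \oo --> (0 : R) by apply: cvg_expr; rewrite ger0_norm.
move=> /cvgrPdist_le /(_ _ h1)[K _ hK]; exists K => k0 M /hK /=.
rewrite sub0r normrN ger0_norm ?exprn_ge0 // => {}hK.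
apply: (@le_trans _ _ (\sum_(k0 <= k < M) `|c| * r ^+ k)).
  by apply: ler_sum => k _; rewrite ler_wpM2r ?exprn_ge0 // ler_norm.
have r01 : 0 <= r < 1 by rewrite r0.
rewrite -mulr_sumr; apply: le_trans (ler_wpM2l (normr_ge0 c) (geometric_sum_le k0 M r01)) _.
rewrite mulrA ler_pdivrMr ?subr_gt0 //; move: hK; rewrite ler_pdivlMr // => hK.
by apply: le_trans hK; rewrite mulrC ler_wpM2l ?exprn_ge0 // lerDl.
Qed.

(** Comparison with the telescoping series of [1 / k - 1 / (k + 1)]. *)
Lemma small_tails_square (c : R) : small_tails (fun k => c / (k.+1%:R) ^+ 2).
Proof.
move=> e e0.
have h0 : 0 < `|c| + 1 by apply: ltr_pwDr.
pose K := Num.bound ((`|c| + 1) / e).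
have hK : (`|c| + 1) / e < K%:R.
  by apply: archi_boundP; rewrite divr_ge0 // ltW.
have K0 : 0 < (K%:R : R) by apply: le_lt_trans hK; rewrite divr_ge0 // ltW.
exists K => k0 M Kk0; have [MK|KM] := leqP M k0; first by rewrite big_geq // ltW.
have k00 : 0 < (k0%:R : R) by apply: lt_le_trans K0 _; rewrite ler_nat.
apply: (@le_trans _ _ ((`|c| + 1) * (k0%:R^-1 - M%:R^-1))).
  rewrite -(subnKC (ltnW KM)); elim: (M - k0)%N => [|n ih].
    by rewrite addn0 big_geq // subrr mulr0.
  rewrite addnS big_nat_recr ?leq_addr //=.
  set m : R := (k0 + n)%:R in ih *.
  have m0 : 0 < m by apply: lt_le_trans k00 _; rewrite ler_nat leq_addr.
  have -> : (k0 + n).+1%:R = m + 1 by rewrite natr1.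
  apply: le_trans (lerD ih (lexx _)) _.
  have h : c / (m + 1) ^+ 2 <= (`|c| + 1) * (m^-1 - (m + 1)^-1).
    have -> : m^-1 - (m + 1)^-1 = (m * (m + 1))^-1.
      by field; apply/andP; split; rewrite gt_eqF //; lra.
    apply: (@le_trans _ _ ((`|c| + 1) / (m + 1) ^+ 2)).
      rewrite ler_wpM2r ?invr_ge0 ?sqr_ge0 //.
      by rewrite (le_trans (ler_norm _)) // lerDl.
    rewrite ler_wpM2l ?(ltW h0) // lef_pV2 ?posrE; nra.
  nra.
have M0 : 0 <= (M%:R^-1 : R) by rewrite invr_ge0.
apply: (@le_trans _ _ ((`|c| + 1) / k0%:R)).
  by rewrite ler_wpM2l ?(ltW h0) // lerBlDr lerDl.
rewrite ler_pdivrMr // mulrC -ler_pdivrMr // (le_trans (ltW hK)) //.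
by rewrite ler_nat.
Qed.

Lemma cvgc_sum (I : Type) (r : seq I) (t : nat -> I -> C) (T : I -> C) :
  (forall i, (fun n => t n i) @ \oo --> T i) ->
  (fun n => \sum_(i <- r) t n i) @ \oo --> \sum_(i <- r) T i.
Proof.
move=> h; elim: r => [|i r ih].
  rewrite big_nil; apply: (cvgc_ext _ (cvgc_cst 0)) => n; by rewrite big_nil.
rewrite big_cons; apply: (cvgc_ext _ (cvgcD (h i) ih)) => n.
by rewrite big_cons.
Qed.

(** Dominated convergence for sums whose summands depend on the cut-off: only
    the tails have to be dominated. *)
Lemma tannery (t : nat -> nat -> C) (T : nat -> C) (b : nat -> R) (n0 k0 : nat) :
  small_tails b ->
  (forall k, (fun n => t n k) @ \oo --> T k) ->
  (forall n k, (n0 <= n)%N -> (k0 <= k < n)%N -> normc (t n k) <= b k) ->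
  (fun n => \sum_(0 <= k < n) (t n k - T k)) @ \oo --> 0.
Proof.
move=> tb tT dom.
have domT k : (k0 <= k)%N -> normc (T k) <= b k.
  move=> kk; apply: (cvgc_le (tT k)); exists (maxn n0 k.+1) => n.
  by rewrite geq_max => /andP[h1 h2]; apply: dom => //; rewrite kk.
apply/cvgcP => e e0; have /tb[K1 hK1] : 0 < e / 4 by lra.
pose K := maxn K1 k0.
have := @cvgc_sum _ (index_iota 0 K) (fun n k => t n k - T k) (fun=> 0).
have h0 k : (fun n => t n k - T k) @ \oo --> (0 : C).
  by rewrite -(subrr (T k)); apply: cvgcB (tT k) (cvgc_cst (T k)).
move=> /(_ h0); rewrite big1 // => /cvgcP /(_ (e / 4))[|N hN]; first by lra.
exists (maxn N (maxn n0 K)) => n; rewrite !geq_max => /and3P[nN nn0 nK].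
rewrite subr0 (@big_cat_nat _ _ _ K) ?geq_max //=.
apply: le_trans (le_normcD _ _) _.
have {}hN := hN n nN; rewrite subr0 in hN.
have h2 : normc (\sum_(K <= k < n) (t n k - T k)) <=
          \sum_(K <= k < n) b k + \sum_(K <= k < n) b k.
  rewrite -big_split /=. apply: le_trans (normc_sum _ _ _) _.
  apply: ler_sum_nat => k /andP[Kk kn]; apply: le_trans (normcB _ _) _.
  have k0k : (k0 <= k)%N by apply: leq_trans Kk; rewrite leq_maxr.
  by apply: lerD; [apply: dom; rewrite // k0k|apply: domT].
have h3 := hK1 K n (leq_maxl _ _).
lra.
Qed.

End Tannery.

(** * The complex exponential *)

Section Exponential.
Variable R : realType.
Local Notation C := R[i].
Implicit Types z w : C.

Lemma cexpD z w : cexp (z + w) = cexp z * cexp w.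
Proof.
case: z => a b; case: w => c d; rewrite /cexp /= expRD cosD sinD.
by simpc; congr (_ +i* _); ring.
Qed.

Lemma cexp0 : cexp (0 : C) = 1.
Proof. by rewrite /cexp /= expR0 cos0 sin0 mul1r. Qed.

Lemma normc_cexp z : normc (cexp z) = expR (complex.Re z).
Proof.
rewrite /cexp normcM normc_real ger0_norm ?expR_ge0 //.
by rewrite /normc /= cos2Dsin2 sqrtr1 mulr1.
Qed.

Lemma cexp_neq0 z : cexp z != 0.
Proof. by rewrite -normc_gt0 normc_cexp expR_gt0. Qed.

Lemma cexpN z : cexp (- z) = (cexp z)^-1.
Proof.
by apply: (mulfI (cexp_neq0 z)); rewrite -cexpD subrr cexp0 divff ?cexp_neq0.
Qed.

Lemma cexpMn z n : cexp (n%:R * z) = cexp z ^+ n.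
Proof.
elim: n => [|n ih]; first by rewrite mul0r cexp0.
by rewrite -natr1 mulrDl mul1r cexpD ih exprSr.
Qed.

Lemma cexpMz z (n : int) : cexp (n%:~R * z) = cexp z ^ n.
Proof.
case: n => n; first exact: cexpMn.
by rewrite NegzE mulrNz mulNr cexpN cexpMn.
Qed.

Lemma ReMreal (x : R) z : complex.Re (x%:C * z) = x * complex.Re z.
Proof. by case: z => a b /=; rewrite mul0r subr0. Qed.

Lemma ImMreal (x : R) z : complex.Im (x%:C * z) = x * complex.Im z.
Proof. by case: z => a b /=; rewrite mul0r addr0. Qed.

Lemma ReN z : complex.Re (- z) = - complex.Re z. Proof. by case: z. Qed.
Lemma ImN z : complex.Im (- z) = - complex.Im z. Proof. by case: z. Qed.

Lemma ReD z w : complex.Re (z + w) = complex.Re z + complex.Re w.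
Proof. by case: z; case: w. Qed.

Lemma ImD z w : complex.Im (z + w) = complex.Im z + complex.Im w.
Proof. by case: z; case: w. Qed.

Lemma Im_quot (z w : C) : w != 0 ->
  complex.Im (z / w) * normc w ^+ 2 =
    complex.Im z * complex.Re w - complex.Re z * complex.Im w.
Proof.
move=> w0; rewrite -[in RHS](divfK w0 z); move: (z / w) => m.
case: m => a b; case: {w0} w => c d /=; rewrite sqr_sqrtr ?addr_ge0 ?sqr_ge0 //; ring.
Qed.

Lemma qexpE z : qexp z =
  cexp ((- (2 * pi * complex.Im z)) +i* (2 * pi * complex.Re z)).
Proof.
rewrite /qexp; congr cexp; case: z => a b; rewrite -mulrA.
by simpc.
Qed.

Lemma qexpD z w : qexp (z + w) = qexp z * qexp w.
Proof. by rewrite /qexp mulrDr cexpD. Qed.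

Lemma qexpN z : qexp (- z) = (qexp z)^-1.
Proof. by rewrite /qexp mulrN cexpN. Qed.

Lemma qexp_neq0 z : qexp z != 0.
Proof. exact: cexp_neq0. Qed.

Lemma qexpMn z n : qexp (n%:R * z) = qexp z ^+ n.
Proof. by rewrite /qexp mulrCA cexpMn. Qed.

Lemma qexpMz z (n : int) : qexp (n%:~R * z) = qexp z ^ n.
Proof. by rewrite /qexp mulrCA cexpMz. Qed.

Lemma normc_qexp z : normc (qexp z) = expR (- (2 * pi * complex.Im z)).
Proof. by rewrite qexpE normc_cexp. Qed.

Lemma qexp1 : qexp (1 : C) = 1.
Proof.
rewrite qexpE /= mulr0 oppr0 mulr1 /cexp /= expR0 mulr_natl cos2pi sin2pi.
by rewrite mul1r.
Qed.

Lemma qexp_half : qexp (2^-1 : C) = -1.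
Proof.
have -> : 2^-1 = (2^-1 : R)%:C by rewrite rmorphV ?unitfE // rmorph_nat.
have e : 2 * pi * 2^-1 = pi :> R by rewrite mulrAC divff ?mul1r.
rewrite qexpE /= mulr0 oppr0 /cexp /= expR0 e cospi sinpi.
by rewrite mul1r; apply/eqP; rewrite eq_complex /= oppr0 !eqxx.
Qed.

Lemma qexp_nat n : qexp (n%:R : C) = 1.
Proof. by rewrite -[n%:R]mulr1 qexpMn qexp1 expr1n. Qed.

Lemma qexp_int (n : int) : qexp (n%:~R : C) = 1.
Proof. by rewrite -[n%:~R]mulr1 qexpMz qexp1 exp1rz. Qed.

Lemma qexpD1 z : qexp (z + 1) = qexp z.
Proof. by rewrite qexpD qexp1 mulr1. Qed.

Lemma normc_qexp_lt1 z : 0 < complex.Im z -> normc (qexp z) < 1.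
Proof.
move=> h; rewrite normc_qexp -expR0 ltr_expR oppr_lt0.
by rewrite mulr_gt0 // mulr_gt0 // pi_gt0.
Qed.

Lemma ler_norm_sqr (x y : R) : `|x| <= `|y| -> x ^+ 2 <= y ^+ 2.
Proof.
move=> h; rewrite -(real_normK (num_real x)) -(real_normK (num_real y)).
by rewrite lerXn2r ?nnegrE.
Qed.

Lemma sin_mean_value (y : R) : exists2 x : R, `|x| <= `|y| & sin y = y * cos x.
Proof.
wlog y0 : y / 0 <= y.
  move=> h; have [y0|y0] := leP 0 y; first exact: h.
  have [|x hx e] := h (- y); first by rewrite oppr_ge0 ltW.
  by exists x; [rewrite -(normrN y)|rewrite -[sin y]opprK -sinN e mulNr opprK].
have hc : {within `[0, y], continuous (@sin R)}.
  by apply: continuous_subspaceT; exact: continuous_sin.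
have [c] := MVT_segment y0 (fun x _ => is_derive_sin x) hc.
rewrite in_itv /= sin0 !subr0 => /andP[c0 cy] ->.
by exists c; [rewrite !ger0_norm|rewrite mulrC].
Qed.

Lemma sin_le_norm (y : R) : `|sin y| <= `|y|.
Proof.
have [x _ ->] := sin_mean_value y; rewrite normrM ler_piMr //.
exact: cos_max.
Qed.

Lemma cos_lower (y : R) : 0 <= 1 - cos y <= y ^+ 2 / 2.
Proof.
have -> : cos y = 1 - sin (y / 2) ^+ 2 *+ 2.
  have -> : cos y = cos (y / 2 *+ 2) by rewrite -mulr_natr mulfVK.
  by rewrite cos_mulr2n; have := cos2Dsin2 (y / 2); lra.
have h := sin_le_norm (y / 2).
have h2 : sin (y / 2) ^+ 2 <= (y / 2) ^+ 2.
  by rewrite -ler_sqrt ?sqr_ge0 // !sqrtr_sqr.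
have h3 := sqr_ge0 (sin (y / 2)).
by apply/andP; split; lra.
Qed.

Lemma sin_lower (y : R) : `|sin y - y| <= `|y| * y ^+ 2 / 2.
Proof.
have [x hx ->] := sin_mean_value y.
rewrite -[X in _ - X]mulr1 -mulrBr normrM -mulrA ler_wpM2l // distrC.
have /andP[h1 h2] := cos_lower x; rewrite ger0_norm //; apply: le_trans h2 _.
by have := ler_norm_sqr hx; lra.
Qed.

Lemma expR_taylor (x : R) : `|x| <= 2^-1 -> 0 <= expR x - 1 - x <= 2 * x ^+ 2.
Proof.
rewrite ler_norml => /andP[h1 h2]; have h3 := expR_ge1Dx x.
have h4 := expR_ge1Dx (- x); have e0 := expR_gt0 x.
have h5 : expR x * expR (- x) = 1 by rewrite -expRD subrr expR0.
have h6 : expR x * (1 - x) <= 1 by rewrite -[leRHS]h5 ler_wpM2l // ltW.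
by apply/andP; split; nra.
Qed.

Lemma cexp_taylor z : normc z <= 2^-1 ->
  normc (cexp z - 1 - z) <= 6 * normc z ^+ 2.
Proof.
move=> hz; have hx := normc_Re z; have hy := normc_Im z.
set m := normc z in hz hx hy *.
move: hx hy; case: {+}z => x y hx hy; rewrite /= in hx hy.
have m0 : 0 <= m by exact: le_trans hx.
have /andP[e1 e2] := expR_taylor (le_trans hx hz).
have /andP[c1 c2] := cos_lower y; have s1 := sin_lower y.
rewrite /cexp; apply: (le_trans (normc_le_ReIm _)).
rewrite /= !mul0r !subr0 !addr0.
have x2 : x ^+ 2 <= m ^+ 2 by apply: ler_norm_sqr; rewrite (ger0_norm m0).
have y2 : y ^+ 2 <= m ^+ 2 by apply: ler_norm_sqr; rewrite (ger0_norm m0).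
have ex2 : expR x <= 2.
  by move: hx; rewrite ler_norml => /andP[? ?]; nra.
have e0 := expR_ge0 x.
have A : `|expR x * cos y - 1 - x| <= 3 * m ^+ 2.
  have -> : expR x * cos y - 1 - x = (expR x - 1 - x) - expR x * (1 - cos y) by ring.
  by rewrite ler_norml; apply/andP; split; nra.
have xy : `|x| * `|y| <= m ^+ 2 by rewrite expr2 ler_pM.
have y3 : `|sin y - y| <= m ^+ 2 / 4.
  apply: le_trans s1 _; have := normr_ge0 y; have := sqr_ge0 y; nra.
have ex1 : `|expR x - 1| <= 2 * `|x|.
  rewrite -(real_normK (num_real x)) in e2.
  have n0 := normr_ge0 x.
  move: hx; rewrite !ler_norml => /andP[hx1 hx2].
  have [xp|xn] := leP 0 x.
    by rewrite ger0_norm // in e2 *; apply/andP; split; nra.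
  by rewrite ltr0_norm // in e2 *; apply/andP; split; nra.
have B : `|expR x * sin y - 0 - y| <= 3 * m ^+ 2.
  have -> : expR x * sin y - 0 - y = expR x * (sin y - y) + (expR x - 1) * y by ring.
  apply: le_trans (ler_normD _ _) _; rewrite !normrM (ger0_norm e0).
  have := ler_pM e0 (normr_ge0 _) ex2 y3.
  have := ler_wpM2r (normr_ge0 y) ex1; nra.
move: A B; rewrite subr0; lra.
Qed.

(** The error is of order [1 / n] by [cexp_taylor]. *)
Lemma cexp_slope (a : C) :
  (fun n => n%:R * (cexp (a / n%:R) - 1)) @ \oo --> a.
Proof.
apply/cvgcP => e e0.
pose m := normc a; have m0 : 0 <= m := normc_ge0 a.
pose N := (Num.bound (2 * m + 6 * m ^+ 2 / e)).+1.
exists N => n Nn.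
have hN : 2 * m + 6 * m ^+ 2 / e < n%:R.
  apply: lt_le_trans (archi_boundP _) _.
    by rewrite addr_ge0 ?divr_ge0 ?mulr_ge0 ?sqr_ge0 // ltW.
  by rewrite ler_nat (leq_trans _ Nn) // /N.
have q0 : 0 <= 6 * m ^+ 2 / e by rewrite divr_ge0 ?mulr_ge0 ?sqr_ge0 // ltW.
have n0 : 0 < (n%:R : R) by apply: le_lt_trans hN; rewrite addr_ge0 // mulr_ge0.
have nC : (n%:R : C) != 0 by rewrite pnatr_eq0 -lt0n -(ltr_nat R).
have hm : normc (a / n%:R) = m / n%:R by rewrite normcM normcV normc_nat.
have h1 : normc (a / n%:R) <= 2^-1 by rewrite hm ler_pdivrMr //; lra.
have -> : n%:R * (cexp (a / n%:R) - 1) - a =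
          n%:R * (cexp (a / n%:R) - 1 - a / n%:R).
  by rewrite [RHS]mulrBr; congr (_ - _); rewrite mulrC mulfVK.
rewrite normcM normc_nat; have h2 := cexp_taylor h1.
apply: le_trans (ler_wpM2l (ltW n0) h2) _; rewrite hm.
have -> : n%:R * (6 * (m / n%:R) ^+ 2) = 6 * m ^+ 2 / n%:R.
  by field; rewrite gt_eqF.
rewrite ler_pdivrMr // [leRHS]mulrC -ler_pdivrMr //.
apply: le_trans (ltW hN); lra.
Qed.

(** The distance from 1 to the ray of argument [y] is at least [|sin y|], and at
    least 1 when the ray leaves the right half-plane. *)
Lemma cexp_far_from_1 (x y : R) : `|y| <= 5 / 4 * pi ->
  `|y| / 5 <= normc (1 - cexp (x +i* y)).
Proof.
move=> hy.
wlog y0 : y hy / 0 <= y.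
  move=> h; have [y0|y0] := leP 0 y; first exact: h.
  have := h (- y); rewrite normrN oppr_ge0 => /(_ hy (ltW y0)).
  rewrite /cexp /= cosN sinN; congr (_ <= _).
  rewrite /normc /=; simpc => /=; congr (Num.sqrt (_ + _)).
  by rewrite sqrrN.
rewrite ger0_norm // in hy *.
have p2 : pi / 2 <= 2 :> R by have [/andP[]] := pihalf_02_cos_pihalf R.
have p0 : 0 < pi :> R by exact: pi_gt0.
rewrite /cexp /=; set r := expR x; have r0 : 0 <= r := expR_ge0 x.
have [yp|yp] := leP y (pi / 2).
  apply: (@le_trans _ _ (sin y)); last first.
    rewrite /normc /= !mul0r subr0 addr0 sub0r.
    have h := cos2Dsin2 y.
    apply: le_trans (ler_norm _) _; rewrite -sqrtr_sqr ler_sqrt; last first.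
      by rewrite addr_ge0 ?sqr_ge0.
    have -> : (1 - r * cos y) ^+ 2 + (- (r * sin y)) ^+ 2 = sin y ^+ 2 +
        (r - cos y) ^+ 2 + (r ^+ 2 - 1) * (cos y ^+ 2 + sin y ^+ 2 - 1) by ring.
    by rewrite h subrr mulr0 addr0 lerDl sqr_ge0.
  have -> : sin y = sin (y / 2) * cos (y / 2) *+ 2.
    rewrite [X in X *+ 2]mulrC -sin_mulr2n; congr sin.
    by rewrite -[RHS]mulr_natr mulfVK.
  have [c hc ->] := sin_mean_value (y / 2).
  have yy : 0 <= y / 2 by rewrite divr_ge0.
  move: hc; rewrite (ger0_norm yy) ler_norml => /andP[c1 c2].
  have small_cos (t : R) : - (pi / 4) <= t <= pi / 4 -> 2^-1 <= cos t.
    move=> /andP[t1 t2].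
    have ct : 0 <= cos t by apply: cos_ge0_pihalf; apply/andP; split; lra.
    have : 0 <= cos (t *+ 2) by apply: cos_ge0_pihalf; apply/andP; split; lra.
    rewrite cos_mulr2n -mulr_natr; nra.
  have k1 : 2^-1 <= cos c by apply: small_cos; apply/andP; split; lra.
  have k2 : 2^-1 <= cos (y / 2) by apply: small_cos; apply/andP; split; lra.
  have : 4^-1 <= cos c * cos (y / 2) by nra.
  set u := cos c; set v := cos (y / 2) => uv.
  have -> : y / 2 * u * v *+ 2 = y * (u * v) by rewrite -mulr_natr; field.
  nra.
have cy : cos y <= 0.
  have -> : y = (y - pi) + pi by rewrite subrK.
  rewrite cosDpi oppr_le0; apply: cos_ge0_pihalf; apply/andP; split; lra.
apply: (@le_trans _ _ 1); first lra.
apply: le_trans (normc_Re (Complex (1 - (r * cos y - 0 * sin y))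
  (0 - (r * sin y + 0 * cos y)))).
by rewrite /= mul0r subr0; apply: le_trans (ler_norm _); nra.
Qed.

End Exponential.

Arguments cexp_slope {R} a.

(** * A finite form of Kronecker's partial fractions *)

Lemma prod_nat_neq (F : comPzSemiRingType) (f : nat -> F) N l : (l < N)%N ->
  \prod_(0 <= j < N | j != l) f j =
  (\prod_(0 <= j < l) f j) * \prod_(0 <= j < N - l.+1) f (l.+1 + j)%N.
Proof.
move=> lN; rewrite (@big_cat_nat _ _ _ l) //=; last exact: ltnW.
congr (_ * _).
  rewrite big_nat_cond [RHS]big_nat_cond; apply: eq_bigl => j.
  by rewrite andbT; case: (ltnP j l) => // jl; rewrite (ltn_eqF jl).
rewrite big_ltn_cond // eqxx /= -{1}(add0n l.+1) big_addn.
rewrite big_nat_cond [RHS]big_nat_cond; apply: eq_big => j.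
  by case: (0 <= j < _)%N => //=; apply/negbT; rewrite gtn_eqF // addnS ltnS leq_addl.
by rewrite addnC.
Qed.

Section PartialFractions.
Variable F : fieldType.

(** Partial fractions with simple poles at the [(z l)^-1], over the common
    denominator: two polynomials of size at most [N] that agree at [N] points. *)
Lemma partial_fractions N (z c : nat -> F) (P : {poly F}) : (size P <= N)%N ->
  (forall i, (i < N)%N -> z i != 0) ->
  (forall i j, (i < N)%N -> (j < N)%N -> z i = z j -> i = j) ->
  (forall l, (l < N)%N ->
     P.[(z l)^-1] = c l * \prod_(0 <= j < N | j != l) (1 - z j / z l)) ->
  forall X, P.[X] =
    \sum_(0 <= l < N) c l * \prod_(0 <= j < N | j != l) (1 - z j * X).
Proof.
move=> sP z0 zI hP X.
pose G := \sum_(0 <= l < N)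
   c l *: \prod_(0 <= j < N | j != l) (1 - z j *: 'X).
have hG Y : G.[Y] = \sum_(0 <= l < N) c l * \prod_(0 <= j < N | j != l) (1 - z j * Y).
  rewrite horner_sum; apply: eq_bigr => l _; rewrite hornerZ horner_prod.
  by congr (_ * _); apply: eq_bigr => j _; rewrite !hornerE.
rewrite -hG; suff -> : P = G by [].
apply/eqP; rewrite -subr_eq0; apply/eqP.
apply: (@roots_geq_poly_eq0 _ _ [seq (z l)^-1 | l <- iota 0 N]).
- apply/allP => y /mapP[l]; rewrite mem_iota add0n => lN ->.
  rewrite /root hornerD hornerN hG hP // (bigD1_seq l) ?mem_index_iota ?iota_uniq //=.
  rewrite [X in _ - (_ + X)]big1_seq ?addr0.
    by rewrite subrr.
  move=> m /andP[ml]; rewrite mem_index_iota => mN; apply/eqP.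
  rewrite mulf_eq0 prodf_seq_eq0; apply/orP; right; apply/hasP; exists l.
    by rewrite mem_index_iota.
  by rewrite eq_sym ml divff ?z0 // subrr eqxx.
- rewrite map_inj_in_uniq ?iota_uniq // => i j; rewrite !mem_iota !add0n => iN jN.
  by move=> /invr_inj; apply: zI.
rewrite size_map size_iota; apply: leq_trans (size_polyD _ _) _.
rewrite geq_max sP size_polyN; apply: leq_trans (size_sum _ _ _) _.
apply/bigmax_leqP_seq => l; rewrite mem_index_iota => lN _.
apply: leq_trans (size_scale_leq _ _) _.
move: lN => /andP[_ lN]; rewrite (prod_nat_neq _ lN).
have hs (f : nat -> F) k : (size (\prod_(0 <= j < k) (1 - f j *: 'X))%R <= k.+1)%N.
  elim: k => [|k ih]; first by rewrite big_geq // size_poly1.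
  rewrite big_nat_recr //=; apply: leq_trans (size_polyMleq _ _) _.
  have h2 : (size (1 - f k *: 'X : {poly F})%R <= 2)%N.
    apply: leq_trans (size_polyD _ _) _; rewrite geq_max size_poly1 size_polyN.
    by rewrite (leq_trans (size_scale_leq _ _)) // size_polyX.
  by rewrite -subn1 leq_subLR (leq_trans (leq_add ih h2)) //; lia.
apply: leq_trans (size_polyMleq _ _) _.
have h1 := hs z l; have h2 := hs (fun j => z (l.+1 + j)%N) (N - l.+1)%N.
by rewrite -subn1 leq_subLR (leq_trans (leq_add h1 h2)) //; lia.
Qed.

End PartialFractions.

Section FiniteIdentity.
Variables (F : fieldType) (p : F).
Hypothesis p0 : p != 0.
Hypothesis pX : forall k, p ^+ k.+1 != 1.

(** The residues of the finite product are products of two values of [alpha],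
    up to powers of [- p]. *)
Definition alpha l := \prod_(0 <= i < l) ((1 + p ^+ i.*2.+1) / (1 - p ^+ i.*2.+2)).

Lemma expr_inj i j : p ^+ i = p ^+ j -> i = j.
Proof.
wlog ij : i j / (i <= j)%N.
  by move=> h e; have [ij|ij] := leqP i j; [exact: h|apply/esym/h => //; exact: ltnW].
rewrite -{1}(subnK ij) exprD => e.
have : p ^+ (j - i) = 1.
  by apply: (mulIf (expf_neq0 i p0)); rewrite -e mul1r.
case e2 : (j - i)%N => [|k]; last by move/eqP; rewrite (negPf (pX k)).
by move=> _; apply/eqP; rewrite eqn_leq ij /= -subn_eq0 e2.
Qed.

Lemma one_sub_pX k : 1 - p ^+ k.+1 != 0.
Proof. by rewrite subr_eq0 eq_sym. Qed.

Lemma prod_alpha N l : (l < N.+1)%N ->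
  \prod_(0 <= j < N) (1 + p ^+ j.*2.+1 / p ^+ l.*2) =
  (- p) ^+ l * alpha l * alpha (N - l) *
    \prod_(0 <= j < N.+1 | j != l) (1 - p ^+ j.*2 / p ^+ l.*2).
Proof.
move=> lN; rewrite prod_nat_neq // subSS.
rewrite (@big_cat_nat _ _ _ l) //=.
have -> : \prod_(l <= i < N) (1 + p ^+ i.*2.+1 / p ^+ l.*2) =
    alpha (N - l) * \prod_(0 <= j < N - l) (1 - p ^+ (l.+1 + j).*2 / p ^+ l.*2).
  rewrite -{1}(add0n l) big_addn -big_split /=; apply: eq_bigr => i _.
  have -> : (i + l).*2.+1 = (i.*2.+1 + l.*2)%N by lia.
  have -> : (l.+1 + i).*2 = (i.*2.+2 + l.*2)%N by lia.
  by rewrite !exprD !mulfK ?expf_neq0 // mulfVK ?one_sub_pX.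
have -> : \prod_(0 <= i < l) (1 + p ^+ i.*2.+1 / p ^+ l.*2) =
    (- p) ^+ l * alpha l * \prod_(0 <= j < l) (1 - p ^+ j.*2 / p ^+ l.*2).
  rewrite /alpha -[in (- p) ^+ l](subn0 l) -prodr_const_nat.
  rewrite [\prod_(0 <= i < l) (_ / _)]big_nat_rev -!big_split /=.
  apply: eq_big_nat => j /andP[_ jl]; rewrite add0n.
  have [k ->] : exists k, l = (j + k.+1)%N by exists (l - j.+1)%N; lia.
  have -> : (j + k.+1 - j.+1 = k)%N by lia.
  have -> : (j + k.+1).*2 = (j.*2 + k.*2.+2)%N by lia.
  rewrite exprD exprS [p ^+ k.*2.+1]exprS [p ^+ k.*2.+2]exprS [p ^+ k.*2.+1]exprS.
  have := one_sub_pX k.*2.+1; rewrite !exprS.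
  have := expf_neq0 j.*2 p0; have := expf_neq0 k.*2 p0.
  set u := p ^+ j.*2; set v := p ^+ k.*2 => u0 v0 w0.
  by field; rewrite u0 v0 p0 w0.
ring.
Qed.

Lemma finite_identity_raw N X : (forall j, (j < N.+1)%N -> 1 - p ^+ j.*2 * X != 0) ->
  (\prod_(0 <= j < N) (1 + p ^+ j.*2.+1 * X)) /
    (\prod_(0 <= j < N.+1) (1 - p ^+ j.*2 * X)) =
  \sum_(0 <= m < N.+1) (- p) ^+ m * alpha m * alpha (N - m) / (1 - p ^+ m.*2 * X).
Proof.
move=> X0.
pose P : {poly F} := \prod_(0 <= j < N) (1 + p ^+ j.*2.+1 *: 'X).
have hP Y : P.[Y] = \prod_(0 <= j < N) (1 + p ^+ j.*2.+1 * Y).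
  by rewrite horner_prod; apply: eq_bigr => j _; rewrite !hornerE.
have sP : (size P <= N.+1)%N.
  rewrite /P; elim: N {X0 hP P} => [|k ih]; first by rewrite big_geq // size_poly1.
  rewrite big_nat_recr //=; apply: leq_trans (size_polyMleq _ _) _.
  have h2 : (size (1 + p ^+ k.*2.+1 *: 'X : {poly F})%R <= 2)%N.
    apply: leq_trans (size_polyD _ _) _; rewrite geq_max size_poly1.
    by rewrite (leq_trans (size_scale_leq _ _)) // size_polyX.
  by rewrite -subn1 leq_subLR (leq_trans (leq_add ih h2)) //; lia.
have := @partial_fractions F N.+1 (fun j => p ^+ j.*2)
  (fun m => (- p) ^+ m * alpha m * alpha (N - m)) P sP.
move=> /(_ (fun i _ => expf_neq0 _ p0)).
move=> /(_ (fun i j _ _ e => double_inj (expr_inj e))).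
have hl l : (l < N.+1)%N -> P.[(p ^+ l.*2)^-1] =
   (- p) ^+ l * alpha l * alpha (N - l) *
   \prod_(0 <= j < N.+1 | j != l) (1 - p ^+ j.*2 / p ^+ l.*2).
  by move=> lN; rewrite hP prod_alpha.
move=> /(_ hl X); rewrite hP => ->; rewrite mulr_suml; apply: eq_big_nat => l /andP[_ lN].
rewrite [X in _ / X](bigD1_seq l) ?mem_index_iota ?iota_uniq //=.
have h1 := X0 l lN.
have h2 : \prod_(0 <= j < N.+1 | j != l) (1 - p ^+ j.*2 * X) != 0.
  rewrite prodf_seq_neq0; apply/allP => j; rewrite mem_index_iota => /andP[_ jN].
  by apply/implyP => _; exact: X0.
set u := \prod_(0 <= j < N.+1 | j != l) _ in h2 *.
set A := _ * alpha l * _; by field; rewrite h1 h2.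
Qed.

Lemma sum_around (V : nmodType) (f : nat -> V) n :
  \sum_(0 <= m < n + n) f m = \sum_(0 <= i < n) (f (n + i)%N + f (n - i.+1)%N).
Proof.
rewrite (@big_cat_nat _ _ _ n) ?leq_addr //= addrC big_split /=; congr (_ + _).
  rewrite -{1}(add0n n) big_addn addnK; apply: eq_bigr => i _; by rewrite addnC.
by rewrite big_nat_rev; apply: eq_bigr => i _; rewrite add0n.
Qed.

(** The identity [finite_identity_raw] at [X = x / p ^ (2 n + 2)], with the poles
    renumbered from the middle. As [n] grows both sides converge to the bilateral
    expansion of a quotient of theta functions of the variable [x]; only the values
    [x = -1] and [x = p] are needed. *)
Lemma finite_identity n x : (forall j, x * p ^+ j.*2 != 1) ->
    (forall j, x != p ^+ j.*2.+2) ->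
  (\prod_(0 <= k < n.+1) ((x + p ^+ k.*2.+1) / (x - p ^+ k.*2.+2))) *
  ((\prod_(0 <= j < n) (1 + x * p ^+ j.*2.+1)) /
    (\prod_(0 <= j < n.+1) (1 - x * p ^+ j.*2))) =
  \sum_(0 <= i < n.+1) alpha (n.+1 + i) * alpha (n - i) *
    ((- p) ^+ i / (1 - x * p ^+ i.*2) + (- p) ^+ i.+1 / (p ^+ i.*2.+2 - x)).
Proof.
move=> x1 x2.
pose X := x / p ^+ n.+1.*2.
have hX j : p ^+ (n.+1 + j).*2 * X = x * p ^+ j.*2.
  by rewrite /X doubleD exprD mulrC -mulrA mulKf ?expf_neq0.
have hX2 j : (j <= n)%N -> p ^+ (n - j).*2 * X = x / p ^+ j.*2.+2.
  move=> jn; rewrite /X mulrCA; congr (_ * _).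
  have -> : n.+1.*2 = ((n - j).*2 + j.*2.+2)%N by lia.
  by rewrite exprD invfM mulrA mulfV ?expf_neq0 // mul1r.
have d1 j : 1 - x * p ^+ j.*2 != 0 by rewrite subr_eq0 eq_sym.
have d2 j : 1 - x / p ^+ j.*2.+2 != 0.
  rewrite subr_eq0; apply/negP => /eqP e; have := x2 j.
  by rewrite -[x](mulfVK (expf_neq0 j.*2.+2 p0)) -e mul1r eqxx.
have d3 j : x - p ^+ j.*2.+2 != 0 by rewrite subr_eq0.
have X0 j : (j < (n.+1 + n).+1)%N -> 1 - p ^+ j.*2 * X != 0.
  move=> _; have [jn|jn] := leqP n.+1 j.
    by rewrite -(subnKC jn) hX.
  by rewrite -(subKn (jn : (j <= n)%N)) hX2 ?leq_subr.
have := finite_identity_raw X0.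
have -> : (n.+1 + n).+1 = (n.+1 + n.+1)%N by lia.
rewrite sum_around => e.
have np0 k : (- p) ^+ k != 0 by rewrite expf_neq0 // oppr_eq0.
apply: (mulfI (np0 n.+1)); transitivity (\sum_(0 <= i < n.+1)
   ((- p) ^+ (n.+1 + i) * alpha (n.+1 + i) * alpha (n.+1 + n - (n.+1 + i)) /
      (1 - p ^+ (n.+1 + i).*2 * X) +
    (- p) ^+ (n.+1 - i.+1) * alpha (n.+1 - i.+1) *
      alpha (n.+1 + n - (n.+1 - i.+1)) / (1 - p ^+ (n.+1 - i.+1).*2 * X))).
  have sh (f : nat -> F) m : \prod_(0 <= j < n.+1 + m) f j =
      (\prod_(0 <= j < n.+1) f j) * \prod_(0 <= j < m) f (n.+1 + j)%N.
    rewrite (@big_cat_nat _ _ _ n.+1) ?leq_addr //=; congr (_ * _).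
    rewrite -{1}(add0n n.+1) big_addn addnC addnK.
    by apply: eq_bigr => j _; rewrite addnC.
  rewrite -e {e} !sh invfM mulrACA [LHS]mulrA; congr (_ * _); last first.
    congr (_ / _); apply: eq_bigr => j _; last by rewrite hX.
    by rewrite [in RHS]exprS -mulrA hX mulrCA -exprS.
  rewrite -[in (- p) ^+ n.+1](subn0 n.+1) -prodr_const_nat.
  rewrite [X in _ = X / _]big_nat_rev [X in _ = _ / X]big_nat_rev /= !add0n.
  rewrite -prodf_div -!big_split /=; apply: eq_big_nat => j /andP[_ jn].
  rewrite subSS [p ^+ (n - j).*2.+1]exprS -mulrA hX2 //.
  have := d3 j; have := d2 j; rewrite !exprS.
  have := expf_neq0 j.*2 p0; set u := p ^+ j.*2 => u0 h2 h3.
  have h4 : p * (p * u) - x != 0 by rewrite -opprB oppr_eq0.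
  by field; rewrite p0 u0 h3 h4.
rewrite mulr_sumr; apply: eq_big_nat => i /andP[_ jn].
rewrite (subSS i n) hX hX2 //.
have -> : (n.+1 + n - (n.+1 + i) = n - i)%N by lia.
have -> : (n.+1 + n - (n - i) = n.+1 + i)%N by lia.
rewrite mulrDr mulrDr; congr (_ + _).
  by rewrite exprD; field; exact: d1.
have -> : (- p) ^+ n.+1 = (- p) ^+ (n - i) * (- p) ^+ i.+1.
  by rewrite -exprD; congr (_ ^+ _); lia.
have h : p ^+ i.*2.+2 = (- p) ^+ i.+1 * (- p) ^+ i.+1.
  by rewrite -exprMn mulrNN exprMn -exprD addnn.
have := d3 i; have := d2 i; have := np0 i.+1; rewrite h.
set a := (- p) ^+ i.+1 => a0 h2 h3.
have h4 : a * a - x != 0 by rewrite -opprB oppr_eq0.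
by field; rewrite a0 h4.
Qed.

End FiniteIdentity.

Opaque ComplexField.mulc ComplexField.invc ComplexField.addc ComplexField.oppc.

(** * Infinite products and the squares of theta series *)

Section InfiniteProducts.
Variable R : realType.
Local Notation C := R[i].

Lemma cvgc_bounded (u : nat -> C) (a : C) : u @ \oo --> a ->
  exists B : R, forall n, normc (u n) <= B.
Proof.
move=> /cvgcP /(_ 1 ltr01)[N hN].
exists (normc a + 1 + \sum_(0 <= k < N) normc (u k)) => n.
have s0 : 0 <= \sum_(0 <= k < N) normc (u k) by apply: sumr_ge0 => k _; exact: normc_ge0.
have [Nn|nN] := leqP N n.
  have h := hN n Nn; have := le_normcD (u n - a) a; rewrite subrK; lra.
rewrite (bigD1_seq n) ?mem_index_iota ?iota_uniq //=.
have := normc_ge0 a.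
have : 0 <= \sum_(i <- index_iota 0 N | i != n) normc (u i).
  by apply: sumr_ge0 => k _; exact: normc_ge0.
lra.
Qed.

Section Product.
Variables (a : nat -> C) (c r : R).
Hypotheses (c0 : 0 <= c) (r01 : 0 <= r < 1).
Hypothesis ha : forall k, normc (a k) <= c * r ^+ k.

Let P n := \prod_(0 <= k < n) (1 + a k).
Let B := expR (c / (1 - r)).

Lemma prod_bounded n : normc (P n) <= B.
Proof.
have h : normc (P n) <= expR (\sum_(0 <= k < n) c * r ^+ k).
  rewrite /P; elim: n => [|n ih]; first by rewrite !big_geq // normc1 expR0.
  rewrite !big_nat_recr //= normcM expRD; apply: ler_pM; rewrite ?normc_ge0 //.
  apply: le_trans (le_normcD _ _) _; rewrite normc1.
  by apply: le_trans (expR_ge1Dx _); rewrite lerD2l.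
apply: le_trans h _; rewrite ler_expR -mulr_sumr.
rewrite ler_wpM2l //; apply: le_trans (geometric_sum_le 0 n r01) _.
by rewrite expr0 mul1r.
Qed.

Lemma prod_increment n m : (n <= m)%N ->
  normc (P m - P n) <= B * c / (1 - r) * r ^+ n.
Proof.
move=> nm; have h : normc (P m - P n) <= \sum_(n <= k < m) B * c * r ^+ k.
  rewrite -(subnKC nm); elim: (m - n)%N => [|k ih].
    by rewrite addn0 subrr normc0 big_geq.
  rewrite addnS big_nat_recr ?leq_addr //= {1}/P big_nat_recr //= -/(P _).
  have -> : P (n + k) * (1 + a (n + k)%N) - P n =
     P (n + k)%N - P n + P (n + k)%N * a (n + k)%N by ring.
  apply: le_trans (le_normcD _ _) _; apply: lerD => //.
  rewrite normcM -mulrA; apply: ler_pM; rewrite ?normc_ge0 //.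
  exact: prod_bounded.
apply: le_trans h _; rewrite -mulr_sumr -!mulrA ler_wpM2l ?expR_ge0 //.
rewrite ler_wpM2l // [_^-1 * _]mulrC; exact: geometric_sum_le.
Qed.

Lemma prod_cvg : exists2 l : C, P @ \oo --> l &
  forall n, normc (P n - l) <= B * c / (1 - r) * r ^+ n.
Proof.
have K0 : 0 <= B * c / (1 - r).
  by case/andP: r01 => _ r1; rewrite divr_ge0 ?mulr_ge0 ?expR_ge0 // subr_ge0 ltW.
have [|l hl] := @cauchyc R P.
  move=> e e0; have [K hK] := small_tails_geometric (B * c / (1 - r)) r01 e0.
  exists K => n Kn; apply: le_trans (prod_increment Kn) _.
  by have := hK K K.+1 (leqnn K); rewrite big_nat1.
exists l => // n; rewrite normcBC.
apply: (cvgc_le (cvgcB hl (cvgc_cst (P n)))).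
by exists n => m; exact: prod_increment.
Qed.

End Product.

(** The factor of the eta-function that is a power series in [q]. *)
Definition euler (u : C) : C :=
  lim ((\prod_(1 <= k < n.+1) (1 - u ^+ k)) @[n --> \oo]).

Lemma etaE (tau : C) : eta tau = qexp (tau / 24) * euler (qexp tau).
Proof. by []. Qed.

Lemma euler_factor_le (u : C) (r : R) k : normc u <= r -> normc (- u ^+ k.+1) <= r * r ^+ k.
Proof.
move=> h; rewrite normcN normcX -exprS lerXn2r ?nnegrE ?normc_ge0 //.
exact: le_trans (normc_ge0 u) h.
Qed.

Lemma one_sub_expr_neq0 (u : C) k : normc u < 1 -> 1 - u ^+ k.+1 != 0.
Proof.
move=> h; rewrite subr_eq0; apply/negP => /eqP e.
have : normc (u ^+ k.+1) < 1 by rewrite normcX exprn_ilt1 // normc_ge0.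
by rewrite -e normc1 ltxx.
Qed.

Lemma one_sub_expr_ge (u : C) (r : R) k : normc u <= r -> r < 1 ->
  1 - r <= normc (1 - u ^+ k.+1).
Proof.
move=> h r1; apply: le_trans (normc_lowerD _ _); rewrite normc1 normcN normcX.
rewrite lerD2l lerN2; have u0 := normc_ge0 u.
have [r0 u1] : 0 <= r /\ normc u <= 1 by split; lra.
by apply: le_trans h; rewrite exprS ler_piMr // exprn_ile1.
Qed.

Lemma euler_cvg (u : C) : normc u < 1 ->
  (fun n => \prod_(0 <= k < n) (1 - u ^+ k.+1)) @ \oo --> euler u.
Proof.
move=> u1; have u01 : 0 <= normc u < 1 by rewrite normc_ge0.
have [l hl _] := @prod_cvg (fun k => - u ^+ k.+1) _ _ (normc_ge0 u) u01
  (fun k => euler_factor_le k (lexx _)).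
have e : (fun n => \prod_(1 <= k < n.+1) (1 - u ^+ k)) =
         (fun n => \prod_(0 <= k < n) (1 - u ^+ k.+1)).
  by apply/funext => n; rewrite big_add1.
by rewrite /euler e (cvg_lim _ hl).
Qed.

(** The inverses of the factors also form a convergent product, whose value is
    the inverse of [euler u]; hence [euler_neq0]. *)
Lemma euler_inv_cvg (u : C) : normc u < 1 -> exists l : C,
  (fun n => \prod_(0 <= k < n) (1 + u ^+ k.+1 / (1 - u ^+ k.+1))) @ \oo --> l.
Proof.
move=> u1; have u01 : 0 <= normc u < 1 by rewrite normc_ge0.
have [||l hl _] := @prod_cvg (fun k => u ^+ k.+1 / (1 - u ^+ k.+1))
    (normc u / (1 - normc u)) (normc u) _ u01.
- by rewrite divr_ge0 ?normc_ge0 // subr_ge0 ltW.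
- move=> k; rewrite normcM normcV mulrAC.
  have h := one_sub_expr_ge k (lexx (normc u)) u1.
  apply: ler_pM; rewrite ?normc_ge0 ?invr_ge0 ?normc_ge0 //.
    by have := euler_factor_le k (lexx (normc u)); rewrite normcN.
  by rewrite lef_pV2 ?posrE // ?(lt_le_trans _ h) // subr_gt0.
by exists l.
Qed.

Lemma euler_neq0 (u : C) : normc u < 1 -> euler u != 0.
Proof.
move=> u1; have [l hl] := euler_inv_cvg u1.
have := cvgcM (euler_cvg u1) hl.
have -> : (fun n => (\prod_(0 <= k < n) (1 - u ^+ k.+1)) *
   \prod_(0 <= k < n) (1 + u ^+ k.+1 / (1 - u ^+ k.+1))) = fun=> 1.
  apply/funext => n; rewrite -big_split /= big1 // => k _.
  by have h := one_sub_expr_neq0 k u1; rewrite mulrDr mulr1 mulrCA divff // mulr1 subrK.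
move=> h; have := cvgc_unique h (cvgc_cst 1).
by move=> e; apply/negP => /eqP e0; move: e; rewrite e0 mul0r => /esym/eqP; rewrite oner_eq0.
Qed.

End InfiniteProducts.

Section FieldIdentities.
Variable F : numFieldType.
Implicit Types a b c d : F.

Lemma sqr_div_div a b : b != 0 -> b ^+ 2 / a / b = b / a.
Proof. by move=> b0; rewrite expr2 mulrAC mulfK. Qed.

Lemma div_div_sqr a b c : b / c / (a / b) = b ^+ 2 / (c * a).
Proof. by rewrite !invfM invrK [a^-1 * b]mulrC mulrACA expr2. Qed.

Lemma div_double_sqr a b : a ^+ 2 / (2 * b ^+ 2) = a * a / (b * (2 * b)).
Proof. by rewrite [b * (2 * b)]mulrCA !expr2. Qed.

Lemma mul_double_neq0 a : a != 0 -> a * (2 * a) != 0.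
Proof. by move=> a0; rewrite !mulf_neq0 ?pnatr_eq0. Qed.

Lemma kronecker_value_theta4 a b c : a != 0 -> b != 0 -> c != 0 ->
  (a / b) ^+ 2 / (2 * (c / b) ^+ 2) / (b / (c * a)) ^+ 2 = a ^+ 4 / (2 * b ^+ 2).
Proof. by move=> a0 b0 c0; field; rewrite a0 b0 c0. Qed.

Lemma div_cancel_l a b c : a != 0 -> a * b / (a * c) = b / c.
Proof. by move=> a0; rewrite invfM mulrACA divff // mul1r. Qed.

Lemma kronecker_pair_theta2 a b c : a != 0 ->
  b / (1 - c) + - a * b / (a * c - a) = 2 * (b / (1 - c)).
Proof.
move=> a0; rewrite -[X in a * c - X]mulr1 -mulrBr -(opprB 1 c) mulrN mulNr invrN mulrNN div_cancel_l //.
by rewrite mulr_natl mulr2n.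
Qed.

Lemma kronecker_value_theta2 a b c : a != 0 -> b != 0 -> c != 0 ->
  2^-1 * (2 * (c / b * (c / b)) / (a / b * (a / b)) / (b / (c * a)) ^+ 2) =
  c ^+ 4 / b ^+ 2.
Proof. by move=> a0 b0 c0; field; rewrite a0 b0 c0. Qed.

Lemma half_double a : 2^-1 * (2 * a) = a.
Proof. by rewrite mulKf // pnatr_eq0. Qed.

Lemma kronecker_factor_theta4 a b : (-1 + a) / (-1 - b) = (1 - a) / (1 + b).
Proof.
have -> : -1 + a = - (1 - a) by rewrite opprB addrC.
have -> : -1 - b = - (1 + b) by rewrite opprD.
by rewrite invrN mulrNN.
Qed.

Lemma kronecker_factor_theta2 a b c : a != 0 -> (a + a * b) / (a - a * c) = (1 + b) / (1 - c).
Proof. by move=> a0; rewrite -{1 3}[a]mulr1 -mulrDr -mulrBr div_cancel_l. Qed.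

Lemma div_sqr_regroup a b c : a * (b * b) / (c * c) = a * b / c * (b / c).
Proof. by rewrite mulrACA -invfM mulrA. Qed.

Lemma div_regroup a b c d : a * b / (c * d) = a / c * (b / d).
Proof. by rewrite mulrACA -invfM. Qed.

End FieldIdentities.

Section Kronecker.
Variable R : realType.
Local Notation C := R[i].
Variable p : C.
Hypothesis p0 : p != 0.
Hypothesis p1 : normc p < 1.

Let O_ n : C := \prod_(0 <= k < n) (1 - p ^+ k.*2.+1).
Let Op n : C := \prod_(0 <= k < n) (1 + p ^+ k.*2.+1).
Let E_ n : C := \prod_(0 <= k < n) (1 - p ^+ k.*2.+2).
Let Ep n : C := \prod_(0 <= k < n) (1 + p ^+ k.*2.+2).

Let pX k : p ^+ k.+1 != 1.
Proof. by have := one_sub_expr_neq0 k p1; rewrite subr_eq0 eq_sym. Qed.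

Let normX k : normc (p ^+ k.+1) < 1.
Proof. by rewrite normcX exprn_ilt1 // normc_ge0. Qed.

Let prod_sub_neq0 (u : C) n : normc u < 1 ->
  \prod_(0 <= k < n) (1 - u ^+ k.+1) != 0.
Proof.
move=> u1; rewrite prodf_seq_neq0; apply/allP => k _; apply/implyP => _.
exact: one_sub_expr_neq0.
Qed.

Let E_E n : E_ n = \prod_(0 <= k < n) (1 - (p ^+ 2) ^+ k.+1).
Proof. by apply: eq_bigr => k _; rewrite -exprM mul2n. Qed.

Let E_cvg : E_ @ \oo --> euler (p ^+ 2).
Proof. by apply: (cvgc_ext (fun n => esym (E_E n))); exact: euler_cvg. Qed.

Let E_neq0 n : E_ n != 0.
Proof. by rewrite E_E prod_sub_neq0. Qed.

Let O_neq0 n : O_ n != 0.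
Proof.
rewrite prodf_seq_neq0; apply/allP => k _; apply/implyP => _.
exact: one_sub_expr_neq0.
Qed.

Lemma prod_odd_even (V : comPzSemiRingType) (f : nat -> V) n :
  \prod_(0 <= k < n.*2) f k =
  (\prod_(0 <= k < n) f k.*2) * \prod_(0 <= k < n) f k.*2.+1.
Proof.
elim: n => [|n ih]; first by rewrite !big_geq // mulr1.
rewrite doubleS !big_nat_recr //= ih -!mulrA; congr (_ * _).
by rewrite mulrCA.
Qed.

Lemma n_le_double n : (n <= n.*2)%N. Proof. by rewrite -addnn leq_addr. Qed.

Let O_cvg : O_ @ \oo --> euler p / euler (p ^+ 2).
Proof.
have h := cvgc_sub n_le_double (euler_cvg p1).
have := cvgcM h (cvgcV E_cvg (euler_neq0 (normX 1))).
apply: cvgc_ext => n; rewrite prod_odd_even mulfK //; exact: E_neq0.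
Qed.

Let Ep_cvg : Ep @ \oo --> euler (p ^+ 4) / euler (p ^+ 2).
Proof.
have := cvgcM (euler_cvg (normX 3)) (cvgcV E_cvg (euler_neq0 (normX 1))).
apply: cvgc_ext => n; apply: (mulIf (E_neq0 n)); rewrite mulfVK //.
rewrite -big_split /=; apply: eq_bigr => k _.
have -> : (p ^+ 4) ^+ k.+1 = p ^+ k.*2.+2 * p ^+ k.*2.+2.
  by rewrite -exprM -exprD; congr (_ ^+ _); lia.
ring.
Qed.

Let Op_cvg : Op @ \oo --> euler (p ^+ 2) ^+ 2 / (euler (p ^+ 4) * euler p).
Proof.
have h := cvgc_sub n_le_double (euler_cvg (normX 1)).
have h2 := cvgcM h (cvgcV (euler_cvg (normX 3)) (euler_neq0 (normX 3))).
have h0 : euler p / euler (p ^+ 2) != 0.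
  by rewrite mulf_neq0 ?invr_eq0 ?euler_neq0.
have := cvgcM h2 (cvgcV O_cvg h0).
have -> : euler (p ^+ 2) * (euler (p ^+ 4))^-1 * (euler p / euler (p ^+ 2))^-1 =
   euler (p ^+ 2) ^+ 2 / (euler (p ^+ 4) * euler p).
  exact: div_div_sqr.
apply: cvgc_ext => n.
apply: (mulIf (O_neq0 n)); rewrite mulfVK ?O_neq0 // prod_odd_even.
have -> : \prod_(0 <= k < n) (1 - (p ^+ 2) ^+ k.*2.+2) =
          \prod_(0 <= k < n) (1 - (p ^+ 4) ^+ k.+1).
  by apply: eq_bigr => k _; rewrite -!exprM; congr (1 - _ ^+ _); lia.
rewrite mulfK ?prod_sub_neq0 // -big_split /=; apply: eq_bigr => k _.
have -> : (p ^+ 2) ^+ k.*2.+1 = p ^+ k.*2.+1 * p ^+ k.*2.+1.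
  by rewrite -exprM -exprD; congr (_ ^+ _); lia.
ring.
Qed.

Let one_add_neq0 k : 1 + p ^+ k.*2 != 0.
Proof.
case: k => [|k]; first by rewrite expr0 (pnatr_eq0 _ 2).
rewrite addrC addr_eq0; apply/negP => /eqP e.
by have := normX k.*2.+1; rewrite -doubleS e normcN normc1 ltxx.
Qed.

Let prod_even_shift n : \prod_(0 <= j < n.+1) (1 + p ^+ j.*2) = 2 * Ep n.
Proof. by rewrite big_nat_recl. Qed.

Let al := euler (p ^+ 2) / (euler (p ^+ 4) * euler p).

Let alpha_cvg : alpha p @ \oo --> al.
Proof.
have := cvgcM Op_cvg (cvgcV E_cvg (euler_neq0 (normX 1))).
have -> : euler (p ^+ 2) ^+ 2 / (euler (p ^+ 4) * euler p) * (euler (p ^+ 2))^-1 = al.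
  exact: (sqr_div_div (euler (p ^+ 4) * euler p) (euler_neq0 (normX 1))).
by apply: cvgc_ext => n; rewrite /alpha -prodf_div.
Qed.

Let al_neq0 : al != 0.
Proof.
apply: mulf_neq0 (euler_neq0 (normX 1)) (invr_neq0 _).
exact: mulf_neq0 (euler_neq0 (normX 3)) (euler_neq0 p1).
Qed.

(** The finite identity passes to the limit by [tannery], since the residues
    converge to [al ^ 2] and stay bounded. *)
Lemma kronecker_limit (s : nat -> C) (u : nat -> C) (l : C) (c : R) :
  (forall n, u n.+1 = \sum_(0 <= i < n.+1)
     alpha p (n.+1 + i) * alpha p (n - i) * s i) ->
  u @ \oo --> l -> (forall i, normc (s i) <= c * normc p ^+ i) ->
  (fun n => \sum_(0 <= i < n) s i) @ \oo --> l / al ^+ 2.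
Proof.
move=> hu ul hs; have [B hB] := cvgc_bounded alpha_cvg.
have B0 : 0 <= B := le_trans (normc_ge0 _) (hB 0%N).
have p01 : 0 <= normc p < 1 by rewrite normc_ge0.
have := @tannery R (fun n i => alpha p (n + i) * alpha p (n - i.+1) * s i)
  (fun i => al * al * s i) (fun k => (B * B * c) * normc p ^+ k) 0 0
  (small_tails_geometric _ p01).
have t1 k : (fun n => alpha p (n + k)) @ \oo --> al.
  exact: (cvgc_sub (fun n => leq_addr k n) alpha_cvg).
have t2 k : (fun n => alpha p (n - k.+1)) @ \oo --> al.
  apply: (@cvgc_shiftn _ _ _ k.+1); apply: cvgc_ext alpha_cvg => n.
  by rewrite addnK.
move=> /(_ (fun k => cvgcM (cvgcM (t1 k) (t2 k)) (cvgc_cst (s k)))).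
have t3 n k : (0 <= n)%N -> (0 <= k < n)%N ->
    normc (alpha p (n + k) * alpha p (n - k.+1) * s k) <= B * B * c * normc p ^+ k.
  move=> _ _; rewrite !normcM -(mulrA (B * B)).
  apply: ler_pM; rewrite ?mulr_ge0 ?normc_ge0 //.
  by apply: ler_pM; rewrite ?normc_ge0.
move=> /(_ t3) h.
have := cvgcZ (al ^+ 2)^-1 (cvgcB ul h); rewrite subr0 [X in _ --> X]mulrC => h2.
apply: (@cvgc_near R _ _ _ 1 _ h2) => -[//|n] _.
rewrite hu -sumrB; set S := \sum_(0 <= i < n.+1) s i.
have -> : \sum_(0 <= i < n.+1) (alpha p (n.+1 + i) * alpha p (n - i) * s i -
     (alpha p (n.+1 + i) * alpha p (n.+1 - i.+1) * s i - al * al * s i)) =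
   al ^+ 2 * S.
  by rewrite mulr_sumr; apply: eq_bigr => i _; rewrite subSS subKr expr2.
by rewrite mulKf // expf_neq0.
Qed.

(** The Lambert series of half the square of the theta series [theta_4], with the
    terms of index [i] and [- (i + 1)] grouped: the case [x = -1]. *)
Lemma lambert_theta4 :
  (fun n => \sum_(0 <= i < n) ((- p) ^+ i / (1 + p ^+ i.*2) +
     (- p) ^+ i.+1 / (1 + p ^+ i.+1.*2))) @ \oo -->
  euler p ^+ 4 / (2 * euler (p ^+ 2) ^+ 2).
Proof.
pose u n := O_ n * O_ n.-1 / (Ep n * (2 * Ep n.-1)).
have e1 := euler_neq0 p1; have e2 := euler_neq0 (normX 1).
have e4 := euler_neq0 (normX 3).
pose l := (euler p / euler (p ^+ 2)) ^+ 2 / (2 * (euler (p ^+ 4) / euler (p ^+ 2)) ^+ 2).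
have ul : u @ \oo --> l.
  have hO := cvgcM O_cvg (cvgc_pred O_cvg).
  have hE := cvgcM Ep_cvg (cvgcZ 2 (cvgc_pred Ep_cvg)).
  have n0 : euler (p ^+ 4) / euler (p ^+ 2) *
       (2 * (euler (p ^+ 4) / euler (p ^+ 2))) != 0.
    exact: mul_double_neq0 (mulf_neq0 e4 (invr_neq0 e2)).
  have := cvgcM hO (cvgcV hE n0).
  have -> : l = euler p / euler (p ^+ 2) * (euler p / euler (p ^+ 2)) /
      (euler (p ^+ 4) / euler (p ^+ 2) * (2 * (euler (p ^+ 4) / euler (p ^+ 2)))).
    exact: div_double_sqr.
  exact.
have bnd k : normc (1 + p ^+ k.*2)^-1 <= 1 + (1 - normc p)^-1.
  have i0 : 0 < (1 - normc p)^-1 by rewrite invr_gt0 subr_gt0.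
  rewrite normcV; case: k => [|k].
    have -> : normc (1 + p ^+ 0.*2) = 2 by rewrite expr0 -(normc_nat R 2).
    by lra.
  have h : 1 - normc p <= normc (1 + p ^+ k.+1.*2).
    apply: le_trans (normc_lowerD _ _); rewrite normc1 lerD2l lerN2.
    rewrite normcX doubleS exprS ler_piMr ?normc_ge0 // exprn_ile1 ?normc_ge0 //.
    exact: ltW.
  apply: (@le_trans _ _ (1 - normc p)^-1); last by lra.
  by rewrite lef_pV2 ?posrE ?subr_gt0 // (lt_le_trans _ h) // subr_gt0.
have hs i : normc ((- p) ^+ i / (1 + p ^+ i.*2) +
     (- p) ^+ i.+1 / (1 + p ^+ i.+1.*2)) <= (2 * (1 + (1 - normc p)^-1)) * normc p ^+ i.
  apply: le_trans (le_normcD _ _) _; rewrite !normcM !normcX normcN exprS.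
  have n0 : 0 <= normc p ^+ i by rewrite exprn_ge0 // normc_ge0.
  have h1 := ler_wpM2l n0 (bnd i); have h2 := ler_wpM2l n0 (bnd i.+1).
  have h3 : normc p * (normc p ^+ i * normc (1 + p ^+ i.+1.*2)^-1) <=
            normc p ^+ i * normc (1 + p ^+ i.+1.*2)^-1.
    by rewrite ler_piMl ?mulr_ge0 ?normc_ge0 // ltW.
  rewrite -mulrA; lra.
have := kronecker_limit _ ul hs.
have -> : l / al ^+ 2 = euler p ^+ 4 / (2 * euler (p ^+ 2) ^+ 2).
  exact: (kronecker_value_theta4 e1 e2 e4).
apply=> n; have h1 j : -1 * p ^+ j.*2 != 1.
  by rewrite mulN1r eqr_oppLR -addr_eq0 addrC one_add_neq0.
have h2 j : -1 != p ^+ j.*2.+2.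
  by rewrite eq_sym -addr_eq0 addrC -doubleS one_add_neq0.
have := finite_identity p0 pX n h1 h2.
have -> : \prod_(0 <= k < n.+1) ((-1 + p ^+ k.*2.+1) / (-1 - p ^+ k.*2.+2)) =
    O_ n.+1 / Ep n.+1.
  rewrite -prodf_div; apply: eq_bigr => k _.
  exact: kronecker_factor_theta4.
have -> : \prod_(0 <= j < n) (1 + -1 * p ^+ j.*2.+1) = O_ n.
  by apply: eq_bigr => j _; rewrite mulN1r.
have -> : \prod_(0 <= j < n.+1) (1 - -1 * p ^+ j.*2) = 2 * Ep n.
  by rewrite -prod_even_shift; apply: eq_bigr => j _; rewrite mulN1r opprK.
rewrite (_ : u n.+1 = O_ n.+1 / Ep n.+1 * (O_ n / (2 * Ep n))); last exact: div_regroup.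
move=> ->; apply: eq_bigr => i _.
by rewrite mulN1r !opprK [p ^+ _ + 1]addrC.
Qed.

(** The Lambert series of the square of the theta series [theta_2], up to the
    factor [4 p ^ (1/2)]: the case [x = p], where the two terms of a pair agree. *)
Lemma lambert_theta2 :
  (fun n => \sum_(0 <= i < n) (- p) ^+ i / (1 - p ^+ i.*2.+1)) @ \oo -->
  euler (p ^+ 4) ^+ 4 / euler (p ^+ 2) ^+ 2.
Proof.
pose u n := 2 * (Ep n.-1 * Ep n.-1) / (O_ n * O_ n).
have e1 := euler_neq0 p1; have e2 := euler_neq0 (normX 1).
have e4 := euler_neq0 (normX 3).
pose l := 2 * (euler (p ^+ 4) / euler (p ^+ 2) * (euler (p ^+ 4) / euler (p ^+ 2)))
   / (euler p / euler (p ^+ 2) * (euler p / euler (p ^+ 2))).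
have pred_cvg := cvgc_pred Ep_cvg.
have q0 := mulf_neq0 e1 (invr_neq0 e2).
have ul : u @ \oo --> l.
  exact (cvgcM (cvgcZ 2 (cvgcM pred_cvg pred_cvg))
     (cvgcV (cvgcM O_cvg O_cvg) (mulf_neq0 q0 q0))).
pose s i := 2 * ((- p) ^+ i / (1 - p ^+ i.*2.+1)).
have hs i : normc (s i) <= (2 * (1 - normc p)^-1) * normc p ^+ i.
  rewrite /s (normcM 2) normc_nat normcM normcX normcN normcV -mulrA.
  rewrite ler_wpM2l // mulrC ler_wpM2r ?exprn_ge0 ?normc_ge0 //.
  have h := one_sub_expr_ge i.*2 (lexx (normc p)) p1.
  by rewrite lef_pV2 ?posrE ?subr_gt0 // (lt_le_trans _ h) // subr_gt0.
have hu n : u n.+1 =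
    \sum_(0 <= i < n.+1) alpha p (n.+1 + i) * alpha p (n - i) * s i.
  have h1 j : p * p ^+ j.*2 != 1 by rewrite -exprS.
  have h2 j : p != p ^+ j.*2.+2.
    by apply/negP => /eqP /(@expr_inj _ _ p0 pX 1).
  have := finite_identity p0 pX n h1 h2.
  have -> : \prod_(0 <= k < n.+1) ((p + p ^+ k.*2.+1) / (p - p ^+ k.*2.+2)) =
      2 * Ep n / O_ n.+1.
    rewrite -prod_even_shift -prodf_div; apply: eq_bigr => k _.
    by have := @kronecker_factor_theta2 _ p (p ^+ k.*2) (p ^+ k.*2.+1) p0; rewrite -!exprS.
  have -> : \prod_(0 <= j < n) (1 + p * p ^+ j.*2.+1) = Ep n.
    by apply: eq_bigr => j _; rewrite -exprS.
  have -> : \prod_(0 <= j < n.+1) (1 - p * p ^+ j.*2) = O_ n.+1.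
    by apply: eq_bigr => j _; rewrite -exprS.
  rewrite (_ : u n.+1 = 2 * Ep n / O_ n.+1 * (Ep n / O_ n.+1)); last exact: div_sqr_regroup.
  move=> ->; apply: eq_bigr => i _; congr (_ * _).
  by have := @kronecker_pair_theta2 _ p ((- p) ^+ i) (p ^+ i.*2.+1) p0; rewrite -!exprS.
have := cvgcZ 2^-1 (kronecker_limit hu ul hs).
have -> : 2^-1 * (l / al ^+ 2) = euler (p ^+ 4) ^+ 4 / euler (p ^+ 2) ^+ 2.
  exact: (kronecker_value_theta2 e1 e2 e4).
apply: cvgc_ext => n; rewrite mulr_sumr; apply: eq_bigr => i _.
exact: half_double.
Qed.

End Kronecker.

(** * The partial fractions of the cosecant *)

Section RootsOfUnity.
Variable F : fieldType.

(** Partial fractions of [M.*2%:R * w ^+ M / (1 - w ^+ M.*2)] at the roots of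
    unity of order [M.*2]: expand each geometric series and use orthogonality. *)
Lemma alternating_sum_roots M (zeta w : F) : zeta ^+ M = -1 ->
    (forall k, (0 < k < M.*2)%N -> zeta ^+ k != 1) -> w ^+ M.*2 != 1 ->
  \sum_(0 <= j < M.*2) (-1) ^+ j / (1 - w * zeta ^+ j) =
  M.*2%:R * w ^+ M / (1 - w ^+ M.*2).
Proof.
move=> zM zk wN; set N := M.*2 in zk wN *.
have zN : zeta ^+ N = 1 by rewrite /N -addnn exprD zM mulrNN mulr1.
have w1 : 1 - w ^+ N != 0 by rewrite subr_eq0 eq_sym.
have uN j : (w * zeta ^+ j) ^+ N = w ^+ N.
  by rewrite exprMn -exprM mulnC exprM zN expr1n mulr1.
have inv j : (1 - w * zeta ^+ j)^-1 =
    (\sum_(0 <= l < N) (w * zeta ^+ j) ^+ l) / (1 - w ^+ N).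
  have h : (1 - w * zeta ^+ j) * \sum_(0 <= l < N) (w * zeta ^+ j) ^+ l = 1 - w ^+ N.
    by rewrite geometric_sum uN.
  have h0 : 1 - w * zeta ^+ j != 0.
    by apply/negP => /eqP e; move: w1; rewrite -h e mul0r eqxx.
  by rewrite -h invfM mulrCA divff ?mulr1 //; apply/negP => /eqP e;
     move: w1; rewrite -h e mulr0 eqxx.
under eq_bigr do rewrite inv mulrA.
rewrite -mulr_suml; congr (_ / _).
under eq_bigr do rewrite mulr_sumr.
rewrite exchange_big_nat /=.
have term l : \sum_(0 <= j < N) (-1) ^+ j * (w * zeta ^+ j) ^+ l =
    w ^+ l * \sum_(0 <= j < N) (zeta ^+ (l + M)) ^+ j.
  rewrite mulr_sumr; apply: eq_bigr => j _.
  by rewrite -zM exprMn mulrCA; congr (_ * _); rewrite -!exprM -exprD; congr (_ ^+ _); lia.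
under eq_bigr do rewrite term.
case: (posnP M) => [M0|Mgt0].
  by rewrite /N M0 big_geq // mul0r.
have MN : (M < N)%N by rewrite /N -addnn -ltn_subLR ?leqnn // subnn.
rewrite (bigD1_seq M) ?mem_index_iota ?iota_uniq //=.
rewrite [X in _ + X]big1_seq ?addr0.
  rewrite addnn zN; under eq_bigr do rewrite expr1n.
  by rewrite sumr_const_nat subn0 mulrC.
move=> l /andP[lM]; rewrite mem_index_iota => /andP[_ lN].
have z1 : zeta ^+ (l + M) != 1.
  have [lM1|lM1] := ltnP (l + M) N; first by apply: zk; rewrite lM1 andbT; lia.
  have -> : (l + M = N + (l - M))%N by rewrite /N -addnn; lia.
  by rewrite exprD zN mul1r; apply: zk; rewrite /N -addnn in lM1 lN *; apply/andP; split; lia.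
have z1' : 1 - zeta ^+ (l + M) != 0 by rewrite subr_eq0 eq_sym.
apply/eqP; rewrite mulf_eq0; apply/orP; right.
rewrite -(inj_eq (mulfI z1')) mulr0 geometric_sum; apply/eqP.
by rewrite -exprM mulnC exprM zN expr1n subrr.
Qed.

Lemma sum_pairs (f : nat -> F) n :
  \sum_(0 <= k < n.*2) f k = \sum_(0 <= k < n) (f k.*2 + f k.*2.+1).
Proof.
elim: n => [|n ih]; first by rewrite !big_geq.
by rewrite doubleS !big_nat_recr //= ih addrA.
Qed.

End RootsOfUnity.

Section FieldIdentities.
Variable F : fieldType.
Implicit Types a b c : F.

Lemma sub_inv a b : a != 0 -> b != 0 -> a^-1 - b^-1 = (b - a) / (a * b).
Proof. by move=> a0 b0; field; rewrite a0 b0. Qed.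

Lemma sub_scaled_one_sub a b c : a * (1 - b * c) - a * (1 - b) = b * (- (a * (c - 1))).
Proof. by ring. Qed.

Lemma rescaled_sub a b c d e : a != 0 ->
  - a * (b + c - (b + c - (- a^-1 * d + - a^-1 * e))) = d + e.
Proof. by move=> a0; field. Qed.

End FieldIdentities.

Section Cosecant.
Variable R : realType.
Local Notation C := R[i].

Definition twopii : C := (2 * pi)%:C * 'i.

Lemma twopii_neq0 : twopii != 0.
Proof.
rewrite /twopii mulf_eq0 negb_or; apply/andP; split.
  by apply: lt0r_neq0; rewrite ltcR mulr_gt0 ?pi_gt0.
by rewrite eq_complex /= oner_eq0 andbF.
Qed.

Lemma qexp_cexp (z : C) : qexp z = cexp (twopii * z).
Proof. by []. Qed.

Lemma qexp_far_from_1 (z : C) : `|complex.Re z| <= 5 / 8 ->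
  `|complex.Re z| / 2 <= normc (1 - qexp z).
Proof.
move=> hz; rewrite qexpE.
have p0 : 0 < pi :> R by exact: pi_gt0.
have p2 : 1 <= pi / 2 :> R by exact: pihalf_ge1.
have pn : `|2 * pi * complex.Re z| = 2 * pi * `|complex.Re z|.
  by rewrite normrM ger0_norm // mulr_ge0 // ltW.
apply: le_trans (cexp_far_from_1 _ _); rewrite pn.
  have := normr_ge0 (complex.Re z); nra.
nra.
Qed.

Lemma Re_natdiv (z : C) n : complex.Re (z / n%:R) = complex.Re z / n%:R.
Proof.
have -> : (n%:R : C)^-1 = (n%:R^-1 : R)%:C.
  by rewrite -(rmorph_nat (real_complex R)) fmorphV.
by rewrite mulrC ReMreal mulrC.
Qed.

Lemma Im_natdiv (z : C) n : complex.Im (z / n%:R) = complex.Im z / n%:R.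
Proof.
have -> : (n%:R : C)^-1 = (n%:R^-1 : R)%:C.
  by rewrite -(rmorph_nat (real_complex R)) fmorphV.
by rewrite mulrC ImMreal mulrC.
Qed.

Lemma Re_nat n : complex.Re (n%:R : C) = n%:R.
Proof. by rewrite -(rmorph_nat (real_complex R)). Qed.

Lemma Re_int (m : int) : complex.Re (m%:~R : C) = m%:~R.
Proof. by rewrite -(rmorph_int (real_complex R)). Qed.

Lemma Im_int (m : int) : complex.Im (m%:~R : C) = 0.
Proof. by rewrite -(rmorph_int (real_complex R)). Qed.

(** A lower bound for [1 - qexp x] in terms of the distance from [x] to the
    integers shows that the roots of unity used below are primitive. *)
Lemma qexp_root_neq1 (N k : nat) : (0 < k < N)%N -> qexp (k%:R / N%:R : C) != 1.
Proof.
move=> /andP[k0 kN].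
have N0 : 0 < (N%:R : R) by rewrite ltr0n (ltn_trans k0).
have far (x : C) : complex.Re x != 0 -> `|complex.Re x| <= 5 / 8 -> qexp x != 1.
  move=> x0 /qexp_far_from_1 h; apply/negP => /eqP e; move: h.
  by rewrite e subrr normc0 ler_pdivrMr // mul0r normr_le0 (negPf x0).
have [h|h] := leqP k.*2 N.
  apply: far; rewrite Re_natdiv Re_nat.
    by rewrite mulf_neq0 ?invr_eq0 ?pnatr_eq0 -?lt0n // (ltn_trans k0).
  rewrite ger0_norm ?divr_ge0 // ler_pdivrMr //.
  have : (k.*2%:R : R) <= N%:R by rewrite ler_nat.
  by rewrite -addnn natrD; have := ler0n R k; lra.
have -> : (k%:R / N%:R : C) = - ((N - k)%:R / N%:R) + 1.
  have NC : (N%:R : C) != 0 by rewrite pnatr_eq0 -lt0n (ltn_trans k0).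
  by rewrite natrB ?(ltnW kN) // mulrBl divff // opprB subrK.
have Nk : 0 < ((N - k)%:R : R) by rewrite ltr0n subn_gt0.
rewrite qexpD1; apply: far; rewrite ReN Re_natdiv Re_nat.
  by rewrite oppr_eq0 mulf_neq0 ?invr_eq0 ?gt_eqF.
rewrite normrN ger0_norm ?divr_ge0 // ler_pdivrMr //.
have : ((N - k).*2%:R : R) <= N%:R by rewrite ler_nat; lia.
by rewrite -addnn natrD; lra.
Qed.

(** Grouping the terms of index [2 c] and [2 c + 1] of the alternating series
    makes it absolutely convergent. *)
Definition csc_pair (z : C) (c : int) : C :=
  (z + (2 * c)%:~R)^-1 - (z + (2 * c)%:~R + 1)^-1.

Section Expansion.
Variable z : C.
Hypothesis z1 : qexp z != 1.
Let x := complex.Re z.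

(* The denominators of the partial fractions, normalized to have a limit. *)
Let Y (N : nat) (m : int) : C := N%:R * (1 - qexp ((z + m%:~R) / N%:R)).

Let zm_neq0 (m : int) : z + m%:~R != 0.
Proof.
apply/negP; rewrite addr_eq0 => /eqP e.
by move: z1; rewrite e -mulrNz qexp_int eqxx.
Qed.

Let Y_cvg (m : int) : (fun L => Y (4 * L) m) @ \oo --> - (twopii * (z + m%:~R)).
Proof.
have := cvgc_sub (fun n => leq_pmull n (isT : (0 < 4)%N)) (cexp_slope (twopii * (z + m%:~R))).
move=> /(cvgcZ (-1)); rewrite mulN1r; apply: cvgc_ext => L.
by rewrite /Y qexp_cexp [in RHS]mulrA mulN1r -mulrN opprB.
Qed.

Let pair (L : nat) (c : int) : C := (Y (4 * L) (2 * c))^-1 - (Y (4 * L) (2 * c + 1))^-1.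

Let pair_cvg (c : int) : (fun L => pair L c) @ \oo --> - twopii^-1 * csc_pair z c.
Proof.
have n0 m : - (twopii * (z + m%:~R)) != 0.
  by rewrite oppr_eq0; exact: mulf_neq0 twopii_neq0 (zm_neq0 m).
have := cvgcB (cvgcV (@Y_cvg (2 * c)) (n0 _)) (cvgcV (@Y_cvg (2 * c + 1)) (n0 _)).
rewrite /csc_pair -addrA -[X in (_ + (_ + X))^-1]/((1 : int)%:~R) -rmorphD.
by rewrite !invrN !invfM -opprD -mulrBr mulNr.
Qed.

(* The finite expansion [alternating_sum_roots] for the roots of unity of order
   [4 L], with [w] chosen so that the index runs symmetrically around 0. *)
Let pair_sum (L : nat) : (0 < L)%N ->
  \sum_(0 <= i < L) (pair L i%:Z + pair L (- (i.+1)%:Z)) =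
  qexp (z / 2) / (1 - qexp z).
Proof.
move=> L0; pose N := (4 * L)%N.
have N0 : (0 < N)%N by rewrite muln_gt0.
have NC : (N%:R : C) != 0 by rewrite pnatr_eq0 -lt0n.
have NE : N = (2 * L).*2 by rewrite /N; lia.
pose w : C := qexp ((z - (2 * L)%:R) / N%:R).
pose zeta : C := qexp (1 / N%:R).
have zX j : zeta ^+ j = qexp (j%:R / N%:R).
  by rewrite /zeta -qexpMn mulrA mulr1.
have half : ((2 * L)%:R / N%:R : C) = 2^-1.
  rewrite NE -addnn natrD -mulr2n -[X in _ / X]mulr_natl invfM mulrCA divff ?mulr1 //.
  by rewrite pnatr_eq0 muln_eq0 -lt0n.
have zM : zeta ^+ (2 * L) = -1 by rewrite zX half qexp_half.
have zk k : (0 < k < (2 * L).*2)%N -> zeta ^+ k != 1.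
  by rewrite -NE => h; rewrite zX qexp_root_neq1.
have wM : w ^+ (2 * L) = qexp (z / 2).
  rewrite /w -qexpMn mulrCA half mulrBl qexpD qexpN.
  have -> : ((2 * L)%:R / 2 : C) = L%:R by rewrite natrM mulrC mulKf ?pnatr_eq0.
  by rewrite qexp_nat invr1 mulr1.
have wN : w ^+ (2 * L).*2 = qexp z.
  rewrite -NE /w -qexpMn mulrC mulfVK // qexpD qexpN qexp_nat.
  by rewrite invr1 mulr1.
have w1 : w ^+ (2 * L).*2 != 1 by rewrite wN.
have := alternating_sum_roots zM zk w1.
rewrite wM wN sum_pairs mul2n -addnn sum_around => e.
have term j (m : int) : m = j%:Z - (2 * L)%:Z ->
   1 / (1 - w * zeta ^+ j) = N%:R * (Y N m)^-1.
  move=> ->; rewrite /Y invfM mulrA divff // zX /w -qexpD -mulrDl.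
  have -> : z - (2 * L)%:R + j%:R = z + (j%:Z - (2 * L)%:Z)%:~R.
    by rewrite rmorphB /= -addrA [- _ + _]addrC.
  by [].
have NE2 : (L + L).*2 = N by rewrite /N; lia.
rewrite NE2 in e; apply: (mulfI NC); rewrite mulrA -e mulr_sumr.
apply: eq_big_nat => i /andP[_ iL]; rewrite mulrDr /pair !mulrBr; congr (_ + _).
  rewrite -signr_odd odd_double expr0 -signr_odd oddS odd_double expr1 mulN1r.
  by rewrite -(@term (L + i).*2) -1?(@term (L + i).*2.+1) ?mul1r //; lia.
rewrite -signr_odd odd_double expr0 -signr_odd oddS odd_double expr1 mulN1r.
by rewrite -(@term (L - i.+1).*2) -1?(@term (L - i.+1).*2.+1) ?mul1r //; lia.
Qed.

Let pair_bound : exists B : R, forall L (c : int) (i : nat),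
  2 * `|x| <= L%:R -> 2 * `|x| <= i.+1%:R ->
  (i.+1 <= absz (2 * c)%R <= 2 * L)%N -> (i.+1 <= absz (2 * c + 1)%R <= 2 * L)%N ->
  normc (pair L c) <= B / (i.+1%:R) ^+ 2.
Proof.
have [B hB] := cvgc_bounded (cexp_slope (twopii * 1)).
pose E := expR (2 * pi * `|complex.Im z|).
have B0 : 0 <= B := le_trans (normc_ge0 _) (hB 0%N).
exists (16 * E * B) => L c i hL hi h1 h2.
have L0 : (0 < L)%N by case/andP: h1 => h11 h12; lia.
pose N := (4 * L)%N.
have NR : 0 < (N%:R : R) by rewrite ltr0n muln_gt0.
have NC : (N%:R : C) != 0 by rewrite pnatr_eq0 -lt0n muln_gt0.
have lower (m : int) : (i.+1 <= absz m <= 2 * L)%N -> i.+1%:R / 4 <= normc (Y N m).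
  move=> /andP[m1 m2]; rewrite /Y normcM normc_nat.
  have m1' : (i.+1%:R : R) <= `|m%:~R| by rewrite -intr_norm -natr_absz ler_nat.
  have m2' : `|m%:~R| <= (2 * L)%:R :> R by rewrite -intr_norm -natr_absz ler_nat.
  have re : complex.Re ((z + m%:~R) / N%:R) = (x + m%:~R) / N%:R.
    by rewrite Re_natdiv ReD Re_int.
  have hN : N%:R = 4 * L%:R :> R by rewrite natrM.
  have hN2 : (2 * L)%:R = 2 * L%:R :> R by rewrite natrM.
  have up : `|x + m%:~R| <= 5 / 8 * N%:R.
    apply: le_trans (ler_normD _ _) _; rewrite hN; rewrite hN2 in m2'; lra.
  have lo : i.+1%:R / 2 <= `|x + m%:~R|.
    have := lerB_normD m%:~R x; rewrite [m%:~R + x]addrC; lra.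
  have /qexp_far_from_1 : `|complex.Re ((z + m%:~R) / N%:R)| <= 5 / 8.
    by rewrite re normrM normfV (ger0_norm (ltW NR)) ler_pdivrMr.
  rewrite re normrM normfV (ger0_norm (ltW NR)) => h.
  apply: le_trans (ler_wpM2l (ltW NR) h).
  have -> : N%:R * (`|x + m%:~R| / N%:R / 2) = `|x + m%:~R| / 2.
    by field; rewrite gt_eqF.
  lra.
have l1 := lower _ h1; have l2 := lower _ h2.
have i0 : 0 < (i.+1%:R / 4 : R) by rewrite divr_gt0 ?ltr0n.
have y1 : 0 < normc (Y N (2 * c)) := lt_le_trans i0 l1.
have y2 : 0 < normc (Y N (2 * c + 1)) := lt_le_trans i0 l2.
have yE : pair L c = (Y N (2 * c + 1) - Y N (2 * c)) /
    (Y N (2 * c) * Y N (2 * c + 1)).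
  rewrite /pair -/N; apply: sub_inv; by rewrite -normc_gt0.
have d : normc (Y N (2 * c + 1) - Y N (2 * c)) <= E * B.
  have -> : Y N (2 * c + 1) - Y N (2 * c) =
      qexp ((z + (2 * c)%:~R) / N%:R) * (- (N%:R * (cexp (twopii * 1 / N%:R) - 1))).
    rewrite /Y [(2 * c + 1)%:~R]rmorphD /= addrA [(_ + 1%:~R) / _]mulrDl qexpD.
    rewrite (qexp_cexp (1%:~R / _)) [twopii * (_ / _)]mulrA.
    exact: sub_scaled_one_sub.
  rewrite normcM normcN; apply: ler_pM; rewrite ?normc_ge0 ?hB //.
  rewrite normc_qexp ler_expR -mulrN -!mulrA ler_wpM2l // ler_wpM2l ?pi_ge0 //.
  rewrite Im_natdiv ImD Im_int addr0.
  apply: le_trans (ler_norm _) _; rewrite normrN normrM normfV (ger0_norm (ltW NR)).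
  by rewrite ler_pdivrMr // ler_peMr // ler1n muln_gt0.
rewrite yE normcM normcV normcM.
have -> : 16 * E * B / i.+1%:R ^+ 2 = (E * B) * ((i.+1%:R / 4) * (i.+1%:R / 4))^-1.
  by field; rewrite gt_eqF ?ltr0n.
apply: ler_pM; rewrite ?normc_ge0 ?invr_ge0 ?mulr_ge0 ?normc_ge0 //.
by rewrite lef_pV2 ?posrE ?mulr_gt0 // ler_pM // ltW.
Qed.

(** Mittag-Leffler expansion of the cosecant,
    [pi / sin (pi z) = \sum_m (-1)^m / (z + m)], with the terms grouped into
    pairs so that the sum converges absolutely. It is the limit of the expansions
    at roots of unity, by [tannery]. *)
Theorem cosecant_expansion :
  (fun L => \sum_(0 <= i < L) (csc_pair z i%:Z + csc_pair z (- (i.+1)%:Z))) @ \oo -->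
  - twopii * (qexp (z / 2) / (1 - qexp z)).
Proof.
have [B hB] := pair_bound.
pose n0 := Num.bound (2 * `|x|).
have hn0 n : (n0 <= n)%N -> 2 * `|x| <= n%:R.
  move=> h; apply: le_trans (ltW (archi_boundP _)) _; rewrite ?mulr_ge0 //.
  by rewrite ler_nat.
have cvg i := cvgcD (@pair_cvg i%:Z) (@pair_cvg (- (i.+1)%:Z)).
have bound n k : (n0 <= n)%N -> (n0.+1 <= k < n)%N ->
    normc (pair n k%:Z + pair n (- (k.+1)%:Z)) <= 2 * B / (k.+1%:R) ^+ 2.
  move=> nn /andP[k0 kn]; apply: le_trans (le_normcD _ _) _.
  have hk : 2 * `|x| <= k.+1%:R by apply: hn0; lia.
  have := hB n k%:Z k (hn0 n nn) hk; have := hB n (- (k.+1)%:Z) k (hn0 n nn) hk.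
  move=> H1 H2.
  have {}H1 : normc (pair n (- (k.+1)%:Z)) <= B / (k.+1%:R) ^+ 2 by apply: H1; lia.
  have {}H2 : normc (pair n k%:Z) <= B / (k.+1%:R) ^+ 2 by apply: H2; lia.
  by rewrite -mulrA mulr_natl mulr2n; exact: lerD.
have := tannery (small_tails_square (2 * B)) cvg bound.
move=> /(cvgcB (cvgc_cst (qexp (z / 2) / (1 - qexp z)))).
rewrite subr0 => /(cvgcZ (- twopii)).
apply: (@cvgc_near R _ _ _ 1) => L L0.
rewrite -(pair_sum L0) -sumrB mulr_sumr; apply: eq_bigr => i _.
exact: rescaled_sub twopii_neq0.
Qed.

End Expansion.
End Cosecant.

Opaque cexp qexp euler.

(** * The inversion formula for theta series *)

Section FieldIdentities.
Variable F : fieldType.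
Implicit Types a b c d h i k m n q s t w x y z : F.

(** Four terms of the lattice sum with alternating signs, grouped into a second
    difference, which decreases like the cube of the distance to the origin. *)
Lemma lattice_quadruple t w : w != 0 -> w + 1 != 0 -> w + t != 0 -> w + t + 1 != 0 ->
  w^-1 - (w + 1)^-1 - ((w + t)^-1 - (w + t + 1)^-1) =
  t * ((w + 1)^-1 * (w + t)^-1 * (w + t + 1)^-1 + w^-1 * (w + 1)^-1 * (w + t)^-1).
Proof. by move=> a b c d; field; rewrite a b c d. Qed.

(** Division by [t] exchanges the roles of the two coordinates of the lattice. *)
Lemma lattice_transpose t n m h : t != 0 ->
  (n * t + h + m)^-1 - (n * t + h + m + 1)^-1 -
    (((n + 1) * t + h + m)^-1 - ((n + 1) * t + h + m + 1)^-1) =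
  t^-1 * (((m + h) / t + n)^-1 - ((m + h) / t + n + 1)^-1 -
    (((m + 1 + h) / t + n)^-1 - ((m + 1 + h) / t + n + 1)^-1)).
Proof.
move=> t0.
have key a b : a = t * b -> a^-1 = t^-1 * b^-1 by move=> ->; rewrite invfM.
rewrite (@key (n * t + h + m) ((m + h) / t + n)); last by field.
rewrite (@key (n * t + h + m + 1) ((m + 1 + h) / t + n)); last by field.
rewrite (@key ((n + 1) * t + h + m) ((m + h) / t + n + 1)); last by field.
rewrite (@key ((n + 1) * t + h + m + 1) ((m + 1 + h) / t + n + 1)); last by field.
ring.
Qed.

Lemma theta_inversion_algebra k i x y t s z : k != 0 -> t != 0 -> i * i = -1 -> (2%:R : F) != 0 ->
  - k * (i * (x / (2 * y))) = t^-1 * (2 * (k * (s * z))) ->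
  (x / y) ^+ 2 = - (16 * t ^- 2 * (s * s) * z ^+ 2).
Proof.
move=> k0 t0 ii two e.
have e2 : i * (x / y) = - (4 * (t^-1 * (s * z))).
  apply: (mulfI k0); apply: (mulIf (invr_neq0 two)).
  transitivity (- (- k * (i * (x / (2 * y))))).
    by rewrite invfM; ring.
  by rewrite e; field; rewrite two t0.
have : (i * (x / y)) ^+ 2 = (- (4 * (t^-1 * (s * z)))) ^+ 2 by rewrite e2.
rewrite exprMn [i ^+ 2]expr2 ii mulN1r => /eqP; rewrite eqr_oppLR => /eqP ->.
by rewrite sqrrN !exprMn exprVn; ring.
Qed.

Lemma csc_opp k q : q != 0 ->
  - k * (q^-1 / (1 - (q * q)^-1)) = - (- k * (q / (1 - q * q))).
Proof.
move=> q0; have e : 1 - (q * q)^-1 = - (q^-1 * q^-1 * (1 - q * q)) by field.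
rewrite e invrN !invfM !invrK; set u := (1 - q * q)^-1; by field.
Qed.

Lemma csc_shift k x d : k * (x * -1 / d) = - (k * (x / d)).
Proof. by ring. Qed.

Lemma csc_row_term k i s x d : s * (- k * (x * i / d)) = - k * (i * (s * x / d)).
Proof. by ring. Qed.

Lemma csc_column_term k t i s x d :
  s * (t * - (- k * (x * i / d))) = t * (k * (i * (s * x / d))).
Proof. by ring. Qed.

Lemma double_split a b c x : a * (2 * (b * (c * x))) = a * (b * (c * x)) + a * (b * (c * x)).
Proof. by ring. Qed.

End FieldIdentities.

Lemma double_half (F : numFieldType) (x : F) : 2 * (x / 2) = x.
Proof. by rewrite mulrC divfK ?pnatr_eq0. Qed.

Section Interchange.
Variable R : realType.
Local Notation C := R[i].

(** Partial sums over the interval [- n <= i < n], stable under [i -> - 1 - i]. *)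
Definition zsum (n : nat) (f : int -> C) : C :=
  \sum_(0 <= k < n) (f k%:Z + f (- (k.+1)%:Z)).

Lemma zsumB n f g : zsum n (fun i => f i - g i) = zsum n f - zsum n g.
Proof.
by rewrite /zsum -sumrB; apply: eq_bigr => k _; rewrite opprD addrACA.
Qed.

Lemma zsumZ n a f : zsum n (fun i => a * f i) = a * zsum n f.
Proof. by rewrite /zsum mulr_sumr; apply: eq_bigr => k _; rewrite mulrDr. Qed.

Lemma eq_zsum n f g : f =1 g -> zsum n f = zsum n g.
Proof. by move=> /funext ->. Qed.

Lemma zsum_exchange n m (T : int -> int -> C) :
  zsum n (fun i => zsum m (T i)) = zsum m (fun j => zsum n (T^~ j)).
Proof.
rewrite /zsum; under eq_bigr do rewrite -big_split /=.
rewrite exchange_big_nat /=; apply: eq_bigr => j _.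
by rewrite -big_split /=; apply: eq_bigr => i _; rewrite addrACA.
Qed.

Lemma zsum_pairs n f : zsum n (fun i => f (2 * i) + f (2 * i + 1)) = zsum n.*2 f.
Proof.
rewrite /zsum sum_pairs; apply: eq_bigr => k _.
have -> : 2 * k%:Z = (k.*2)%:Z by lia.
have -> : (k.*2)%:Z + 1 = (k.*2.+1)%:Z by lia.
have -> : 2 * - (k.+1)%:Z = - (k.*2.+2)%:Z by lia.
have -> : - (k.*2.+2)%:Z + 1 = - (k.*2.+1)%:Z by lia.
by rewrite -!addrA; congr (_ + _); rewrite [RHS]addrCA; congr (_ + _); rewrite addrC.
Qed.

Lemma normc_zsum n f : normc (zsum n f) <=
  \sum_(0 <= k < n) (normc (f k%:Z) + normc (f (- (k.+1)%:Z))).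
Proof.
apply: le_trans (normc_sum _ _ _) _; apply: ler_sum => k _.
exact: le_normcD.
Qed.

Lemma cube_telescope (u : R) : 0 < u -> (u + 1) ^- 3 <= u ^- 2 - (u + 1) ^- 2.
Proof.
move=> u0; have u1 : 0 < u + 1 by rewrite addr_gt0.
have u0' : u != 0 by rewrite gt_eqF.
have u1' : u + 1 != 0 by rewrite gt_eqF.
have -> : u ^- 2 - (u + 1) ^- 2 = (2 * u + 1) / (u ^+ 2 * (u + 1) ^+ 2).
  by field; rewrite u0' u1'.
rewrite ler_pdivlMr ?mulr_gt0 ?exprn_gt0 //.
have -> : (u + 1) ^- 3 * (u ^+ 2 * (u + 1) ^+ 2) = u ^+ 2 / (u + 1) by field.
by rewrite ler_pdivrMr //; nra.
Qed.

Lemma cube_tail (B : R) (n m : nat) : 0 <= B -> (0 < n)%N ->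
  \sum_(n <= k < m) B / k.+1%:R ^+ 3 <= B / n%:R ^+ 2.
Proof.
move=> B0 n0; have [mn|nm] := leqP m n.
  by rewrite big_geq // divr_ge0 // sqr_ge0.
suff h : \sum_(n <= k < m) B / k.+1%:R ^+ 3 <= B * (n%:R ^- 2 - m%:R ^- 2).
  apply: le_trans h _; rewrite ler_wpM2l // lerBlDr lerDl invr_ge0.
  by rewrite sqr_ge0.
rewrite -(subnKC (ltnW nm)); elim: (m - n)%N => [|k ih].
  by rewrite addn0 big_geq // subrr mulr0.
rewrite addnS big_nat_recr ?leq_addr //=; apply: le_trans (lerD ih (lexx _)) _.
rewrite -mulrDr ler_wpM2l //.
rewrite -natr1; have := @cube_telescope (n + k)%:R.
by rewrite ltr0n addn_gt0 n0 => /(_ isT); lra.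
Qed.

Section Box.
Variables (T : int -> int -> C) (Row : int -> C) (B : R).
Hypothesis B0 : 0 <= B.
Hypothesis T_le : forall i j k, (0 < k)%N -> (k <= maxn (absz i) (absz j))%N ->
  normc (T i j) <= B / k.+1%:R ^+ 3.
Hypothesis T_row : forall i, (fun n => zsum n (T i)) @ \oo --> Row i.

Lemma row_tail i n : (0 < n)%N -> normc (Row i - zsum n (T i)) <= 2 * B / n%:R ^+ 2.
Proof.
move=> n0; apply: (cvgc_le (cvgcB (@T_row i) (cvgc_cst (zsum n (T i))))).
exists n => m nm.
have -> : zsum m (T i) - zsum n (T i) =
    \sum_(n <= k < m) (T i k%:Z + T i (- (k.+1)%:Z)).
  by rewrite /zsum [X in X - _](@big_cat_nat _ _ _ n) //= addrAC subrr add0r.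
have B20 : 0 <= 2 * B by rewrite mulr_ge0.
apply: le_trans (normc_sum _ _ _) _; apply: le_trans _ (cube_tail m B20 n0).
apply: ler_sum_nat => k /andP[nk _]; apply: le_trans (le_normcD _ _) _.
rewrite -mulrA mulr_natl mulr2n; apply: lerD; apply: T_le; lia.
Qed.

(** The rows truncated at [n] miss a total of order [n / n ^ 2]. *)
Lemma box_cvg (X : C) : (fun n => zsum n Row) @ \oo --> X ->
  (fun n => zsum n (fun i => zsum n (T i))) @ \oo --> X.
Proof.
move=> hX; have : (fun n => zsum n (fun i => Row i - zsum n (T i))) @ \oo --> (0 : C).
  apply/cvgcP => e e0; pose N := (Num.bound (4 * B / e)).+1.
  exists N => n Nn; rewrite subr0.
  have hN : 4 * B / e < n%:R.
    apply: lt_le_trans (archi_boundP _) _; first by rewrite divr_ge0 ?mulr_ge0 // ltW.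
    by rewrite ler_nat (leq_trans _ Nn) // /N.
  have n0 : (0 < n)%N by apply: leq_trans Nn.
  have nR : 0 < (n%:R : R) by rewrite ltr0n.
  apply: le_trans (normc_zsum _ _) _.
  apply: (@le_trans _ _ (\sum_(0 <= k < n) (4 * B / n%:R ^+ 2))).
    apply: ler_sum => k _.
    have -> : 4 * B / n%:R ^+ 2 = 2 * B / n%:R ^+ 2 + 2 * B / n%:R ^+ 2 by ring.
    by apply: lerD; exact: row_tail.
  rewrite sumr_const_nat subn0 -[leLHS]mulr_natr.
  have -> : 4 * B / n%:R ^+ 2 * n%:R = 4 * B / n%:R.
    by field; rewrite gt_eqF.
  by rewrite ler_pdivrMr // [leRHS]mulrC -ler_pdivrMr // ltW.
move=> /(cvgcB hX); rewrite subr0; apply: cvgc_ext => n.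
by rewrite zsumB opprB addrC subrK.
Qed.

End Box.

(** Absolute convergence lets both iterated sums be compared with the sums over
    square boxes. *)
Theorem interchange (T : int -> int -> C) (Row Col : int -> C) (X Y : C) (B : R) :
  0 <= B ->
  (forall i j k, (0 < k)%N -> (k <= maxn (absz i) (absz j))%N ->
     normc (T i j) <= B / k.+1%:R ^+ 3) ->
  (forall i, (fun n => zsum n (T i)) @ \oo --> Row i) ->
  (forall j, (fun n => zsum n (T^~ j)) @ \oo --> Col j) ->
  (fun n => zsum n Row) @ \oo --> X -> (fun n => zsum n Col) @ \oo --> Y -> X = Y.
Proof.
move=> B0 hT hR hC hX hY; have h1 := box_cvg B0 hT hR hX.
have hT' i j k : (0 < k)%N -> (k <= maxn (absz i) (absz j))%N ->
     normc (T j i) <= B / k.+1%:R ^+ 3.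
  by move=> k0 kij; apply: hT => //; rewrite maxnC.
have h2 := @box_cvg (fun j i => T i j) Col B B0 hT' hC Y hY.
apply: (cvgc_unique h1); apply: cvgc_ext h2 => n.
exact: zsum_exchange.
Qed.

End Interchange.

Section ThetaInversion.
Variable R : realType.
Local Notation C := R[i].
Implicit Types tau : C.

(** The imaginary part controls the first coordinate, and then the triangle
    inequality controls the second one. *)
Lemma real_comb_lower (tau : C) : 0 < complex.Im tau ->
  exists2 d : R, 0 < d & forall x y : R,
    d * `|x| <= normc (x%:C * tau + y%:C) /\ d * `|y| <= normc (x%:C * tau + y%:C).
Proof.
move=> t0; set v := complex.Im tau in t0 *; set a := normc tau.
have a0 : 0 <= a := normc_ge0 tau.
have s0 : 0 < v + a + 1 by lra.
exists (v / (v + a + 1)); first by rewrite divr_gt0.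
move=> x y; set w := x%:C * tau + y%:C.
have hx : v * `|x| <= normc w.
  apply: le_trans (normc_Im _).
  by rewrite ImD ImMreal /= addr0 normrM mulrC (gtr0_norm t0).
have hy : `|y| <= normc w + `|x| * a.
  have -> : `|y| = normc (w - x%:C * tau) by rewrite /w addrC addKr normc_real.
  by apply: le_trans (normcB _ _) _; rewrite normcM normc_real.
have x0 := normr_ge0 x; have w0 := normc_ge0 w.
by split; rewrite mulrAC ler_pdivrMr //; nra.
Qed.

(** Summed over [j] first this gives the Lambert series of [theta_4 ^ 2] at [tau],
    and summed over [i] first that of [theta_2 ^ 2] at [-1 / tau]. *)
Definition lattice_term (tau : C) (i j : int) : C :=
  csc_pair ((2 * i)%:~R * tau + 2^-1) j - csc_pair ((2 * i + 1)%:~R * tau + 2^-1) j.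

Lemma lattice_term_le tau : 0 < complex.Im tau -> exists2 B : R, 0 <= B &
  forall i j k, (0 < k)%N -> (k <= maxn (absz i) (absz j))%N ->
    normc (lattice_term tau i j) <= B / k.+1%:R ^+ 3.
Proof.
move=> t0; have [d d0 hd] := real_comb_lower t0.
exists (2 * normc tau * (4 / d) ^+ 3).
  have d4 : 0 <= 4 / d by rewrite divr_ge0 // ltW.
  exact: mulr_ge0 (mulr_ge0 (ler0n _ 2) (normc_ge0 _)) (exprn_ge0 _ d4).
move=> i j k k0 kij; pose mu := d * k.+1%:R / 4.
have kR : 1 <= (k%:R : R) by rewrite ler1n.
have k1 : k.+1%:R = k%:R + 1 :> R by rewrite natr1.
have mu0 : 0 < mu by rewrite divr_gt0 // mulr_gt0 ?ltr0n.
have lower (a b : bool) : mu <= normc ((2 * i + a%:Z)%:~R * tau + 2^-1 + (2 * j)%:~R + b%:R).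
  have -> : (2 * i + a%:Z)%:~R * tau + 2^-1 + (2 * j)%:~R + b%:R =
     ((2 * i + a%:Z)%:~R : R)%:C * tau + (2^-1 + (2 * j)%:~R + b%:R : R)%:C.
    rewrite !rmorphD /= !rmorph_int fmorphV rmorph_nat [b%:R%:C]rmorph_nat.
    by rewrite !addrA.
  have [h1 h2] := hd (2 * i + a%:Z)%:~R (2^-1 + (2 * j)%:~R + b%:R).
  have [ki|kj] : (k <= absz i)%N \/ (k <= absz j)%N by move: kij; rewrite leq_max => /orP.
    apply: le_trans h1; rewrite /mu -mulrA ler_wpM2l ?(ltW d0) //.
    have : (k%:R : R) <= `|i%:~R| by rewrite -intr_norm -natr_absz ler_nat.
    rewrite rmorphD rmorphM /=; move: (i%:~R) => x.
    have := lerB_normD (2 * x) (a%:R).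
    rewrite normrM (ger0_norm (ler0n R a)) (ger0_norm (ler0n R 2)).
    by case: (a) => /=; lra.
  apply: le_trans h2; rewrite /mu -mulrA ler_wpM2l ?(ltW d0) //.
  have : (k%:R : R) <= `|j%:~R| by rewrite -intr_norm -natr_absz ler_nat.
  rewrite rmorphM /=; move: (j%:~R) => x.
  have hb : 0 <= 2^-1 + b%:R :> R by rewrite addr_ge0 // invr_ge0.
  have := lerB_normD (2 * x) (2^-1 + b%:R).
  rewrite normrM (ger0_norm hb) (ger0_norm (ler0n R 2)).
  by rewrite addrA [2^-1 + 2 * x]addrC; case: (b) => /=; lra.
pose w := (2 * i)%:~R * tau + 2^-1 + (2 * j)%:~R.
have l0 : mu <= normc w by have := lower false false; rewrite /= !addr0.
have l1 : mu <= normc (w + 1) by have := lower false true; rewrite /= !addr0.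
have l2 : mu <= normc (w + tau).
  have := lower true false; rewrite /= addr0; congr (_ <= normc _).
  by rewrite rmorphD mulrDl mul1r /w -!addrA; congr (_ + _); rewrite addrC !addrA.
have l3 : mu <= normc (w + tau + 1).
  have := lower true true; congr (_ <= normc (_ + _)).
  by rewrite rmorphD mulrDl mul1r /w -!addrA; congr (_ + _); rewrite addrC !addrA.
have nz z : mu <= normc z -> z != 0.
  by move=> h; rewrite -normc_gt0; apply: lt_le_trans h.
have -> : lattice_term tau i j =
   tau * ((w + 1)^-1 * (w + tau)^-1 * (w + tau + 1)^-1 +
          w^-1 * (w + 1)^-1 * (w + tau)^-1).
  rewrite /lattice_term /csc_pair.
  have -> : (2 * i + 1)%:~R * tau + 2^-1 + (2 * j)%:~R = w + tau.
    by rewrite rmorphD mulrDl mul1r /w -!addrA; congr (_ + _); rewrite addrC !addrA.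
  by apply: lattice_quadruple; apply: nz.
rewrite normcM.
have inv z : mu <= normc z -> normc z^-1 <= mu^-1.
  by move=> h; rewrite normcV lef_pV2 ?posrE // (lt_le_trans mu0).
have i3 z1 z2 z3 : mu <= normc z1 -> mu <= normc z2 -> mu <= normc z3 ->
    normc (z1^-1 * z2^-1 * z3^-1) <= mu^-1 ^+ 3.
  move=> /inv h1 /inv h2 /inv h3; rewrite !normcM exprSr expr2.
  by rewrite !ler_pM ?mulr_ge0 ?normc_ge0.
have -> : 2 * normc tau * (4 / d) ^+ 3 / k.+1%:R ^+ 3 = normc tau * (mu^-1 ^+ 3 + mu^-1 ^+ 3).
  by rewrite /mu; field; rewrite !gt_eqF // ltr0n.
rewrite ler_wpM2l ?normc_ge0 //; apply: le_trans (le_normcD _ _) _.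
by apply: lerD; apply: i3.
Qed.

(** [pi / sin (pi z)] *)
Definition csc (z : C) : C := - twopii R * (qexp (z / 2) / (1 - qexp z)).

Lemma csc_cvg z : qexp z != 1 -> (fun n => zsum n (csc_pair z)) @ \oo --> csc z.
Proof. exact: cosecant_expansion. Qed.

Lemma cscD1 z : csc (z + 1) = - csc z.
Proof.
rewrite /csc qexpD1 mulrDl qexpD (_ : 1 / 2 = 2^-1) ?mul1r // qexp_half.
exact: csc_shift.
Qed.

Lemma cscN z : csc (- z) = - csc z.
Proof.
have e : qexp z = qexp (z / 2) * qexp (z / 2) by rewrite -qexpD -splitr.
rewrite /csc [- z / 2]mulNr !qexpN e; exact: csc_opp _ (qexp_neq0 _).
Qed.

Lemma qexp_neq1 (z : C) : complex.Im z != 0 -> qexp z != 1.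
Proof.
move=> z0; apply/negP => /eqP e; have := normc_qexp z; rewrite e normc1 => h.
have : - (2 * pi * complex.Im z) = 0 by apply: expR_inj; rewrite -h expR0.
move/eqP; rewrite oppr_eq0 !mulf_eq0 (negPf z0) orbF (gt_eqF (pi_gt0 R)) orbF.
by rewrite pnatr_eq0.
Qed.

Lemma Im_half : complex.Im (2^-1 : C) = 0.
Proof. by rewrite -[2^-1]mul1r Im_natdiv /= mul0r. Qed.

Lemma ImMint (m : int) (z : C) : complex.Im (m%:~R * z) = m%:~R * complex.Im z.
Proof. by rewrite -(rmorph_int (real_complex R)) ImMreal. Qed.

Lemma sign_even (i : int) : (-1 : C) ^ (2 * i) = 1.
Proof. by rewrite -exprz_exp -[(-1) ^ 2]/((-1) ^+ 2) sqrrN expr1n exp1rz. Qed.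

Lemma sign_odd (i : int) : (-1 : C) ^ (2 * i + 1) = -1.
Proof. by rewrite expfzDr ?oppr_eq0 ?oner_eq0 // sign_even mul1r expr1z. Qed.

Lemma sign_neg (k : nat) : (-1 : C) ^ (- (k.+1)%:Z) = (-1) ^+ k.+1.
Proof. by rewrite -exprnN invr_sign. Qed.

Section Inversion.
Variable tau : C.
Hypothesis t0 : 0 < complex.Im tau.
Let tau' := - tau^-1.
Let p := qexp (tau / 2).
Let r := qexp (tau' / 2).

Lemma tau_neq0 : tau != 0.
Proof. by apply/negP => /eqP e; move: t0; rewrite e ltxx. Qed.

Lemma Im_inv_neg : 0 < complex.Im (- tau^-1).
Proof.
rewrite ImN; move: t0; case: tau => a b /= b0.
by rewrite opprK divr_gt0 // ltr_wpDl ?sqr_ge0 ?exprn_gt0.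
Qed.

Let F (n : int) : C := (-1) ^ n * csc (n%:~R * tau + 2^-1).
Let H (m : int) : C := (-1) ^ m * (tau^-1 * csc ((m%:~R + 2^-1) / tau)).

Let row_cvg i : (fun n => zsum n (lattice_term tau i)) @ \oo --> F (2 * i) + F (2 * i + 1).
Proof.
have nz (m : int) : qexp (m%:~R * tau + 2^-1) != 1.
  have [->|m0] := eqVneq m 0.
    by rewrite mul0r add0r qexp_half eq_sym -addr_eq0 (pnatr_eq0 _ 2).
  apply: qexp_neq1; rewrite ImD Im_half addr0 ImMint.
  by rewrite mulf_neq0 ?intr_eq0 ?(gt_eqF t0).
have := cvgcB (csc_cvg (nz (2 * i))) (csc_cvg (nz (2 * i + 1))).
rewrite /F sign_even sign_odd mul1r mulN1r; apply: cvgc_ext => n.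
by rewrite -zsumB.
Qed.

Let col_cvg j : (fun n => zsum n (lattice_term tau ^~ j)) @ \oo --> H (2 * j) + H (2 * j + 1).
Proof.
have nz (m : int) : qexp ((m%:~R + 2^-1) / tau) != 1.
  apply: qexp_neq1.
  have -> : (m%:~R + 2^-1) / tau = - ((m%:~R + 2^-1 : R)%:C * - tau^-1).
    by rewrite rmorphD /= rmorph_int fmorphV rmorph_nat mulrN opprK.
  rewrite ImN ImMreal oppr_eq0 mulf_neq0 ?(gt_eqF Im_inv_neg) //.
  apply/negP => /eqP e; have : (2 * m + 1)%:~R = 0 :> R.
    by rewrite rmorphD rmorphM /=; lra.
  by move/eqP; rewrite intr_eq0; lia.
have := cvgcZ tau^-1 (cvgcB (csc_cvg (nz (2 * j))) (csc_cvg (nz (2 * j + 1)))).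
have -> : H (2 * j) + H (2 * j + 1) = tau^-1 * (csc (((2 * j)%:~R + 2^-1) / tau) -
     csc (((2 * j + 1)%:~R + 2^-1) / tau)).
  by rewrite /H sign_even sign_odd mul1r mulN1r mulrBr.
apply: cvgc_ext => n; rewrite -zsumB -zsumZ; apply: eq_zsum => i.
rewrite /lattice_term /csc_pair !rmorphD /=.
by apply/esym; exact: (lattice_transpose _ _ _ tau_neq0).
Qed.

Let nat_F (k : nat) : F k%:Z = - twopii R * (qexp (2^-1 / 2) * ((- p) ^+ k / (1 + p ^+ k.*2))).
Proof.
have e1 : qexp ((k%:R * tau + 2^-1) / 2) = p ^+ k * qexp (2^-1 / 2).
  by rewrite mulrDl qexpD -mulrA qexpMn.
have e2 : qexp (k%:R * tau + 2^-1) = - p ^+ k.*2.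
  rewrite qexpD qexp_half mulrN1 -mul2n exprM /p -qexpMn.
  by rewrite double_half qexpMn.
rewrite /F /csc e1 e2 opprK exprNn.
exact: csc_row_term.
Qed.

Let neg_F (k : nat) : F (- (k.+1)%:Z) = F (k.+1)%:Z.
Proof.
rewrite /F sign_neg; congr (_ * _).
have -> : (- (k.+1)%:Z)%:~R * tau + 2^-1 = - (k.+1%:R * tau + 2^-1) + 1.
  rewrite rmorphN mulNr opprD -addrA; congr (_ + _).
  by rewrite [X in - _ + X](splitr 1) mul1r addKr.
by rewrite cscD1 cscN opprK.
Qed.

Let nat_H (k : nat) :
  H k%:Z = tau^-1 * (twopii R * (qexp (tau' / 2 / 2) * ((- r) ^+ k / (1 - r ^+ k.*2.+1)))).
Proof.
have e0 : (k%:R + 2^-1) / tau = - ((k%:R + 2^-1) * tau').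
  by rewrite /tau' mulrN opprK.
have e1 : qexp ((k%:R + 2^-1) * tau' / 2) = r ^+ k * qexp (tau' / 2 / 2).
  by rewrite mulrDl mulrDl -mulrA qexpD qexpMn [2^-1 * _]mulrC.
have e2 : qexp ((k%:R + 2^-1) * tau') = r ^+ k.*2.+1.
  rewrite mulrDl qexpD [2^-1 * _]mulrC -/r exprSr -mul2n exprM /r -qexpMn.
  by rewrite double_half qexpMn.
rewrite /H e0 cscN /csc e1 e2 exprNn.
exact: csc_column_term.
Qed.

Let neg_H (k : nat) : H (- (k.+1)%:Z) = H k%:Z.
Proof.
rewrite /H sign_neg exprS mulN1r.
have -> : ((- (k.+1)%:Z)%:~R + 2^-1) / tau = - ((k%:R + 2^-1) / tau).
  rewrite -mulNr; congr (_ / _).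
  have -> : (- (k.+1)%:Z)%:~R = - (k%:R + 1) :> C by rewrite rmorphN /= natr1.
  rewrite !opprD -addrA; congr (_ + _).
  by rewrite [X in - X + _](splitr 1) mul1r opprD -addrA addNr addr0.
by rewrite cscN !mulrN mulNr opprK.
Qed.

Lemma norm_p_lt1 : normc p < 1.
Proof. by apply: normc_qexp_lt1; rewrite Im_natdiv divr_gt0. Qed.

Lemma norm_r_lt1 : normc r < 1.
Proof. by apply: normc_qexp_lt1; rewrite Im_natdiv divr_gt0 // Im_inv_neg. Qed.

(** The transformation [theta_4 (tau) ^ 4 = - tau ^ (-2) theta_2 (-1 / tau) ^ 4],
    in terms of Euler products, as the square of the equality between the two ways
    of summing [lattice_term]; squaring removes a square root of [-1] and one of [r]. *)
Theorem theta_inversion :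
  (euler p ^+ 4 / euler (p ^+ 2) ^+ 2) ^+ 2 =
  - (16 * tau ^- 2 * r * (euler (r ^+ 4) ^+ 4 / euler (r ^+ 2) ^+ 2) ^+ 2).
Proof.
have [B B0 hB] := lattice_term_le t0.
pose X := - twopii R * (qexp (2^-1 / 2) * (euler p ^+ 4 / (2 * euler (p ^+ 2) ^+ 2))).
pose Y := tau^-1 * (2 * (twopii R * (qexp (tau' / 2 / 2) *
     (euler (r ^+ 4) ^+ 4 / euler (r ^+ 2) ^+ 2)))).
have hX : (fun n => zsum n (fun i => F (2 * i) + F (2 * i + 1))) @ \oo --> X.
  have := cvgcZ (- twopii R) (cvgcZ (qexp (2^-1 / 2)) (cvgc_sub n_le_double
     (lambert_theta4 (qexp_neq0 _) norm_p_lt1))).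
  apply: cvgc_ext => n; rewrite zsum_pairs /zsum !mulr_sumr.
  by apply: eq_bigr => k _; rewrite neg_F !nat_F !mulrDr.
have hY : (fun n => zsum n (fun i => H (2 * i) + H (2 * i + 1))) @ \oo --> Y.
  have := cvgcZ tau^-1 (cvgcZ 2 (cvgcZ (twopii R) (cvgcZ (qexp (tau' / 2 / 2))
     (cvgc_sub n_le_double (lambert_theta2 (qexp_neq0 _) norm_r_lt1))))).
  apply: cvgc_ext => n; rewrite zsum_pairs /zsum !mulr_sumr.
  by apply: eq_bigr => k _; rewrite neg_H !nat_H; exact: double_split.
have e := interchange B0 hB row_cvg col_cvg hX hY.
have ii : qexp (2^-1 / 2) * qexp (2^-1 / 2) = -1 :> C.
  by rewrite -qexpD -splitr qexp_half.
have ss : qexp (tau' / 2 / 2) * qexp (tau' / 2 / 2) = r by rewrite -qexpD -splitr.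
have two : (2%:R : C) != 0 by rewrite pnatr_eq0.
by have := theta_inversion_algebra (twopii_neq0 R) tau_neq0 ii two e; rewrite ss.
Qed.

End Inversion.
End ThetaInversion.

(** * Functions regular at infinity *)

Lemma mul_div_cancel_r (F : fieldType) (a b e : F) : a != 0 -> a * (e / (b * a)) = e / b.
Proof. by move=> a0; rewrite invfM mulrCA [a * (_ / _)]mulrCA mulfV ?mulr1. Qed.

Lemma div_one_sub_div (F : fieldType) (a r n : F) : r != 0 -> a / r / (1 - n / r) = a / (r - n).
Proof.
move=> r0; have -> : r - n = r * (1 - n / r) by rewrite mulrBr mulr1 mulrC mulfVK.
by rewrite [in RHS]invfM mulrA.
Qed.

Lemma error_budget (F : fieldType) (d a b e : F) : a != 0 -> b != 0 -> (2%:R : F) != 0 ->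
  e + d * (2 / a + 2 / b) = 2 * d / a + 2 * (d + e * b / 2) / b.
Proof. by move=> a0 b0 two; field; rewrite two a0 b0. Qed.

Section PolynomialBounds.
Variable R : realType.
Local Notation C := R[i].
Implicit Types p : {poly C}.

Lemma normc_horner p : exists2 B : R, 0 <= B &
  forall z : C, normc z <= 1 -> normc p.[z] <= B.
Proof.
exists (\sum_(i < size p) normc p`_i); first by apply: sumr_ge0 => i _; exact: normc_ge0.
move=> z z1; rewrite horner_coef; apply: le_trans (normc_sum _ _ _) _.
apply: ler_sum => i _; rewrite normcM normcX ler_piMr ?normc_ge0 //.
by rewrite exprn_ile1 ?normc_ge0.
Qed.

Lemma sum_root_powers (N k : nat) : (0 < N)%N -> (k < N.*2)%N -> k != N -> (0 < k)%N ->
  \sum_(0 <= j < N) qexp (j%:R / N%:R : C) ^+ k = 0.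
Proof.
move=> N0 kN kN' k0.
have NC : (N%:R : C) != 0 by rewrite pnatr_eq0 -lt0n.
pose zeta : C := qexp (k%:R / N%:R).
have zj j : qexp (j%:R / N%:R : C) ^+ k = zeta ^+ j.
  by rewrite -!qexpMn !mulrA [k%:R * _]mulrC.
have z1 : zeta != 1.
  have [h|h] := ltnP k N; first by rewrite qexp_root_neq1 // k0.
  rewrite /zeta -(subnK h) natrD mulrDl divff // qexpD1.
  by apply: qexp_root_neq1; apply/andP; split; lia.
have zN : zeta ^+ N = 1 by rewrite /zeta -qexpMn mulrC mulfVK // qexp_nat.
under eq_bigr do rewrite zj.
have z1' : 1 - zeta != 0 by rewrite subr_eq0 eq_sym.
apply: (mulfI z1'); rewrite mulr0.
by rewrite geometric_sum zN subrr.
Qed.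

(** Cauchy's estimate for the coefficients; averaging over roots of unity of
    large order replaces the contour integral. *)
Lemma coef_bound p (r : C) (B : R) :
  (forall K j : nat, (0 < K)%N -> normc p.[r * qexp (j%:R / K%:R)] <= B) ->
  forall i, normc p`_i * normc r ^+ i <= B.
Proof.
move=> hB i; pose N := (size p + i).+1.
have N0 : (0 < N)%N by [].
have NC : (N%:R : C) != 0 by rewrite pnatr_eq0.
have NR : 0 < (N%:R : R) by rewrite ltr0n.
have B0 : 0 <= B := le_trans (normc_ge0 _) (hB 1 0 isT)%N.
have sp : (size p <= N)%N by rewrite /N; lia.
have key : N%:R * (p`_i * r ^+ i) = \sum_(0 <= j < N)
    p.[r * qexp (j%:R / N%:R)] * qexp (j%:R / N%:R) ^+ (N - i).
  under eq_bigr do rewrite (horner_coef_wide _ sp) mulr_suml.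
  rewrite exchange_big /=.
  have iN : (i < N)%N by rewrite /N; lia.
  have term (l : nat) : \sum_(0 <= j < N) p`_l * (r * qexp (j%:R / N%:R)) ^+ l *
      qexp (j%:R / N%:R) ^+ (N - i) = p`_l * r ^+ l *
      \sum_(0 <= j < N) qexp (j%:R / N%:R) ^+ (l + (N - i)).
    rewrite mulr_sumr; apply: eq_bigr => j _.
    by rewrite exprMn mulrA -[LHS]mulrA -exprD.
  rewrite (bigD1 (Ordinal iN)) //= [X in _ + X]big1 ?addr0.
    rewrite term subnKC ?(ltnW iN) //.
    rewrite [X in _ = _ * X](_ : _ = \sum_(0 <= j < N) 1).
      by rewrite sumr_const_nat subn0 mulrC.
    by apply: eq_bigr => j _; rewrite -qexpMn mulrC mulfVK // qexp_nat.
  move=> [l lN] /= li; rewrite term sum_root_powers ?mulr0 //; try lia.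
  apply/negP => /eqP e; case/negP: li; apply/eqP/val_inj => /=; lia.
have : normc (N%:R * (p`_i * r ^+ i)) <= \sum_(0 <= j < N) B.
  rewrite key; apply: le_trans (normc_sum _ _ _) _; apply: ler_sum => j _.
  rewrite normcM normcX normc_qexp Im_natdiv.
  have -> : complex.Im (j%:R : C) = 0 by exact: (Im_int R j%:Z).
  by rewrite mul0r mulr0 oppr0 expR0 expr1n mulr1; exact: hB.
rewrite sumr_const_nat subn0 normcM normc_nat -[leRHS]mulr_natl ler_pM2l //.
by rewrite normcM normcX.
Qed.

(** A weak form of the maximum principle, by summation of Cauchy's estimates. *)
Lemma poly_bound p (r : C) (B : R) : r != 0 ->
  (forall K j : nat, (0 < K)%N -> normc p.[r * qexp (j%:R / K%:R)] <= B) ->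
  forall z : C, normc z < normc r -> normc p.[z] <= B / (1 - normc z / normc r).
Proof.
move=> r0 hB z zr; have B0 : 0 <= B := le_trans (normc_ge0 _) (hB 1 0 isT)%N.
have rp : 0 < normc r by rewrite normc_gt0.
set t := normc z / normc r.
have t01 : 0 <= t < 1 by rewrite divr_ge0 ?normc_ge0 //= ltr_pdivrMr // mul1r.
rewrite horner_coef; apply: le_trans (normc_sum _ _ _) _.
apply: (@le_trans _ _ (\sum_(i < size p) B * t ^+ i)).
  apply: ler_sum => i _; rewrite normcM normcX /t exprMn exprVn mulrCA mulrC.
  rewrite ler_wpM2l ?exprn_ge0 ?normc_ge0 // ler_pdivlMr ?exprn_gt0 //.
  exact: coef_bound.
rewrite -mulr_sumr ler_wpM2l // -(big_mkord xpredT (fun i => t ^+ i)).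
by apply: le_trans (geometric_sum_le 0 _ t01) _; rewrite expr0 mul1r.
Qed.

Lemma poly_split p : exists p' : {poly C}, forall z, p.[z] = p.[0] + z * p'.[z].
Proof.
have /factor_theorem[p' hp'] : root (p - p.[0]%:P) 0.
  by rewrite /root !hornerE subrr.
exists p' => z; have := congr1 (horner^~ z) hp'; rewrite !hornerE => e.
by move/(canRL (subrK _)): e => ->; rewrite subr0 addrC mulrC.
Qed.

End PolynomialBounds.

Section Regular.
Variable R : realType.
Local Notation C := R[i].
Implicit Types (g h : C -> C) (tau : C).

(** Power series in [q^(1/N)], encoded by uniform approximation by polynomials on
    the half-planes [y <= Im tau], [y > 0]: in this form infinite products and
    substitutions need no manipulation of coefficients. *)
Definition regular (N : nat) g := forall y e : R, 0 < y -> 0 < e ->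
  exists p : {poly C}, forall tau, y <= complex.Im tau ->
    normc (g tau - p.[qexp (tau / N%:R)]) <= e.

Section Level.
Variable N : nat.
Hypothesis N0 : (0 < N)%N.

Let NR : 0 < (N%:R : R). Proof. by rewrite ltr0n. Qed.
Let NC : (N%:R : C) != 0. Proof. by rewrite pnatr_eq0 -lt0n. Qed.

Lemma normc_q (tau : C) : normc (qexp (tau / N%:R)) = expR (- (2 * pi * (complex.Im tau / N%:R))).
Proof. by rewrite normc_qexp Im_natdiv. Qed.

Lemma normc_q_le (tau : C) (y : R) : y <= complex.Im tau ->
  normc (qexp (tau / N%:R)) <= expR (- (2 * pi * (y / N%:R))).
Proof.
move=> h; rewrite normc_q ler_expR lerN2 ler_wpM2l ?mulr_ge0 ?pi_ge0 //.
by rewrite ler_pM2r ?invr_gt0.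
Qed.

Lemma normc_q_le1 (tau : C) : 0 <= complex.Im tau -> normc (qexp (tau / N%:R)) <= 1.
Proof.
by move=> h; apply: le_trans (normc_q_le h) _; rewrite mul0r mulr0 oppr0 expR0.
Qed.

Lemma regular_bounded g : regular N g -> forall y : R, 0 < y ->
  exists M : R, forall tau, y <= complex.Im tau -> normc (g tau) <= M.
Proof.
move=> hg y y0; have [p hp] := hg y 1 y0 ltr01; have [B _ hB] := normc_horner p.
exists (1 + B) => tau ht; rewrite -(subrK p.[qexp (tau / N%:R)] (g tau)).
apply: le_trans (le_normcD _ _) _; apply: lerD; first exact: hp.
by apply: hB; apply: normc_q_le1; apply: le_trans ht; exact: ltW.
Qed.

Lemma regular_ext g h : (forall tau, 0 < complex.Im tau -> g tau = h tau) ->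
  regular N g -> regular N h.
Proof.
move=> e hg y eps y0 e0; have [p hp] := hg y eps y0 e0.
by exists p => tau ht; rewrite -e ?hp // (lt_le_trans y0).
Qed.

Lemma regular_cst (c : C) : regular N (fun=> c).
Proof.
by move=> y e _ e0; exists c%:P => tau _; rewrite hornerC subrr normc0 ltW.
Qed.

Lemma regular_q : regular N (fun tau => qexp (tau / N%:R)).
Proof.
by move=> y e _ e0; exists 'X => tau _; rewrite hornerX subrr normc0 ltW.
Qed.

Lemma regularD g h : regular N g -> regular N h -> regular N (fun tau => g tau + h tau).
Proof.
move=> hg hh y e y0 e0; have e2 : 0 < e / 2 by lra.
have [p hp] := hg y _ y0 e2; have [s hs] := hh y _ y0 e2.
exists (p + s) => tau ht; rewrite hornerD opprD addrACA.
by apply: le_trans (le_normcD _ _) _; have := hp _ ht; have := hs _ ht; lra.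
Qed.

Lemma regularM g h : regular N g -> regular N h -> regular N (fun tau => g tau * h tau).
Proof.
move=> hg hh y e y0 e0.
have [A hA] := regular_bounded hg y0; have [B hB] := regular_bounded hh y0.
pose A1 := `|A| + 1; pose B1 := `|B| + 1.
have A0 : 0 < A1 by rewrite ltr_wpDl.
have B0 : 0 < B1 by rewrite ltr_wpDl.
have eb : 0 < e / (2 * B1) by rewrite divr_gt0 // mulr_gt0.
have [p hp] := hg y _ y0 eb.
have ea : 0 < Num.min 1 (e / (2 * (A1 + e / (2 * B1)))).
  by rewrite lt_min ltr01 divr_gt0 // mulr_gt0 // addr_gt0.
have [s hs] := hh y _ y0 ea.
exists (p * s) => tau ht; set q := qexp _; rewrite hornerM.
have -> : g tau * h tau - p.[q] * s.[q] = (g tau - p.[q]) * h tau + p.[q] * (h tau - s.[q]).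
  by rewrite mulrBl mulrBr addrA subrK.
apply: le_trans (le_normcD _ _) _; rewrite !normcM.
have h1 : normc (g tau - p.[q]) * normc (h tau) <= e / 2.
  apply: (@le_trans _ _ (e / (2 * B1) * B1)).
    apply: ler_pM; rewrite ?normc_ge0 ?hp //; apply: le_trans (hB _ ht) _.
    by rewrite /B1; have := ler_norm B; lra.
  by rewrite invfM mulrA mulfVK // gt_eqF.
have pq : normc p.[q] <= A1 + e / (2 * B1).
  have -> : p.[q] = g tau - (g tau - p.[q]) by rewrite opprB addrC subrK.
  apply: le_trans (normcB _ _) _; apply: lerD; last exact: hp.
  by apply: le_trans (hA _ ht) _; rewrite /A1; have := ler_norm A; lra.
have h2 : normc p.[q] * normc (h tau - s.[q]) <= e / 2.
  apply: (@le_trans _ _ ((A1 + e / (2 * B1)) * (e / (2 * (A1 + e / (2 * B1)))))).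
    apply: ler_pM; rewrite ?normc_ge0 //; apply: le_trans (hs _ ht) _.
    by rewrite ge_min lexx orbT.
  by rewrite mul_div_cancel_r // gt_eqF // addr_gt0.
lra.
Qed.

Lemma regularZ c g : regular N g -> regular N (fun tau => c * g tau).
Proof. by move=> hg; apply: (regularM (regular_cst c) hg). Qed.

Lemma regularX g n : regular N g -> regular N (fun tau => g tau ^+ n).
Proof.
move=> hg; elim: n => [|n ih].
  by apply: (regular_ext _ (regular_cst 1)) => tau _; rewrite expr0.
by apply: (regular_ext _ (regularM hg ih)) => tau _; rewrite exprS.
Qed.

Lemma regular_sum (g : nat -> C -> C) n : (forall k, regular N (g k)) ->
  regular N (fun tau => \sum_(0 <= k < n) g k tau).
Proof.
move=> hg; elim: n => [|n ih].
  by apply: (regular_ext _ (regular_cst 0)) => tau _; rewrite big_geq.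
by apply: (regular_ext _ (regularD ih (hg n))) => tau _; rewrite big_nat_recr.
Qed.

Lemma regular_prod (g : nat -> C -> C) n : (forall k, regular N (g k)) ->
  regular N (fun tau => \prod_(0 <= k < n) g k tau).
Proof.
move=> hg; elim: n => [|n ih].
  by apply: (regular_ext _ (regular_cst 1)) => tau _; rewrite big_geq.
by apply: (regular_ext _ (regularM ih (hg n))) => tau _; rewrite big_nat_recr.
Qed.

Lemma regular_limit g : (forall y e : R, 0 < y -> 0 < e -> exists2 h, regular N h &
    forall tau, y <= complex.Im tau -> normc (g tau - h tau) <= e) -> regular N g.
Proof.
move=> H y e y0 e0; have e2 : 0 < e / 2 by lra.
have [h hh hgh] := H y _ y0 e2; have [p hp] := hh y _ y0 e2.
exists p => tau ht; have -> : g tau - p.[qexp (tau / N%:R)] =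
    (g tau - h tau) + (h tau - p.[qexp (tau / N%:R)]) by rewrite addrA subrK.
by apply: le_trans (le_normcD _ _) _; have := hgh _ ht; have := hp _ ht; lra.
Qed.

Lemma small_power (c r e : R) : 0 <= r < 1 -> 0 < e -> exists n, c * r ^+ n <= e.
Proof.
move=> r01 e0; have [K hK] := small_tails_geometric c r01 e0.
by exists K; have := hK K K.+1 (leqnn K); rewrite big_nat1.
Qed.

(** The bound on the remainder in [prod_cvg] is uniform on half-planes. *)
Lemma regular_infprod (u : nat -> C -> C) g : (forall k, regular N (u k)) ->
  (forall y : R, 0 < y -> exists c r : R, [/\ 0 <= c, 0 <= r < 1 &
     forall k tau, y <= complex.Im tau -> normc (u k tau) <= c * r ^+ k]) ->
  (forall tau, 0 < complex.Im tau ->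
     (fun n => \prod_(0 <= k < n) (1 + u k tau)) @ \oo --> g tau) ->
  regular N g.
Proof.
move=> hu bu hg; apply: regular_limit => y e y0 e0.
have [c [r [c0 r01 hc]]] := bu y y0.
have [n hn] := small_power (expR (c / (1 - r)) * c / (1 - r)) r01 e0.
exists (fun tau => \prod_(0 <= k < n) (1 + u k tau)).
  by apply: regular_prod => k; apply: regularD (regular_cst 1) (hu k).
move=> tau ht.
have [l hl bl] := prod_cvg c0 r01 (fun k => hc k tau ht).
have -> : g tau = l by apply: cvgc_unique hl; apply: hg; apply: lt_le_trans ht.
by rewrite normcBC; apply: le_trans (bl n) hn.
Qed.

Lemma regular_geometric (u : C -> C) : regular N u ->
  (forall y : R, 0 < y -> exists2 r : R, 0 <= r < 1 &
     forall tau, y <= complex.Im tau -> normc (u tau) <= r) ->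
  regular N (fun tau => (1 - u tau)^-1).
Proof.
move=> hu bu; apply: regular_limit => y e y0 e0.
have [r r01 hr] := bu y y0; have [n hn] := small_power (1 - r)^-1 r01 e0.
exists (fun tau => \sum_(0 <= k < n) u tau ^+ k).
  by apply: regular_sum => k; apply: regularX.
move=> tau ht; have /andP[r0 r1] := r01; have ur := hr tau ht.
have r1' : 0 < 1 - r by lra.
have lo : 1 - r <= normc (1 - u tau).
  by apply: le_trans (normc_lowerD _ _); rewrite normc1 normcN; lra.
have nz : 1 - u tau != 0 by rewrite -normc_gt0 (lt_le_trans r1').
have -> : (1 - u tau)^-1 - \sum_(0 <= k < n) u tau ^+ k = u tau ^+ n / (1 - u tau).
  apply: (mulfI nz); rewrite mulrBr mulfV // mulrCA mulfV // mulr1.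
  by rewrite geometric_sum opprB addrC subrK.
apply: le_trans hn; rewrite normcM normcV normcX mulrC.
apply: ler_pM; rewrite ?invr_ge0 ?normc_ge0 ?exprn_ge0 ?normc_ge0 //.
  by rewrite lef_pV2 ?posrE // (lt_le_trans r1').
by rewrite lerXn2r ?nnegrE ?normc_ge0.
Qed.

(** Convergence at height [y / 2] bounds the terms there, so that the convergence
    is geometric above height [y]. *)
Lemma regular_series g : holomorphic_at_infty N g -> regular N g.
Proof.
move=> [a ha]; apply: regular_limit => y e y0 e0.
have y2 : 0 < y / 2 by lra.
pose t1 : C := 0 +i* (y / 2).
pose term m tau := a m * qexp (m%:R * tau / N%:R).
have [B hB] : exists B : R, forall m, normc (term m t1) <= B.
  have [B hB] := cvgc_bounded (ha t1 y2); exists (B + B) => m.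
  have -> : term m t1 = series (fun m => term m t1) m.+1 - series (fun m => term m t1) m.
    by rewrite !seriesEnat /= big_nat_recr //= addrAC subrr add0r.
  by apply: le_trans (normcB _ _) _; apply: lerD; exact: hB.
have B0 : 0 <= B := le_trans (normc_ge0 _) (hB 0%N).
pose d := expR (- (2 * pi * (y / 2 / N%:R))).
have d01 : 0 <= d < 1.
  rewrite expR_ge0 -expR0 ltr_expR oppr_lt0 mulr_gt0 ?mulr_gt0 ?pi_gt0 //.
  by rewrite invr_gt0.
have bnd m tau : y <= complex.Im tau -> normc (term m tau) <= B * d ^+ m.
  move=> ht; have -> : term m tau = term m t1 * qexp ((tau - t1) / N%:R) ^+ m.
    rewrite /term -[RHS]mulrA -qexpMn -qexpD; congr (_ * qexp _).
    by rewrite [m%:R * (_ / _)]mulrA -mulrDl -mulrDr [t1 + _]addrC subrK.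
  rewrite normcM normcX; apply: ler_pM; rewrite ?normc_ge0 ?exprn_ge0 ?normc_ge0 //.
  rewrite lerXn2r ?nnegrE ?normc_ge0 ?expR_ge0 //; apply: normc_q_le.
  by rewrite ImD ImN /=; lra.
have [K hK] := small_tails_geometric B d01 e0.
exists (fun tau => \sum_(0 <= m < K) term m tau).
  apply: regular_sum => m; apply: regularZ.
  apply: (regular_ext _ (regularX m regular_q)) => tau _.
  by rewrite -qexpMn mulrA.
move=> tau ht; have t0 : 0 < complex.Im tau by apply: lt_le_trans ht.
apply: (cvgc_le (cvgcB (ha tau t0) (cvgc_cst (\sum_(0 <= m < K) term m tau)))).
exists K => n Kn; rewrite seriesEnat /= (@big_cat_nat _ _ _ K) //= addrAC subrr add0r.
apply: le_trans (normc_sum _ _ _) _; apply: le_trans (hK K n (leqnn K)).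
by apply: ler_sum => m _; exact: bnd.
Qed.

(* Points at height [y] whose [q^(1/N)] is a root of unity times a fixed value. *)
Let circle_point (y : R) (K j : nat) : (0 < K)%N -> exists2 tau : C,
  complex.Im tau = y & qexp ((0 +i* y) / N%:R) * qexp (j%:R / K%:R) = qexp (tau / N%:R).
Proof.
move=> K0; exists ((0 +i* y) + N%:R * (j%:R / K%:R)).
  rewrite ImD [N%:R * _]mulrA -natrM Im_natdiv.
  by have -> : complex.Im ((N * j)%:R : C) = 0 by [exact: (Im_int R (N * j)%:Z)]; rewrite mul0r addr0.
by rewrite -qexpD [in RHS]mulrDl mulrAC divff // mul1r.
Qed.

Let q_ratio (y : R) tau : y < complex.Im tau ->
  normc (qexp (tau / N%:R)) < normc (qexp ((0 +i* y : C) / N%:R)).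
Proof.
move=> h; rewrite !normc_q /= ltr_expR ltrN2 ltr_pM2l ?mulr_gt0 ?pi_gt0 //.
by rewrite ltr_pM2r ?invr_gt0.
Qed.

(** The maximum principle in the variable [tau]: a horizontal line is mapped to a
    circle. *)
Lemma poly_q_bound (p : {poly C}) (y B : R) :
  (forall tau, complex.Im tau = y -> normc p.[qexp (tau / N%:R)] <= B) ->
  forall z : C, normc z < normc (qexp ((0 +i* y) / N%:R)) ->
    normc p.[z] <= B / (1 - normc z / normc (qexp ((0 +i* y) / N%:R))).
Proof.
move=> h; apply: poly_bound (qexp_neq0 _) _ => K j K0.
by have [t ty ->] := circle_point y j K0; exact: h.
Qed.

(** The maximum principle above the line of height [y], for [y] tending to 0.
    This is how the vanishing of forms of negative weight is proved. *)
Lemma regular_vanish g (M : R) : regular N g ->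
  (forall tau, 0 < complex.Im tau -> normc (g tau) <= M * complex.Im tau) ->
  forall tau, 0 < complex.Im tau -> g tau = 0.
Proof.
move=> hg gM tau t0; apply/eqP; rewrite -normc_eq0 eq_le normc_ge0 andbT.
set Y := complex.Im tau in t0; have Y2 : 0 < Y / 2 by lra.
have YY : Y / 2 < complex.Im tau by rewrite -/Y; lra.
have := q_ratio YY; set q := qexp _; set s := qexp _ => qs.
have s0 : 0 < normc s by apply: le_lt_trans qs; exact: normc_ge0.
have D0 : 0 < 1 - normc q / normc s by rewrite subr_gt0 ltr_pdivrMr // mul1r.
set D := (1 - normc q / normc s)^-1.
have D1 : 0 < D by rewrite invr_gt0.
have M0 : 0 <= M.
  by have := le_trans (normc_ge0 _) (gM tau t0); rewrite pmulr_lge0.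
apply/ler_addgt0Pr => e e0; rewrite add0r.
pose y := Num.min (Y / 2) (e / (1 + (M + 1) * D)).
have C0 : 0 < 1 + (M + 1) * D by rewrite addr_gt0 // mulr_gt0 // ltr_wpDl.
have y0 : 0 < y by rewrite lt_min Y2 divr_gt0.
have yY : y <= Y / 2 by rewrite ge_min lexx.
have ye : y * (1 + (M + 1) * D) <= e.
  by rewrite -ler_pdivlMr // ge_min lexx orbT.
have [p hp] := hg y y y0 y0.
have hline t : complex.Im t = y -> normc p.[qexp (t / N%:R)] <= (M + 1) * y.
  move=> ty; have -> : p.[qexp (t / N%:R)] = g t - (g t - p.[qexp (t / N%:R)]).
    by rewrite opprB addrC subrK.
  apply: le_trans (normcB _ _) _; rewrite mulrDl mul1r; apply: lerD.
    by rewrite -ty; apply: gM; rewrite ty.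
  by apply: hp; rewrite ty.
have q1 : normc q < normc (qexp ((0 +i* y) / N%:R)).
  by apply: q_ratio; rewrite -/Y; lra.
have := poly_q_bound hline q1.
set s' := normc (qexp _) in q1 * => hpq.
have s's : normc s <= s'.
  rewrite /s /s' !normc_q /= ler_expR lerN2 ler_pM2l ?mulr_gt0 ?pi_gt0 //.
  by rewrite ler_pM2r ?invr_gt0.
have s'0 : 0 < s' by apply: lt_le_trans s's.
have hD : (1 - normc q / s')^-1 <= D.
  rewrite lef_pV2 ?posrE // ?lerD2l ?lerN2.
    by rewrite ler_wpM2l ?normc_ge0 // lef_pV2 ?posrE.
  by rewrite subr_gt0 ltr_pdivrMr // mul1r.
have -> : g tau = (g tau - p.[q]) + p.[q] by rewrite subrK.
apply: le_trans (le_normcD _ _) _.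
have h1 : normc (g tau - p.[q]) <= y by apply: hp; rewrite -/Y; lra.
have h2 : normc p.[q] <= (M + 1) * y * D.
  apply: le_trans hpq _; rewrite ler_wpM2l //.
  by rewrite mulr_ge0 ?(ltW y0) // addr_ge0.
lra.
Qed.

(** The constant terms of the approximating polynomials converge to [l]. After
    division by [q^(1/N)] the error stays small: it is estimated on the lower line
    of height [y / 2] and transported to height [y] by the maximum principle. *)
Lemma regular_divide g : regular N g -> exists (l : C) (g' : C -> C),
  regular N g' /\ forall tau, g tau = l + qexp (tau / N%:R) * g' tau.
Proof.
move=> hg.
have p0_le (p : {poly C}) (y B : R) : (forall tau, complex.Im tau = y ->
    normc p.[qexp (tau / N%:R)] <= B) -> normc p.[0] <= B.
  move=> h; have := poly_q_bound h (z := 0).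
  by rewrite normc0 mul0r subr0 divr1; apply; rewrite normc_gt0 qexp_neq0.
pose P n := projT1 (cid (hg 1 n.+1%:R^-1 ltr01 (eqbRL (invr_gt0 _) (ltr0Sn R n)))).
have hP n tau : 1 <= complex.Im tau ->
    normc (g tau - (P n).[qexp (tau / N%:R)]) <= n.+1%:R^-1.
  by rewrite /P; case: cid => p /= h; exact: h.
have close (p : {poly C}) (y e : R) : 0 < y ->
    (forall tau, y <= complex.Im tau -> normc (g tau - p.[qexp (tau / N%:R)]) <= e) ->
    forall n, normc (p.[0] - (P n).[0]) <= e + n.+1%:R^-1.
  move=> y0 hp n; rewrite -hornerN -hornerD; apply: (p0_le _ (y + 1)) => tau ht.
  rewrite hornerD hornerN.
  have -> : p.[qexp (tau / N%:R)] - (P n).[qexp (tau / N%:R)] =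
     (g tau - (P n).[qexp (tau / N%:R)]) - (g tau - p.[qexp (tau / N%:R)]).
    by ring.
  apply: le_trans (normcB _ _) _; rewrite addrC.
  by apply: lerD; [apply: hp|apply: hP]; rewrite ht; lra.
have inv_small (e : R) : 0 < e -> exists n0, forall n, (n0 <= n)%N -> n.+1%:R^-1 <= e.
  move=> e0; exists (Num.bound e^-1) => n hn; rewrite invf_ple ?posrE ?ltr0n //.
  apply: le_trans (ltW (archi_boundP _)) _; first by rewrite invr_ge0 ltW.
  by rewrite ler_nat (leq_trans hn).
have [l hl] : exists l : C, (fun n => (P n).[0]) @ \oo --> l.
  apply: cauchyc => e e0; have e2 : 0 < e / 2 by lra.
  have [n0 hn0] := inv_small _ e2; exists n0 => n hn.
  have h := close (P n) 1 _ ltr01 (hP n) n0.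
  by apply: le_trans h _; rewrite (splitr e); apply: lerD; [exact: hn0|exact: hn0].
have close_l (p : {poly C}) (y e : R) : 0 < y ->
    (forall tau, y <= complex.Im tau -> normc (g tau - p.[qexp (tau / N%:R)]) <= e) ->
    normc (p.[0] - l) <= e.
  move=> y0 hp; apply/ler_addgt0Pr => d d0; have [n0 hn0] := inv_small _ d0.
  apply: (cvgc_le (cvgcB (cvgc_cst p.[0]) hl)); exists n0 => n hn.
  by apply: le_trans (close p y e y0 hp n) _; rewrite lerD2l; exact: hn0.
exists l, (fun tau => (g tau - l) / qexp (tau / N%:R)); split; last first.
  by move=> tau; rewrite mulrCA mulfV ?qexp_neq0 // mulr1 addrC subrK.
move=> y e y0 e0; have y2 : 0 < y / 2 by lra.
pose r := normc (qexp ((0 +i* (y / 2) : C) / N%:R)).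
pose r0 := expR (- (2 * pi * (y / N%:R))).
have rr0 : r0 < r.
  rewrite /r normc_q /= ltr_expR ltrN2 ltr_pM2l ?mulr_gt0 ?pi_gt0 //.
  by rewrite ltr_pM2r ?invr_gt0 //; lra.
have r00 : 0 < r0 by exact: expR_gt0.
have rpos : 0 < r by apply: lt_trans rr0.
have r1 : r <= 1 by apply: normc_q_le1; rewrite /= ltW.
pose e' := e * (r - r0) / 2.
have e'0 : 0 < e' by rewrite divr_gt0 // mulr_gt0 // subr_gt0.
have [p hp] := hg (y / 2) e' y2 e'0; have [p' hp'] := poly_split p.
exists p' => tau ht; set q := qexp (tau / N%:R).
have q0 : q != 0 by exact: qexp_neq0.
have nq0 : 0 < normc q by rewrite normc_gt0.
have qr0 : normc q <= r0 by exact: normc_q_le.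
apply/ler_addgt0Pr => d d0.
(* The error made by a second, much better, approximation is harmless at [tau]. *)
pose dd := d / (2 / normc q + 2 / (r - r0)).
have rr : 0 < r - r0 by rewrite subr_gt0.
have K0 : 0 < 2 / normc q + 2 / (r - r0) by rewrite addr_gt0 // divr_gt0.
have dd0 : 0 < dd by rewrite divr_gt0.
have [s hs] := hg (y / 2) dd y2 dd0; have [s' hs'] := poly_split s.
have cs := close_l s _ _ y2 hs; have cp := close_l p _ _ y2 hp.
have -> : (g tau - l) / q - p'.[q] =
   ((g tau - s.[q]) + (s.[0] - l)) / q + (s' - p').[q].
  rewrite hornerD hornerN hs'; set a := s'.[q].
  have -> : g tau - (s.[0] + q * a) + (s.[0] - l) = (g tau - l) - a * q.
    by rewrite opprD [q * a]mulrC !addrA; ring.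
  by rewrite [(_ - a * q) / q]mulrBl mulfK // addrA subrK.
apply: le_trans (le_normcD _ _) _.
have h1 : normc ((g tau - s.[q] + (s.[0] - l)) / q) <= 2 * dd / normc q.
  rewrite normcM normcV ler_pM2r ?invr_gt0 //; apply: le_trans (le_normcD _ _) _.
  by have := hs tau (ltac:(lra)); lra.
have line t : complex.Im t = y / 2 ->
    normc (s' - p').[qexp (t / N%:R)] <= 2 * (dd + e') / r.
  move=> ty; set w := qexp (t / N%:R).
  have wr : normc w = r by rewrite /r !normc_q /= ty.
  rewrite ler_pdivlMr // -wr mulrC -normcM hornerD hornerN.
  have -> : w * (s'.[w] - p'.[w]) =
     ((g t - p.[w]) - (g t - s.[w])) - ((s.[0] - l) - (p.[0] - l)).
    by rewrite (hp' w) (hs' w); ring.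
  apply: le_trans (normcB _ _) _.
  have := normcB (g t - p.[w]) (g t - s.[w]); have := normcB (s.[0] - l) (p.[0] - l).
  have ht2 : y / 2 <= complex.Im t by rewrite ty.
  have := hp t ht2; have := hs t ht2; lra.
have qr : normc q < r by apply: le_lt_trans rr0.
have h2 := poly_q_bound line qr; rewrite -/r in h2.
have h3 : 2 * (dd + e') / r / (1 - normc q / r) <= 2 * (dd + e') / (r - r0).
  have -> : 2 * (dd + e') / r / (1 - normc q / r) = 2 * (dd + e') / (r - normc q).
    by apply: div_one_sub_div; rewrite gt_eqF.
  rewrite ler_wpM2l ?mulr_ge0 ?addr_ge0 ?(ltW dd0) ?(ltW e'0) //.
  by rewrite lef_pV2 ?posrE ?subr_gt0 //; lra.
have -> : e + d = 2 * dd / normc q + 2 * (dd + e') / (r - r0).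
  have {1}-> : d = dd * (2 / normc q + 2 / (r - r0)) by rewrite /dd mulfVK // gt_eqF.
  by apply: error_budget; rewrite ?gt_eqF.
by apply: lerD => //; apply: le_trans h2 h3.
Qed.

Lemma regular_level M g : (0 < M)%N -> regular N g -> regular (N * M)%N g.
Proof.
move=> M0 hg y e y0 e0; have [p hp] := hg y e y0 e0; exists (p \Po 'X^M) => tau ht.
have MC : (M%:R : C) != 0 by rewrite pnatr_eq0 -lt0n.
rewrite horner_comp hornerXn -qexpMn natrM invfM mulrCA [M%:R * _]mulrCA.
by rewrite mulfV // mulr1; exact: hp.
Qed.

(** The substitution turns [q^(1/N)] into a root of unity times a power of
    [q^(1/(N y))]. *)
Lemma regular_subst (x y : nat) (j : int) g : (0 < x)%N -> (0 < y)%N -> regular N g ->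
  regular (N * y)%N (fun tau => g ((x%:R * tau + j%:~R) / y%:R)).
Proof.
move=> x0 y0 hg h e h0 e0.
have yR : 0 < (y%:R : R) by rewrite ltr0n.
have xR : 0 < (x%:R : R) by rewrite ltr0n.
have h1 : 0 < x%:R * h / y%:R by rewrite divr_gt0 // mulr_gt0.
have [p hp] := hg _ e h1 e0.
pose zeta : C := qexp (j%:~R / y%:R / N%:R).
exists (p \Po (zeta *: 'X^x)) => tau ht.
have -> : (p \Po (zeta *: 'X^x)).[qexp (tau / (N * y)%N%:R)] =
   p.[qexp ((x%:R * tau + j%:~R) / y%:R / N%:R)].
  rewrite horner_comp hornerZ hornerXn -qexpMn -qexpD; congr (p.[qexp _]).
  by rewrite natrM invfM; ring.
apply: hp; rewrite Im_natdiv ImD Im_int addr0.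
rewrite -(rmorph_nat (real_complex R)) ImMreal ler_pM2r ?invr_gt0 //.
by rewrite ler_pM2l.
Qed.

End Level.
End Regular.

(** * Theta series at infinity *)

Section Good.
Variable R : realType.
Local Notation C := R[i].
Implicit Types (g h : C -> C) (tau : C).

(** The level [N] is left free, since it changes under the substitutions made at
    the different cusps. *)
Definition good g := exists2 N : nat, (0 < N)%N & regular N g.

Lemma good_ext g h : (forall tau, 0 < complex.Im tau -> g tau = h tau) -> good g -> good h.
Proof. by move=> e [N N0 hg]; exists N => //; apply: regular_ext e hg. Qed.

Lemma good_cst (c : C) : good (fun=> c).
Proof. by exists 1%N => //; exact: regular_cst. Qed.

Lemma good_common g h : good g -> good h ->
  exists N, [/\ (0 < N)%N, regular N g & regular N h].
Proof.
move=> [N N0 hg] [M M0 hh]; exists (N * M)%N; rewrite muln_gt0 N0 M0.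
by split=> //; [exact: regular_level|rewrite mulnC; exact: regular_level].
Qed.

Lemma goodD g h : good g -> good h -> good (fun tau => g tau + h tau).
Proof. by move=> hg hh; have [N [N0 a b]] := good_common hg hh; exists N => //; exact: regularD. Qed.

Lemma goodM g h : good g -> good h -> good (fun tau => g tau * h tau).
Proof. by move=> hg hh; have [N [N0 a b]] := good_common hg hh; exists N => //; exact: regularM. Qed.

Lemma goodZ c g : good g -> good (fun tau => c * g tau).
Proof. by move=> hg; exact: (goodM (good_cst c) hg). Qed.

Lemma goodB g h : good g -> good h -> good (fun tau => g tau - h tau).
Proof.
move=> hg hh; apply: (good_ext _ (goodD hg (goodZ (-1) hh))) => tau _.
by rewrite mulN1r.
Qed.

Lemma goodX g n : good g -> good (fun tau => g tau ^+ n).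
Proof. by move=> [N N0 hg]; exists N => //; exact: regularX. Qed.

Lemma good_subst (x y : nat) (j : int) g : (0 < x)%N -> (0 < y)%N -> good g ->
  good (fun tau => g ((x%:R * tau + j%:~R) / y%:R)).
Proof.
move=> x0 y0 [N N0 hg]; exists (N * y)%N; first by rewrite muln_gt0 N0.
exact: regular_subst.
Qed.

Lemma good_bounded g : good g -> forall y : R, 0 < y ->
  exists M : R, forall tau, y <= complex.Im tau -> normc (g tau) <= M.
Proof. by move=> [N N0 hg] y y0; exact: (regular_bounded N0 hg). Qed.

Lemma good_vanish g (M : R) : good g ->
  (forall tau, 0 < complex.Im tau -> normc (g tau) <= M * complex.Im tau) ->
  forall tau, 0 < complex.Im tau -> g tau = 0.
Proof. by move=> [N N0 hg] gM tau t0; exact: (regular_vanish N0 hg gM t0). Qed.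

(** Otherwise the cofactor would be unbounded as [Im tau] tends to infinity. *)
Lemma const_zero (N : nat) (c : C) h : (0 < N)%N -> good h ->
  (forall tau, 0 < complex.Im tau -> c = qexp (tau / N%:R) * h tau) -> c = 0.
Proof.
move=> N0 hh e; have [M hM] := good_bounded hh (@ltr01 R).
apply/eqP; rewrite -normc_eq0 eq_le normc_ge0 andbT; apply/ler_addgt0Pr => d d0.
rewrite add0r; pose r := normc (qexp ((0 +i* 1 : C) / N%:R)).
have r01 : 0 <= r < 1.
  by rewrite normc_ge0 /=; apply: normc_qexp_lt1; rewrite Im_natdiv /= divr_gt0 ?ltr0n.
have [n hn] := small_power M r01 d0.
have it : complex.Im (0 +i* n.+1%:R : C) = n.+1%:R by [].
rewrite (e (0 +i* n.+1%:R)) ?it ?ltr0n // normcM mulrC.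
apply: le_trans hn; have M0 : 0 <= M.
  by apply: le_trans (normc_ge0 _) (hM (0 +i* 1) _).
have -> : (0 +i* n.+1%:R : C) = n.+1%:R * (0 +i* 1).
  by rewrite -(rmorph_nat (real_complex R)); simpc.
rewrite -mulrA qexpMn normcX -/r; apply: ler_pM; rewrite ?normc_ge0 ?exprn_ge0 ?normc_ge0 //.
  by apply: hM; rewrite -(rmorph_nat (real_complex R)) ImMreal /= mulr1 ler1n.
by case/andP: r01 => r0 r1; rewrite exprS ler_piMl ?exprn_ge0 // ltW.
Qed.

(** At level [2K] one divides [K] times by [q^(1/2K)]; because of the period 2 the
    constant terms met after the first division vanish, by [const_zero]. *)
Lemma good_divide g : good g -> (forall tau, 0 < complex.Im tau -> g (tau + 2) = g tau) ->
  exists (l : C) h, good h /\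
    forall tau, 0 < complex.Im tau -> g tau = l + qexp (tau / 2) * h tau.
Proof.
move=> [K K0 hg0] per; pose N := (K * 2)%N.
have N0 : (0 < N)%N by rewrite muln_gt0 K0.
have KC : (K%:R : C) != 0 by rewrite pnatr_eq0 -lt0n.
have hg : regular N g by apply: regular_level.
have [l [g1 [hg1 e1]]] := regular_divide N0 hg.
have qper tau : qexp ((tau + 2) / N%:R) = qexp (tau / N%:R) * qexp (1 / K%:R).
  rewrite mulrDl qexpD; congr (_ * qexp _); rewrite /N natrM invfM mulrCA.
  by rewrite mulfV ?mulr1 ?mul1r // pnatr_eq0.
have shift h : regular N h -> good (fun tau => h (tau + 2)).
  move=> hh; have := @good_subst 1 1 2 h isT isT.
  case=> [|M M0 hM]; first by exists N.
  by exists M => //; apply: (regular_ext _ hM) => tau _; rewrite mul1r divr1.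
have claim j : (j < K)%N -> exists2 h, regular N h &
    forall tau, 0 < complex.Im tau -> g tau = l + qexp (tau / N%:R) ^+ j.+1 * h tau.
  elim: j => [|j ih] jK; first by exists g1 => // tau _; rewrite expr1.
  have [h hh eh] := ih (ltnW jK); have [c [h' [hh' eh']]] := regular_divide N0 hh.
  suff c0 : c = 0.
    by exists h' => // tau t0; rewrite eh // eh' c0 add0r mulrA -exprSr.
  pose zeta : C := qexp (1 / K%:R) ^+ j.+1.
  have z1 : 1 - zeta != 0.
    rewrite subr_eq0 eq_sym /zeta -qexpMn mulrA mulr1.
    by apply: qexp_root_neq1; rewrite jK.
  apply/eqP; rewrite -(inj_eq (mulIf z1)) mul0r; apply/eqP.
  have hgood : good (fun tau => zeta * qexp (1 / K%:R) * h' (tau + 2) - h' tau).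
    by apply: goodB; [apply: goodZ; exact: shift|exists N].
  apply: (const_zero N0 hgood) => tau t0.
  have t2 : 0 < complex.Im (tau + 2) by rewrite ImD (Im_int R 2) addr0.
  have := per tau t0; rewrite !eh // qper exprMn -/zeta => /addrI e0.
  have {e0} : zeta * h (tau + 2) = h tau.
    by apply: (mulfI (expf_neq0 j.+1 (qexp_neq0 (tau / N%:R)))); rewrite mulrA.
  rewrite !eh' qper mulrBr mulr1 mulrDr => e; rewrite mulrBr.
  apply/eqP; rewrite subr_eq -subr_eq0; apply/eqP.
  have {}e : zeta * c = c + qexp (tau / N%:R) * h' tau -
      zeta * (qexp (tau / N%:R) * qexp (1 / K%:R) * h' (tau + 2)).
    by rewrite -e addrK.
  rewrite [c * zeta]mulrC e; ring.
have [|h hh eh] := claim K.-1; first by rewrite prednK.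
exists l, h; split; first by exists N.
move=> tau t0; rewrite eh // prednK // -qexpMn /N natrM invfM.
by rewrite mulrCA [K%:R * _]mulrA mulfV // mul1r.
Qed.

Lemma q_le (y : R) tau : y <= complex.Im tau ->
  normc (qexp (tau / 1%:R)) <= expR (- (2 * pi * (y / 1%:R))).
Proof. exact: normc_q_le. Qed.

Let rlt1 (y : R) : 0 < y -> 0 <= expR (- (2 * pi * (y / 1%:R))) < 1.
Proof.
move=> y0; rewrite expR_ge0 -expR0 ltr_expR oppr_lt0.
by rewrite mulr_gt0 ?mulr_gt0 ?pi_gt0 // divr_gt0.
Qed.

Lemma regular_euler : regular 1 (fun tau => euler (qexp (tau / 1%:R))).
Proof.
apply: (@regular_infprod _ 1 isT (fun k tau => - qexp (tau / 1%:R) ^+ k.+1)).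
- move=> k; apply: (@regular_ext R 1 _ _ _ (@regularZ R 1 isT (-1) _ (@regularX R 1 isT _ k.+1 (@regular_q R 1)))).
  by move=> tau _; rewrite mulN1r.
- move=> y y0; set r := expR (- (2 * pi * (y / 1%:R))); exists r, r.
  split; [exact: expR_ge0|exact: rlt1|].
  by move=> k tau ht; apply: euler_factor_le; exact: q_le.
by move=> tau t0; apply: euler_cvg; apply: normc_qexp_lt1; rewrite divr1.
Qed.

(** The inverse is again an infinite product with rapidly decreasing factors. *)
Lemma regular_euler_inv : regular 1 (fun tau => (euler (qexp (tau / 1%:R)))^-1).
Proof.
pose u k tau : C := qexp (tau / 1%:R) ^+ k.+1.
have ru k : regular 1 (u k) by exact: (@regularX R 1 isT _ k.+1 (@regular_q R 1)).
have ub (y : R) : 0 < y -> forall k tau, y <= complex.Im tau ->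
    normc (u k tau) <= expR (- (2 * pi * (y / 1%:R))) * expR (- (2 * pi * (y / 1%:R))) ^+ k.
  by move=> y0 k tau ht; rewrite -[normc _]normcN; apply: euler_factor_le; exact: q_le.
apply: (@regular_infprod _ 1 isT (fun k tau => u k tau * (1 - u k tau)^-1)).
- move=> k; apply: regularM (ru k) _ => //; apply: regular_geometric (ru k) _ => //.
  move=> y y0; have r01 := rlt1 y0; exists (expR (- (2 * pi * (y / 1%:R)))) => //.
  move=> tau ht; apply: le_trans (ub y y0 k tau ht) _.
  by case/andP: r01 => r0 r1; rewrite ler_piMr // exprn_ile1 // ltW.
- move=> y y0; have r01 := rlt1 y0; set r := expR _ in r01.
  case/andP: (r01) => r0 r1; exists (r / (1 - r)), r; split => //.
    by rewrite divr_ge0 // subr_ge0 ltW.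
  move=> k tau ht; rewrite normcM normcV mulrAC.
  have h := one_sub_expr_ge k (q_le ht) r1.
  apply: ler_pM; rewrite ?normc_ge0 ?invr_ge0 ?normc_ge0 //; first exact: ub.
  by rewrite lef_pV2 ?posrE // ?(lt_le_trans _ h) // subr_gt0.
move=> tau t0; have q1 : normc (qexp (tau / 1%:R)) < 1.
  by apply: normc_qexp_lt1; rewrite divr1.
have := cvgcV (euler_cvg q1) (euler_neq0 q1); apply: cvgc_ext => n.
rewrite -prodfV; apply: eq_bigr => k _.
have nz := one_sub_expr_neq0 k q1; rewrite /u.
by apply: (mulfI nz); rewrite mulfV // mulrDr mulr1 mulrCA mulfV // mulr1 subrK.
Qed.

Lemma good_euler_subst (x y : nat) : (0 < x)%N -> (0 < y)%N ->
  good (fun tau => euler (qexp (x%:R * tau / y%:R))) /\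
  good (fun tau => (euler (qexp (x%:R * tau / y%:R)))^-1).
Proof.
move=> x0 y0; split.
  have := @good_subst x y 0 _ x0 y0 (ex_intro2 _ _ 1%N isT regular_euler).
  by apply: good_ext => tau _; rewrite addr0 divr1.
have := @good_subst x y 0 _ x0 y0 (ex_intro2 _ _ 1%N isT regular_euler_inv).
by apply: good_ext => tau _; rewrite addr0 divr1.
Qed.

End Good.

Section ThetaPowers.
Variable R : realType.
Local Notation C := R[i].
Implicit Types tau : C.

(** Fourth powers of the theta series [theta_4], [theta_3] and [theta_2], of nome
    [p = e^(pi i tau)], by their product formulas. *)
Definition th4 tau : C :=
  (euler (qexp (tau / 2)) ^+ 4 / euler (qexp (tau / 2) ^+ 2) ^+ 2) ^+ 2.

Definition th3 tau : C := th4 (tau + 1).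

Definition th2 tau : C := 16 * qexp (tau / 2) *
  (euler (qexp (tau / 2) ^+ 4) ^+ 4 / euler (qexp (tau / 2) ^+ 2) ^+ 2) ^+ 2.

Lemma mulf_swap (F : fieldType) (a t r x : F) : a * t * r * x = t * (a * r * x).
Proof. ring. Qed.

Lemma th4_inversion tau : 0 < complex.Im tau -> th4 tau = - (tau ^- 2 * th2 (- tau^-1)).
Proof.
move=> t0; rewrite /th4 (theta_inversion t0) /th2; congr (- _).
exact: mulf_swap.
Qed.

Lemma qexp_half_shift tau : qexp ((tau + 1) / 2) = - qexp (tau / 2).
Proof. by rewrite mulrDl qexpD mul1r qexp_half mulrN1. Qed.

Lemma half_add2 (F : fieldType) (t : F) : (2%:R : F) != 0 -> (t + 2) / 2 = t / 2 + 1.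
Proof. by move=> h; rewrite mulrDl mulfV. Qed.

Lemma even_powers_opp (F : fieldType) (p : F) : (- p) ^+ 2 = p ^+ 2 /\ (- p) ^+ 4 = p ^+ 4.
Proof. by split; ring. Qed.

Lemma th4D2 tau : th4 (tau + 2) = th4 tau.
Proof. have two : (2%:R : C) != 0 by rewrite pnatr_eq0.
by have e := half_add2 tau two; rewrite /th4 e qexpD1.
 Qed.

Lemma th2D1 tau : th2 (tau + 1) = - th2 tau.
Proof. by rewrite /th2 qexp_half_shift (even_powers_opp _).1 (even_powers_opp _).2 mulrN mulNr. Qed.

Let sq tau : qexp (tau / 2) ^+ 2 = qexp tau.
Proof. by rewrite -qexpMn double_half. Qed.

Let qd tau : qexp (tau / 2) ^+ 4 = qexp (2 * tau).
Proof. by rewrite -[4%N]/(2 * 2)%N exprM sq -qexpMn. Qed.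

Lemma good_th4 : good th4.
Proof.
have [h1 _] := @good_euler_subst R 1 2 isT isT.
have [_ h2] := @good_euler_subst R 1 1 isT isT.
apply: good_ext (goodX 2 (goodM (goodX 4 h1) (goodX 2 h2))) => tau _.
by rewrite /th4 !mul1r divr1 sq exprVn.
Qed.

Lemma good_th4V : good (fun tau => (th4 tau)^-1).
Proof.
have [_ h1] := @good_euler_subst R 1 2 isT isT.
have [h2 _] := @good_euler_subst R 1 1 isT isT.
apply: good_ext (goodX 2 (goodM (goodX 4 h1) (goodX 2 h2))) => tau _.
by rewrite /th4 !mul1r divr1 sq -exprVn invfM invrK exprVn.
Qed.

Let shift g : good g -> good (fun tau : C => g (tau + 1)).
Proof.
move=> hg; have := @good_subst R 1 1 1 g isT isT hg.
by apply: good_ext => tau _; rewrite mul1r divr1.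
Qed.

Lemma good_th3 : good th3. Proof. exact: shift good_th4. Qed.

Lemma good_th3V : good (fun tau => (th3 tau)^-1). Proof. exact: shift good_th4V. Qed.

Lemma good_th2 : good th2.
Proof.
have [h1 _] := @good_euler_subst R 2 1 isT isT.
have [_ h2] := @good_euler_subst R 1 1 isT isT.
have h0 : good (fun tau : C => qexp (tau / 2%:R)) by exists 2%N => //; exact: regular_q.
apply: good_ext (goodM (goodZ 16 h0) (goodX 2 (goodM (goodX 4 h1) (goodX 2 h2)))) => tau _.
by rewrite /th2 qd sq !mul1r !divr1 exprVn.
Qed.

(** The order of vanishing of [th2] at infinity is one in [q^(1/2)], so that division
    by [th2] is possible for forms without constant term. *)
Lemma th2_factor : exists h : C -> C, [/\ good h, good (fun tau => (h tau)^-1) &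
  forall tau, th2 tau = qexp (tau / 2) * h tau].
Proof.
exists (fun tau => 16 * (euler (qexp (tau / 2) ^+ 4) ^+ 4 / euler (qexp (tau / 2) ^+ 2) ^+ 2) ^+ 2).
have [h1 h1'] := @good_euler_subst R 2 1 isT isT.
have [h2 h2'] := @good_euler_subst R 1 1 isT isT.
split=> [| |tau]; last by rewrite /th2 [16 * _]mulrC mulrA.
  apply: good_ext (goodZ 16 (goodX 2 (goodM (goodX 4 h1) (goodX 2 h2')))) => tau _.
  by rewrite qd sq !mul1r !divr1 exprVn.
apply: good_ext (goodZ 16^-1 (goodX 2 (goodM (goodX 4 h1') (goodX 2 h2)))) => tau _.
by rewrite qd sq !mul1r !divr1 invfM -exprVn invfM invrK exprVn.
Qed.

Lemma th4_neq0 tau : 0 < complex.Im tau -> th4 tau != 0.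
Proof.
move=> t0; have q1 : normc (qexp (tau / 2)) < 1.
  by apply: normc_qexp_lt1; rewrite Im_natdiv divr_gt0.
have e1 := euler_neq0 q1; have e2 : euler (qexp (tau / 2) ^+ 2) != 0.
  by apply: euler_neq0; rewrite sq normc_qexp_lt1.
exact: (expf_neq0 2 (mulf_neq0 (expf_neq0 4 e1) (invr_neq0 (expf_neq0 2 e2)))).
Qed.

Lemma th2_neq0 tau : 0 < complex.Im tau -> th2 tau != 0.
Proof.
move=> t0; have t2 : 0 < complex.Im (2 * tau).
  by rewrite (ImMint 2 tau) mulr_gt0.
have e1 : euler (qexp (tau / 2) ^+ 4) != 0.
  by apply: euler_neq0; rewrite qd; exact: normc_qexp_lt1.
have e2 : euler (qexp (tau / 2) ^+ 2) != 0.
  by apply: euler_neq0; rewrite sq; exact: normc_qexp_lt1.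
have n16 : (16%:R : C) != 0 by rewrite pnatr_eq0.
exact: (mulf_neq0 (mulf_neq0 n16 (qexp_neq0 _))
  (expf_neq0 2 (mulf_neq0 (expf_neq0 4 e1) (invr_neq0 (expf_neq0 2 e2))))).
Qed.

End ThetaPowers.

(** * Integer matrices of order 2 *)

Section Matrices.
Implicit Types A B : 'M[int]_2.

Lemma ord2P (i : 'I_2) : i = 0 \/ i = 1.
Proof. by case: i => [[|[|]]] // h; [left|right]; apply: val_inj. Qed.

Definition mat2 (a b c d : int) : 'M[int]_2 :=
  \matrix_(i, j) if i == 0 then if j == 0 then a else b else if j == 0 then c else d.

Lemma mat2E a b c d : (mat2 a b c d 0 0 = a) * (mat2 a b c d 0 1 = b) *
  (mat2 a b c d 1 0 = c) * (mat2 a b c d 1 1 = d).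
Proof. by rewrite !mxE. Qed.

Lemma eq_mat2 A B : A 0 0 = B 0 0 -> A 0 1 = B 0 1 -> A 1 0 = B 1 0 -> A 1 1 = B 1 1 -> A = B.
Proof.
by move=> h1 h2 h3 h4; apply/matrixP => i j; case: (ord2P i) => ->; case: (ord2P j) => ->.
Qed.

Lemma mul2E A B i j : (A *m B) i j = A i 0 * B 0 j + A i 1 * B 1 j.
Proof.
rewrite mxE !big_ord_recl big_ord0 addr0.
by congr (_ + A i _ * B _ j); apply: val_inj.
Qed.

Lemma det2E A : \det A = A 0 0 * A 1 1 - A 0 1 * A 1 0.
Proof.
rewrite (expand_det_row _ 0) !big_ord_recl big_ord0 /cofactor !det_mx11 !mxE /= addr0.
rewrite expr0 expr1 mul1r mulN1r mulrN.
by congr (A _ _ * A _ _ - A _ _ * A _ _); apply: val_inj.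
Qed.

Lemma SL2Z_mul A B : SL2Z A -> SL2Z B -> SL2Z (A *m B).
Proof. by rewrite /SL2Z /= => hA hB; rewrite det_mulmx hA hB mulr1. Qed.

Definition adj2 A := mat2 (A 1 1) (- A 0 1) (- A 1 0) (A 0 0).

Lemma SL2Z_entries A : SL2Z A -> A 0 0 * A 1 1 - A 0 1 * A 1 0 = 1.
Proof. by rewrite /SL2Z /= det2E. Qed.

Lemma SL2Z_adj A : SL2Z A -> SL2Z (adj2 A).
Proof.
by move=> /SL2Z_entries h; rewrite /SL2Z /= det2E !mat2E mulrNN mulrC.
Qed.

Lemma adj2_mul A : SL2Z A -> adj2 A *m A = 1%:M.
Proof.
move=> /SL2Z_entries h; apply: eq_mat2; rewrite mul2E !mat2E !mxE /=; nia.
Qed.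

Definition trans (j : int) := mat2 1 j 0 1.

Definition Smat := mat2 0 (-1) 1 0.

Lemma SL2Z_trans j : SL2Z (trans j).
Proof. by rewrite /SL2Z /= det2E !mat2E mulr0 subr0. Qed.

Lemma SL2Z_S : SL2Z Smat. Proof. by rewrite /SL2Z /= det2E !mat2E. Qed.

Lemma SL2Z_1 : SL2Z 1%:M. Proof. by rewrite /SL2Z /= det1. Qed.

Lemma trans_add i j : trans i *m trans j = trans (i + j).
Proof. by apply: eq_mat2; rewrite mul2E !mat2E; lia. Qed.

(** The Euclidean algorithm on the first column. *)
Lemma SL2Z_ind (P : 'M[int]_2 -> Prop) : P 1%:M ->
  (forall A, SL2Z A -> P A -> P (Smat *m A)) ->
  (forall A, SL2Z A -> P A -> P (trans 1 *m A) /\ P (trans (-1) *m A)) ->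
  forall A, SL2Z A -> P A.
Proof.
move=> P1 PS PT.
have PTj j A : SL2Z A -> P A -> P (trans j *m A).
  move=> hA hP; have t0 : trans 0 = 1%:M by apply: eq_mat2; rewrite !mat2E !mxE.
  elim/int_rec: j => [|n ih|n ih]; first by rewrite t0 mul1mx.
    have -> : trans n.+1 = trans 1 *m trans n by rewrite trans_add; congr trans; lia.
    rewrite -mulmxA; by case: (PT _ (SL2Z_mul (SL2Z_trans n) hA) ih).
  have -> : trans (- n.+1%:Z) = trans (-1) *m trans (- n%:Z).
    by rewrite trans_add; congr trans; lia.
  rewrite -mulmxA.
  by case: (PT _ (SL2Z_mul (SL2Z_trans (- n%:Z)) hA) ih).
move=> A; have [m] := ubnP `|A 1 0|; elim: m A => // m ih A hm hA.
have e := SL2Z_entries hA.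
case: (eqVneq (A 1 0) 0) => [c0|c0].
  have : (A 0 0 = 1 /\ A 1 1 = 1) \/ (A 0 0 = -1 /\ A 1 1 = -1).
    move: e; rewrite c0 mulr0 subr0 => e; have := congr1 absz e; rewrite abszM.
    by move=> /eqP; rewrite muln_eq1 => /andP[/eqP ea /eqP ed]; nia.
  case=> -[a d].
    have -> : A = trans (A 0 1) *m 1%:M.
      by apply: eq_mat2; rewrite mul2E !mat2E !mxE /= ?a ?d ?c0; lia.
    by apply: PTj P1; exact: SL2Z_1.
  have -> : A = trans (- A 0 1) *m (Smat *m (Smat *m 1%:M)).
    by apply: eq_mat2; rewrite !(mul2E, mat2E) !mxE /= ?a ?d ?c0; lia.
  have s1 := SL2Z_mul SL2Z_S SL2Z_1.
  exact: (PTj _ _ (SL2Z_mul SL2Z_S s1) (PS _ s1 (PS _ SL2Z_1 P1))).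
pose q := divz (A 0 0) (A 1 0).
have -> : A = trans q *m (Smat *m (Smat *m (Smat *m (Smat *m (trans (- q) *m A))))).
  by apply: eq_mat2; rewrite !(mul2E, mat2E); lia.
have hB := SL2Z_mul SL2Z_S (SL2Z_mul (SL2Z_trans (- q)) hA).
have hP : P (Smat *m (trans (- q) *m A)).
  apply: ih hB; rewrite !(mul2E, mat2E).
  have := ltz_mod (A 0 0) c0; have := modz_ge0 (A 0 0) c0.
  by rewrite /modz -/q; lia.
have h2 := SL2Z_mul SL2Z_S hB; have h3 := SL2Z_mul SL2Z_S h2.
exact: (PTj _ _ (SL2Z_mul SL2Z_S h3) (PS _ h3 (PS _ h2 (PS _ hB hP)))).
Qed.

(** The Bezout coefficients of the first column give the row operations. *)
Lemma triangular_form B : 0 < \det B -> exists A (x y : nat) (j : int),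
  [/\ SL2Z A, (0 < x)%N, (0 < y)%N & B = A *m mat2 x j 0 y].
Proof.
move=> hd; pose g : nat := gcdn `|B 0 0| `|B 1 0|.
have [u [v huv]] : exists u v, u * B 0 0 + v * B 1 0 = g.
  by have [u [v huv]] := Bezoutz (B 0 0) (B 1 0); exists u, v.
have [a ha] : exists a : int, B 0 0 = a * g.
  by apply/dvdzP; rewrite /dvdz /=; exact: dvdn_gcdl.
have [c hc] : exists c : int, B 1 0 = c * g.
  by apply/dvdzP; rewrite /dvdz /=; exact: dvdn_gcdr.
have g0 : (0 < g)%N.
  rewrite lt0n; apply/eqP => e; move: hd; rewrite det2E ha hc e !mulr0 mul0r subrr.
  by rewrite ltxx.
have e1 : u * a + v * c = 1.
  have gz : (g%:Z : int) != 0 by lia.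
  by apply: (mulIf gz); rewrite mul1r -[RHS]huv ha hc mulrDl !mulrA.
pose y := a * B 1 1 - c * B 0 1.
have dy : \det B = g%:Z * y by rewrite det2E ha hc /y; lia.
have y0 : 0 < y by move: hd; rewrite dy pmulr_rgt0.
exists (mat2 a (- v) c u), g, `|y|%N, (u * B 0 1 + v * B 1 1).
have ey : (`|y|%N : int) = y by lia.
split=> //; first by rewrite /SL2Z /= det2E !mat2E; lia.
  by rewrite absz_gt0 gt_eqF.
apply: eq_mat2; rewrite !(mul2E, mat2E) ?ey /y.
- by rewrite ha; lia.
- rewrite -[LHS]mul1r -e1; ring.
- by rewrite hc; lia.
- rewrite -[LHS]mul1r -e1; ring.
Qed.

End Matrices.

(** * The action of integer matrices on functions *)

Section Slash.
Variable R : realType.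
Local Notation C := R[i].
Implicit Types (A B : 'M[int]_2) (f g : C -> C) (tau : C) (k : int).

Lemma Im_automorphy A tau : complex.Im (automorphy A tau) = (A 1 0)%:~R * complex.Im tau.
Proof. by rewrite /automorphy ImD ImMint Im_int addr0. Qed.

Lemma automorphy_neq0 A tau : \det A != 0 -> 0 < complex.Im tau -> automorphy A tau != 0.
Proof.
rewrite det2E => hd t0; apply/eqP => e; have := Im_automorphy A tau; rewrite e /=.
move=> /esym/eqP; rewrite mulf_eq0 (gt_eqF t0) orbF intr_eq0 => /eqP c0.
move: e; rewrite /automorphy c0 mul0r add0r => /eqP; rewrite intr_eq0 => /eqP d0.
by move: hd; rewrite c0 d0 !mulr0 subrr eqxx.
Qed.

Lemma Re_automorphy A tau : complex.Re (automorphy A tau) =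
  (A 1 0)%:~R * complex.Re tau + (A 1 1)%:~R.
Proof.
by rewrite /automorphy ReD Re_int -(rmorph_int (real_complex R)) ReMreal.
Qed.

Lemma Im_moebius A tau : \det A != 0 -> 0 < complex.Im tau ->
  complex.Im (moebius A tau) * normc (automorphy A tau) ^+ 2 = (\det A)%:~R * complex.Im tau.
Proof.
move=> hd t0; rewrite Im_quot ?automorphy_neq0 // Im_automorphy Re_automorphy.
have e1 : complex.Im ((A 0 0)%:~R * tau + (A 0 1)%:~R) = (A 0 0)%:~R * complex.Im tau.
  by rewrite ImD ImMint Im_int addr0.
have e2 : complex.Re ((A 0 0)%:~R * tau + (A 0 1)%:~R) =
    (A 0 0)%:~R * complex.Re tau + (A 0 1)%:~R.
  by rewrite ReD Re_int -(rmorph_int (real_complex R)) ReMreal.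
by rewrite e1 e2 det2E rmorphB !rmorphM /=; ring.
Qed.

Lemma moebius_upper A tau : 0 < \det A -> 0 < complex.Im tau ->
  0 < complex.Im (moebius A tau).
Proof.
move=> hd t0; have hd' : \det A != 0 by rewrite gt_eqF.
have := Im_moebius hd' t0; have := automorphy_neq0 hd' t0.
rewrite -normc_gt0 => j0 e.
by rewrite -(pmulr_lgt0 _ (exprn_gt0 2 j0)) e mulr_gt0 // ltr0z.
Qed.

Lemma moebius_numerator (F : fieldType) (a b p q t w : F) : w != 0 ->
  (a * ((p * t + q) / w) + b) * w = (a * p * t + a * q) + b * w.
Proof. by move=> w0; rewrite mulrDl !mulrA mulfVK // mulrDr !mulrA. Qed.

Lemma moebius_regroup (F : comNzRingType) (t a p b r q s : F) :
  (a * p + b * r) * t + (a * q + b * s) = a * p * t + a * q + b * (r * t + s).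
Proof. ring. Qed.

Lemma automorphyM A B tau : automorphy B tau != 0 ->
  automorphy (A *m B) tau = automorphy A (moebius B tau) * automorphy B tau.
Proof.
move=> w0; rewrite [automorphy A _]/automorphy /moebius moebius_numerator //.
rewrite /automorphy !mul2E !rmorphD !rmorphM /=.
exact: moebius_regroup.
Qed.

Lemma moebiusM A B tau : automorphy B tau != 0 ->
  moebius (A *m B) tau = moebius A (moebius B tau).
Proof.
move=> w0; rewrite [LHS]/moebius automorphyM // [in RHS]/moebius.
have -> : (A 0 0)%:~R * moebius B tau + (A 0 1)%:~R =
    (((A *m B) 0 0)%:~R * tau + ((A *m B) 0 1)%:~R) / automorphy B tau.
  apply: (mulIf w0); rewrite mulfVK // /moebius moebius_numerator //.
  rewrite /automorphy !mul2E !rmorphD !rmorphM /=.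
  exact/esym/moebius_regroup.
by rewrite invfM mulrA mulrAC.
Qed.

Lemma slashM k A B f tau : \det B != 0 -> 0 < complex.Im tau ->
  slash k (A *m B) f tau = slash k B (slash k A f) tau.
Proof.
move=> hB t0; have w0 := automorphy_neq0 hB t0.
by rewrite /slash automorphyM // moebiusM // expfzMl mulrCA mulrA.
Qed.

Lemma slash_ext k A f g tau : 0 < \det A -> 0 < complex.Im tau ->
  (forall t, 0 < complex.Im t -> f t = g t) -> slash k A f tau = slash k A g tau.
Proof. by move=> hd t0 e; rewrite /slash e // moebius_upper. Qed.

Lemma automorphy1 tau : automorphy 1%:M tau = 1.
Proof. by rewrite /automorphy !mxE /= mul0r add0r. Qed.

Lemma moebius1 tau : moebius 1%:M tau = tau.
Proof. by rewrite /moebius automorphy1 !mxE /= divr1 addr0; exact: mul1r. Qed.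

Lemma slash1 k f tau : slash k 1%:M f tau = f tau.
Proof. by rewrite /slash automorphy1 moebius1 exp1rz mul1r.
Qed.

Lemma slash_trans k (j : int) f tau : slash k (trans j) f tau = f (tau + j%:~R).
Proof.
rewrite /slash /moebius /automorphy !mat2E mul0r add0r exp1rz mul1r divr1.
by rewrite mul1r.
Qed.

Lemma slash_prod k l A f g tau : \det A != 0 -> 0 < complex.Im tau ->
  slash (k + l) A (fun t => f t * g t) tau = slash k A f tau * slash l A g tau.
Proof.
move=> hA t0; have w0 := automorphy_neq0 hA t0.
by rewrite /slash opprD expfzDr // mulrACA.
Qed.

Lemma slashD k A f g tau :
  slash k A (fun t => f t + g t) tau = slash k A f tau + slash k A g tau.
Proof. by rewrite /slash mulrDr. Qed.

Lemma slashZ k A (c : C) f tau :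
  slash k A (fun t => c * f t) tau = c * slash k A f tau.
Proof. by rewrite /slash mulrCA. Qed.

Lemma slashV k A f tau : slash (- k) A (fun t => (f t)^-1) tau = (slash k A f tau)^-1.
Proof. by rewrite /slash invfM invr_expz. Qed.

(** By [triangular_form] it is enough to treat upper triangular matrices, which
    act by the substitutions of [good_subst]. *)
Lemma good_slash k f : (forall A, SL2Z A -> good (slash k A f)) ->
  forall B, 0 < \det B -> good (slash k B f).
Proof.
move=> h B hd; have [A [x [y [j [hA x0 y0 ->]]]]] := triangular_form hd.
have := goodZ ((y%:R : C) ^ (- k)) (good_subst j x0 y0 (h A hA)).
apply: good_ext => tau t0; rewrite slashM //; last first.
  by rewrite det2E !mat2E mulr0 subr0 mulf_neq0 // eqz_nat -lt0n.
rewrite [in RHS]/slash /moebius /automorphy !mat2E mul0r add0r.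
by rewrite !pmulrn.
Qed.

(** Every point is [SL2(Z)]-equivalent to one of height at least 1/2: as long as
    the height is smaller, the inversion of a point with real part in [-1/2,1/2]
    at least doubles it. *)
Lemma reduction tau : 0 < complex.Im tau ->
  exists A, SL2Z A /\ 1 / 2 <= complex.Im (moebius A tau).
Proof.
move=> t0; have r01 : 0 <= (1 / 2 : R) < 1 by lra.
have [n] := small_power 1 r01 t0; rewrite mul1r => hn.
elim: n tau t0 hn => [|n ih] tau t0 hn.
  exists 1%:M; split; first exact: SL2Z_1.
  by rewrite moebius1; apply: le_trans hn; lra.
have [big|small] := leP (1 / 2) (complex.Im tau).
  exists 1%:M; split; first exact: SL2Z_1.
  by rewrite moebius1.
pose j := Num.floor (complex.Re tau + 1 / 2); pose B := Smat *m trans (- j).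
have hB : SL2Z B := SL2Z_mul SL2Z_S (SL2Z_trans _).
have dB : \det B = 1 := hB.
have dB0 : \det B != 0 by rewrite dB.
have dBp : 0 < \det B by rewrite dB.
have e := Im_moebius dB0 t0; rewrite dB mul1r in e.
have j0 := automorphy_neq0 dB0 t0; rewrite -normc_gt0 in j0.
have hj : normc (automorphy B tau) ^+ 2 <= 1 / 2.
  have -> : automorphy B tau = tau - j%:~R.
    by rewrite /automorphy !(mul2E, mat2E) !mulr1 mul1r !mul0r !addr0 mul1r rmorphN.
  have f1 := floor_le (complex.Re tau + 1 / 2); have f2 := floorD1_gt (complex.Re tau + 1 / 2).
  have er : complex.Re (tau - j%:~R) = complex.Re tau - j%:~R.
    by rewrite ReD ReN Re_int.
  have ei : complex.Im (tau - j%:~R) = complex.Im tau by rewrite ImD ImN Im_int subr0.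
  move: (tau - j%:~R) er ei => z er ei.
  have -> : normc z ^+ 2 = complex.Re z ^+ 2 + complex.Im z ^+ 2.
    by case: z {er ei} => x y /=; rewrite sqr_sqrtr // addr_ge0 ?sqr_ge0.
  rewrite er ei; rewrite -/j in f1 f2; rewrite rmorphD /= in f2; nra.
have t1 := moebius_upper dBp t0.
have hn' : (1 / 2) ^+ n <= complex.Im (moebius B tau).
  have : (1 / 2) ^+ n.+1 <= complex.Im (moebius B tau) * (1 / 2).
    by apply: le_trans hn _; rewrite -e ler_pM2l.
  by rewrite exprS; lra.
have [A [hA hI]] := ih _ t1 hn'.
exists (A *m B); split; first exact: SL2Z_mul.
by rewrite moebiusM // automorphy_neq0.
Qed.

End Slash.

(** * Modularity of the theta series *)

Section Parity.
Implicit Types A B : 'M[int]_2.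

Definition oddz (a : int) := ~~ (2 %| a)%Z.

Lemma oddzD a b : oddz (a + b) = oddz a (+) oddz b. Proof. rewrite /oddz; lia. Qed.

Lemma oddzM a b : oddz (a * b) = oddz a && oddz b. Proof. rewrite /oddz; nia. Qed.

Lemma oddzN a : oddz (- a) = oddz a. Proof. rewrite /oddz; lia. Qed.

Lemma oddz_det A : SL2Z A ->
  (oddz (A 0 0) && oddz (A 1 1)) (+) (oddz (A 0 1) && oddz (A 1 0)).
Proof. by move=> /SL2Z_entries e; rewrite -!oddzM -[X in _ (+) X]oddzN -oddzD e. Qed.

(** The signature of the permutation that [A] induces on the three nonzero
    vectors of [F_2^2]. *)
Definition sgn2 A : bool :=
  (oddz (A 0 0) == oddz (A 1 1)) && (oddz (A 0 1) || oddz (A 1 0)).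

(** The row vector [(a, b)] times [A], modulo 2. *)
Definition act1 A (a b : bool) := (a && oddz (A 0 0)) (+) (b && oddz (A 1 0)).
Definition act2 A (a b : bool) := (a && oddz (A 0 1)) (+) (b && oddz (A 1 1)).

Lemma sgn2M A B : SL2Z A -> SL2Z B -> sgn2 (A *m B) = sgn2 A (+) sgn2 B.
Proof.
move=> /oddz_det + /oddz_det; rewrite /sgn2 !mul2E !oddzD !oddzM.
case: (oddz (A 0 0)); case: (oddz (A 0 1)); case: (oddz (A 1 0)); case: (oddz (A 1 1)) => // _;
case: (oddz (B 0 0)); case: (oddz (B 0 1)); case: (oddz (B 1 0)); case: (oddz (B 1 1)) => //.
Qed.

Lemma actM A B a b : (act1 (A *m B) a b = act1 B (act1 A a b) (act2 A a b)) *
  (act2 (A *m B) a b = act2 B (act1 A a b) (act2 A a b)).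
Proof.
rewrite /act1 /act2 !mul2E !oddzD !oddzM.
case: (oddz (A 0 0)); case: (oddz (A 0 1)); case: (oddz (A 1 0)); case: (oddz (A 1 1));
case: (oddz (B 0 0)); case: (oddz (B 0 1)); case: (oddz (B 1 0)); case: (oddz (B 1 1));
by case: a; case: b.
Qed.

Lemma act_neq0 A a b : SL2Z A -> a || b -> act1 A a b || act2 A a b.
Proof.
move=> /oddz_det; rewrite /act1 /act2.
by case: (oddz (A 0 0)); case: (oddz (A 0 1)); case: (oddz (A 1 0)); case: (oddz (A 1 1));
  case: a; case: b.
Qed.

End Parity.

Section ThetaModularity.
Variable R : realType.
Local Notation C := R[i].
Implicit Types (tau : C) (A B : 'M[int]_2).

(** The fourth powers of the three theta series are permuted, up to sign, like the
    nonzero row vectors of [F_2^2]; with the sign chosen for [th3] the sign that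
    remains is the character [sgn2]. *)
Definition theta (a b : bool) : C -> C :=
  if a then if b then fun tau => - th3 tau else @th4 R else @th2 R.

Definition theta_modular A := forall a b, a || b -> forall tau, 0 < complex.Im tau ->
  slash 2 A (theta a b) tau = (-1) ^+ sgn2 A * theta (act1 A a b) (act2 A a b) tau.

Lemma theta_modularM A B : SL2Z A -> SL2Z B -> theta_modular A -> theta_modular B ->
  theta_modular (A *m B).
Proof.
move=> hA hB mA mB a b ab tau t0; have dB : \det B = 1 := hB.
rewrite slashM ?dB // (slash_ext _ _ t0 (mA a b ab)) ?dB // slashZ.
by rewrite mB ?act_neq0 // mulrA -signr_addb sgn2M // !actM.
Qed.

Lemma th2_inversion tau : 0 < complex.Im tau -> th2 (- tau^-1) = - (tau ^+ 2 * th4 tau).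
Proof.
move=> t0; rewrite (th4_inversion t0) mulrN opprK mulrA mulfV ?mul1r //.
exact/expf_neq0/tau_neq0.
Qed.

Lemma inv_neg_neg tau : - (- tau^-1)^-1 = tau.
Proof. by rewrite invrN invrK opprK. Qed.

Lemma th4_inversion' tau : 0 < complex.Im tau -> th4 (- tau^-1) = - (tau ^+ 2 * th2 tau).
Proof.
by move=> t0; rewrite (th4_inversion (Im_inv_neg t0)) inv_neg_neg -exprVn invrN invrK sqrrN.
Qed.

Lemma one_as_shift (F : fieldType) : 1 = - 1 + 2 :> F. Proof. ring. Qed.

Lemma th4B1 tau : th4 (tau - 1) = th3 tau.
Proof. by rewrite /th3 -(th4D2 (tau - 1)) -addrA; congr (th4 (_ + _)); exact/esym/one_as_shift. Qed.

Lemma th2B1 tau : th2 (tau - 1) = - th2 tau.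
Proof. by rewrite -[in RHS](subrK 1 tau) th2D1 opprK. Qed.

Lemma inversion_of_shift (F : fieldType) (t : F) : t != 0 -> t - 1 != 0 ->
  1 - t^-1 = - (- (t - 1)^-1 - 1)^-1.
Proof.
move=> h1 h2; have e : - (t - 1)^-1 - 1 = - (t / (t - 1)) by field; rewrite h2.
by rewrite e invrN opprK invf_div mulrBl mulfV // mul1r.
Qed.

Lemma inversion_of_shift_weight (F : fieldType) (t a : F) : t != 0 -> t - 1 != 0 ->
  - ((- (t - 1)^-1 - 1) ^+ 2 * - - ((t - 1) ^+ 2 * a)) = - (t ^+ 2 * a).
Proof. by move=> h1 h2; field; rewrite h2. Qed.

(** The identity [T S = S T^(-1) S T^(-1)] up to sign in [SL2(Z)] reduces the
    inversion of [th3] to those of [th4] and [th2]. *)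
Lemma th3_inversion tau : 0 < complex.Im tau -> th3 (- tau^-1) = - (tau ^+ 2 * th3 tau).
Proof.
move=> t0; have t1 : 0 < complex.Im (tau - 1) by rewrite ImD ImN /= oppr0 addr0.
have n0 := tau_neq0 t0; have n1 := tau_neq0 t1.
have s0 : 0 < complex.Im (- (tau - 1)^-1 - 1).
  by rewrite ImD [complex.Im (- 1)]ImN subr0; exact: Im_inv_neg.
rewrite {1}/th3 [- _ + 1]addrC (inversion_of_shift n0 n1) (th4_inversion' s0).
rewrite th2B1 (th2_inversion t1) th4B1.
exact: inversion_of_shift_weight.
Qed.

Lemma moebius_S tau : moebius Smat tau = - tau^-1.
Proof.
rewrite /moebius /automorphy !mat2E mul0r add0r addr0 [1%:~R * _]mul1r.
by rewrite -[(-1)%:~R]/(- 1) mulN1r.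
Qed.

Lemma automorphy_S tau : automorphy Smat tau = tau.
Proof. by rewrite /automorphy !mat2E addr0; exact: mul1r. Qed.

Lemma weight2_cancel (F : fieldType) (t a : F) : t != 0 -> t ^- 2 * - (t ^+ 2 * a) = - a.
Proof. by move=> t0; rewrite mulrN mulrA mulVf ?mul1r // expf_neq0. Qed.

Lemma theta_modular_S : theta_modular Smat.
Proof.
move=> a b ab tau t0; have n0 := tau_neq0 t0.
rewrite /slash automorphy_S moebius_S /sgn2 /act1 /act2 !mat2E /= expr1 mulN1r.
case: a ab; case: b => ab; last by [].
- change (tau ^- 2 * - th3 (- tau^-1) = - - th3 tau).
  by rewrite (th3_inversion t0) -mulrN weight2_cancel.
- change (tau ^- 2 * th4 (- tau^-1) = - th2 tau).
  by rewrite (th4_inversion' t0) weight2_cancel.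
- change (tau ^- 2 * th2 (- tau^-1) = - th4 tau).
  by rewrite (th2_inversion t0) weight2_cancel.
Qed.

Lemma theta_modular_T1 : theta_modular (trans 1).
Proof.
move=> a b ab tau t0; rewrite slash_trans /sgn2 /act1 /act2 !mat2E /= expr1 mulN1r.
case: a ab; case: b => ab; last by [].
- change (- th4 (tau + 1 + 1) = - th4 tau).
  by rewrite -(th4D2 tau) -addrA.
- change (th4 (tau + 1) = - - th4 (tau + 1)); by rewrite opprK.
- exact: th2D1.
Qed.

Lemma theta_modular_TN1 : theta_modular (trans (-1)).
Proof.
move=> a b ab tau t0; rewrite slash_trans /sgn2 /act1 /act2 !mat2E /= expr1 mulN1r.
rewrite -[(-1)%:~R]/(- 1 : C).
case: a ab; case: b => ab; last by [].
- change (- th4 (tau - 1 + 1) = - th4 tau); by rewrite subrK.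
- change (th4 (tau - 1) = - - th3 tau); by rewrite opprK th4B1.
- exact: th2B1.
Qed.

(** It is enough to know the action of the generators, by [theta_modularM]. *)
Lemma thetaP A : SL2Z A -> theta_modular A.
Proof.
elim/SL2Z_ind=> [||]; last 1 first.
- move=> B hB mB; split; first exact: theta_modularM (SL2Z_trans 1) hB theta_modular_T1 mB.
  exact: theta_modularM (SL2Z_trans (-1)) hB theta_modular_TN1 mB.
- move=> a b ab tau t0; rewrite slash1 /sgn2 /act1 /act2 !mxE /= expr0 mul1r.
  by rewrite !andbT !andbF addbF addFb.
- by move=> B hB mB; exact: theta_modularM SL2Z_S hB theta_modular_S mB.
Qed.

(** On matrices with even upper right entry the signature is the parity of the
    lower left entry. *)
Lemma th4_slash A : SL2Z A -> ~~ oddz (A 0 1) -> forall tau, 0 < complex.Im tau ->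
  slash 2 A (@th4 R) tau = (-1) ^+ oddz (A 1 0) * th4 tau.
Proof.
move=> hA /negbTE h01 tau t0; have := thetaP hA (erefl : true || false) t0.
have := oddz_det hA; rewrite /sgn2 /act1 /act2 /theta h01 /= addbF => /andP[-> ->].
by [].
Qed.

Lemma th2_slash A : SL2Z A -> forall tau, 0 < complex.Im tau ->
  slash 2 A (@th2 R) tau = (-1) ^+ sgn2 A * theta (oddz (A 1 0)) (oddz (A 1 1)) tau.
Proof.
move=> hA tau t0; have := thetaP hA (erefl : false || true) t0.
by [].
Qed.

Lemma good_theta a b : good (theta a b).
Proof.
case: a; case: b; [|exact: good_th4|exact: good_th2|exact: good_th2].
by apply: good_ext (goodZ (-1) (good_th3 R)) => tau _; rewrite mulN1r.
Qed.

Lemma good_thetaV b : good (fun tau => (theta true b tau)^-1).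
Proof.
case: b; last exact: good_th4V.
by apply: good_ext (goodZ (-1) (good_th3V R)) => tau _; rewrite invrN mulN1r.
Qed.

End ThetaModularity.

(** * Forms on Gamma(2) *)

Section Forms.
Variable R : realType.
Local Notation C := R[i].
Implicit Types (tau : C) (A B : 'M[int]_2) (f g : C -> C) (k l : int).
Implicit Types G : 'M[int]_2 -> bool.

(** Modularity with the expansions at the cusps replaced by [good], which is stable
    under products with inverses of theta series and under changes of level. *)
Definition mform G k f :=
  (forall A, SL2Z A -> G A -> forall tau, 0 < complex.Im tau -> slash k A f tau = f tau) /\
  (forall A, SL2Z A -> good (slash k A f)).

Lemma SL2Z_det A : SL2Z A -> (\det A != 0) * (0 < \det A).
Proof. by rewrite /SL2Z /= => ->. Qed.

Lemma mform_ext G k f g : (forall tau, 0 < complex.Im tau -> f tau = g tau) ->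
  mform G k f -> mform G k g.
Proof.
move=> e [inv gd]; split=> [A hA GA tau t0|A hA].
  by rewrite -(slash_ext k _ t0 e) ?SL2Z_det // inv // e.
by apply: good_ext (gd A hA) => tau t0; apply: slash_ext; rewrite ?SL2Z_det.
Qed.

Lemma mformD G k f g : mform G k f -> mform G k g -> mform G k (fun tau => f tau + g tau).
Proof.
move=> [If gf] [Ig gg]; split=> [A hA GA tau t0|A hA]; first by rewrite slashD If // Ig.
by apply: good_ext (goodD (gf A hA) (gg A hA)) => tau t0; rewrite slashD.
Qed.

Lemma mformZ G k (c : C) f : mform G k f -> mform G k (fun tau => c * f tau).
Proof.
move=> [If gf]; split=> [A hA GA tau t0|A hA]; first by rewrite slashZ If.
by apply: good_ext (goodZ c (gf A hA)) => tau t0; rewrite slashZ.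
Qed.

Lemma mformM G k l f g : mform G k f -> mform G l g ->
  mform G (k + l) (fun tau => f tau * g tau).
Proof.
move=> [If gf] [Ig gg]; split=> [A hA GA tau t0|A hA].
  by rewrite slash_prod ?SL2Z_det // If // Ig.
apply: good_ext (goodM (gf A hA) (gg A hA)) => tau t0.
by rewrite slash_prod ?SL2Z_det.
Qed.

Lemma mform_cst G (c : C) : mform G 0 (fun=> c).
Proof.
split=> [A hA GA tau t0|A hA]; first by rewrite /slash oppr0 expr0z mul1r.
by apply: good_ext (good_cst c) => tau t0; rewrite /slash oppr0 expr0z mul1r.
Qed.

Lemma mformX G k f m : mform G k f -> mform G (k * m%:Z) (fun tau => f tau ^+ m).
Proof.
move=> hf; elim: m => [|m ih].
  by rewrite mulr0; apply: mform_ext (mform_cst G 1) => tau _; rewrite expr0.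
have -> : k * m.+1%:Z = k + k * m%:Z by rewrite -add1n PoszD mulrDr mulr1.
by apply: mform_ext (mformM hf ih) => tau _; rewrite exprS.
Qed.

Definition Gamma2 A := ~~ oddz (A 0 1) && ~~ oddz (A 1 0).

Lemma good_theta_slash a b A : a || b -> SL2Z A -> good (slash 2 A (@theta R a b)).
Proof.
move=> ab hA; have := goodZ ((-1) ^+ sgn2 A) (good_theta R (act1 A a b) (act2 A a b)).
by apply: good_ext => tau t0; rewrite (thetaP hA ab t0).
Qed.

Lemma mform_th4 : mform Gamma2 2 (@th4 R).
Proof.
split=> [A hA /andP[h01 /negbTE h10] tau t0|A hA].
  by rewrite th4_slash // h10 expr0 mul1r.
exact: (@good_theta_slash true false).
Qed.

Lemma th2_inv A : SL2Z A -> Gamma2 A -> forall tau, 0 < complex.Im tau ->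
  slash 2 A (@th2 R) tau = th2 tau.
Proof.
move=> hA /andP[/negbTE h01 /negbTE h10] tau t0; have := th2_slash hA t0.
have := oddz_det hA; rewrite /sgn2 h01 h10 addbF andbF => /andP[_ ->].
by rewrite expr0 mul1r.
Qed.

Lemma Gamma2_coset A B : SL2Z A -> SL2Z B ->
  (forall i j, oddz (A i j) = oddz (B i j)) ->
  exists D, [/\ SL2Z D, Gamma2 D & A = D *m B].
Proof.
move=> hA hB e; exists (A *m adj2 B); split.
- exact: SL2Z_mul (SL2Z_adj hB).
- rewrite /Gamma2 !(mul2E, mat2E, oddzD, oddzM, oddzN) !e.
  by case: (oddz (B 0 0)); case: (oddz (B 0 1)); case: (oddz (B 1 0)); case: (oddz (B 1 1)).
- by rewrite -mulmxA adj2_mul // mulmx1.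
Qed.

Lemma slash_coset G k f B D tau : mform G k f -> SL2Z D -> G D -> 0 < \det B ->
  0 < complex.Im tau -> slash k (D *m B) f tau = slash k B f tau.
Proof.
move=> [inv _] hD GD hB t0; rewrite slashM ?gt_eqF //.
by apply: slash_ext => // t; exact: inv.
Qed.

(** By [reduction], a form of weight -2 is bounded by the height, with a constant
    that depends only on the finitely many classes mod 2. *)
Lemma mform_weightN2 f : mform Gamma2 (-2) f -> forall tau, 0 < complex.Im tau -> f tau = 0.
Proof.
move=> hf; have [_ gd] := hf.
pose pat A := (oddz (A 0 0), oddz (A 0 1), oddz (A 1 0), oddz (A 1 1)).
have bound (t : bool * bool * bool * bool) : exists M : R, forall A, SL2Z A -> pat A = t ->
    forall tau, 1 / 2 <= complex.Im tau -> normc (slash (-2) A f tau) <= M.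
  have half : 0 < (1 / 2 : R) by lra.
  have [[B [hB pB]]|none] := pselect (exists B, SL2Z B /\ pat B = t); last first.
    by exists 0 => A hA pA; case: none; exists A.
  have [M hM] := good_bounded (gd B hB) half.
  exists M => A hA pA tau ht; move: pA; rewrite -pB => -[e1 e2 e3 e4].
  have [|D [hD gD ->]] := Gamma2_coset hA hB.
    by move=> i j; case: (ord2P i) => ->; case: (ord2P j) => ->.
  by rewrite (slash_coset hf) ?SL2Z_det ?hM // (lt_le_trans half).
have [M hM] := choice bound.
pose K := \sum_t `|M t|.
have fgood : good f.
  by apply: good_ext (gd _ SL2Z_1) => tau _; rewrite slash1.
apply: (good_vanish (M := 2 * K) fgood) => tau t0.
have [A [hA big]] := reduction t0.
have hB := SL2Z_adj hA.
have bB : normc (slash (-2) (adj2 A) f (moebius A tau)) <= K.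
  apply: le_trans (hM _ _ hB erefl _ big) _; apply: le_trans (ler_norm _) _.
  by rewrite /K (bigD1 (pat (adj2 A))) //= lerDl sumr_ge0.
have ef : f tau = automorphy A tau ^+ 2 * slash (-2) (adj2 A) f (moebius A tau).
  by rewrite -[LHS](slash1 (-2)) -(adj2_mul hA) slashM ?SL2Z_det.
rewrite ef normcM normcX.
have dA : \det A = 1 := hA.
have eI := Im_moebius (SL2Z_det hA).1 t0; rewrite dA mul1r in eI.
have := normc_ge0 (slash (-2) (adj2 A) f (moebius A tau)).
have := sqr_ge0 (normc (automorphy A tau)).
move: (normc (slash _ _ _ _)) bB (normc _ ^+ 2) eI big => s sK j eI big j0 s0.
have K0 : 0 <= K by apply: le_trans sK.
have jI : j <= 2 * complex.Im tau by rewrite -eI; nra.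
apply: (@le_trans _ _ (2 * complex.Im tau * K)); last by rewrite mulrAC.
exact: ler_pM.
Qed.

(** A power of [th4], which has no zeros, raises the weight to -2. *)
Lemma mform_weight_neg f (m : nat) : mform Gamma2 (- (2 * m.+1%:Z)) f ->
  forall tau, 0 < complex.Im tau -> f tau = 0.
Proof.
move=> hf tau t0; have h : mform Gamma2 (-2) (fun t => f t * th4 t ^+ m).
  have -> : -2 = - (2 * m.+1%:Z) + 2 * m%:Z by lia.
  exact: mformM (mformX m mform_th4).
apply/eqP; have /eqP := mform_weightN2 h t0; rewrite mulf_eq0 => /orP[//|].
by rewrite expf_eq0 (negbTE (th4_neq0 t0)) andbF.
Qed.

Lemma cancel_constant_term (F : fieldType) (l q h l' h' : F) : l' != 0 ->
  l + q * h - l / l' * (l' + q * h') = q * (h - l / l' * h').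
Proof. by move=> n; field. Qed.

(** Subtracting a multiple of [th4^m] removes the constant term at infinity,
    after which division by [th2], which vanishes only there, is possible. *)
Lemma mform_split f (m : nat) : mform Gamma2 (2 * m%:Z) f ->
  exists (c : C) g, mform Gamma2 (2 * m%:Z - 2) g /\
    forall tau, 0 < complex.Im tau -> f tau = c * th4 tau ^+ m + th2 tau * g tau.
Proof.
move=> hf.
have expand g : mform Gamma2 (2 * m%:Z) g -> exists (l : C) h, good h /\
    forall tau, 0 < complex.Im tau -> g tau = l + qexp (tau / 2) * h tau.
  move=> [inv gd]; apply: good_divide.
    by apply: good_ext (gd _ SL2Z_1) => tau _; rewrite slash1.
  move=> tau t0; rewrite -[RHS](inv (trans 2)) ?slash_trans //; first exact: SL2Z_trans.
  by rewrite /Gamma2 !mat2E.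
have ht : mform Gamma2 (2 * m%:Z) (fun tau => th4 tau ^+ m) := mformX m mform_th4.
have [l [h [hh eh]]] := expand _ hf; have [l' [h' [hh' eh']]] := expand _ ht.
have two : (0 < 2)%N by [].
have l0 : l' != 0.
  apply/eqP => l0; have hV := goodX m (good_th4V R).
  suff : (1 : C) = 0 by move/eqP; rewrite oner_eq0.
  apply: (const_zero two (goodM hh' hV)) => tau t0.
  rewrite mulrA; have -> : qexp (tau / 2) * h' tau = th4 tau ^+ m.
    by rewrite eh' // l0 add0r.
  by rewrite -exprMn mulfV ?expr1n // th4_neq0.
pose G tau := f tau + - (l / l') * th4 tau ^+ m.
have hG : mform Gamma2 (2 * m%:Z) G := mformD hf (mformZ (- (l / l')) ht).
have [t [gt gtV et]] := th2_factor R.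
pose g tau := G tau * (th2 tau)^-1.
have inv_slash A tau : SL2Z A -> 0 < complex.Im tau ->
    slash (2 * m%:Z - 2) A g tau = slash (2 * m%:Z) A G tau / slash 2 A (@th2 R) tau.
  by move=> hA t0; rewrite slash_prod ?SL2Z_det // slashV.
have g_inv A : SL2Z A -> Gamma2 A -> forall tau, 0 < complex.Im tau ->
    slash (2 * m%:Z - 2) A g tau = g tau.
  by move=> hA gA tau t0; rewrite inv_slash // hG.1 // th2_inv.
have ggood : good g.
  have := goodM (goodB hh (goodZ (l / l') hh')) gtV; apply: good_ext => tau t0.
  have q0 := qexp_neq0 (tau / 2).
  by rewrite /g /G mulNr (eh _ t0) (eh' _ t0) cancel_constant_term // et div_cancel_l.
exists (l / l'), g; split; last first.
  move=> tau t0; rewrite /g mulrCA mulfV ?th2_neq0 // mulr1 /G mulNr.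
  by rewrite addrC subrK.
split=> // A hA; have [c1|c0] := boolP (oddz (A 1 0)).
  have := goodM (hG.2 A hA) (goodZ ((-1) ^+ sgn2 A) (good_thetaV R (oddz (A 1 1)))).
  apply: good_ext => tau t0; rewrite inv_slash // th2_slash // c1.
  by rewrite invfM -exprVn invrN invr1.
have := @good_subst R 1 1 (oddz (A 0 1)) g isT isT ggood.
apply: good_ext => tau t0.
have hT := SL2Z_trans (oddz (A 0 1)).
have [D [hD gD eA]] : exists D, [/\ SL2Z D, Gamma2 D & A = D *m trans (oddz (A 0 1))].
  apply: Gamma2_coset => // i j; have := oddz_det hA; rewrite (negbTE c0) andbF addbF.
  case/andP=> o1 o2; case: (ord2P i) => ->; case: (ord2P j) => ->; rewrite !mat2E ?o1 ?o2 //.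
    by case: (oddz _).
  exact: negbTE.
rewrite [in RHS]eA slashM ?SL2Z_det // (slash_ext _ _ t0 (g_inv D hD gD)) ?SL2Z_det //.
by rewrite slash_trans mul1r divr1.
Qed.

End Forms.

(** * Eta quotients of level dividing 2^n *)

Section EtaMonomials.
Variable R : realType.
Local Notation C := R[i].
Implicit Types (tau : C) (f g h : C -> C).

Lemma theta4_eta_algebra (F : fieldType) (a E D : F) : a != 0 -> D != 0 ->
  (a * E) ^+ 8 / (a ^+ 2 * D) ^+ 4 = (E ^+ 4 / D ^+ 2) ^+ 2.
Proof. by move=> a0 D0; field; rewrite a0 D0. Qed.

Lemma theta2_eta_algebra (F : fieldType) (s b E D : F) : b != 0 -> D != 0 ->
  s * b ^+ 12 * (E ^+ 4 / D ^+ 2) ^+ 2 = s * ((b ^+ 2 * E) ^+ 8 / (b * D) ^+ 4).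
Proof. by move=> b0 D0; field; rewrite b0 D0. Qed.

Lemma double_div2 (F : numFieldType) (t : F) : 2%:R * t / 2 = t.
Proof. by field. Qed.

Lemma opp_self_eq0 (F : numFieldType) (a : F) : - a == a -> a = 0.
Proof. by rewrite -subr_eq0 -opprD oppr_eq0 -mulr2n mulrn_eq0 => /eqP. Qed.

Lemma opp_div_opp1 (F : fieldType) (t : F) : - t / - 1 = t.
Proof. by rewrite invrN invr1 mulrNN mulr1. Qed.

Lemma half_sum_difference (F : numFieldType) (a b : F) : a = 2^-1 * (a + b) + 2^-1 * (a - b).
Proof. by field. Qed.

Lemma twelve_twentyfourths (F : numFieldType) (t : F) : 12%:R * ((2 * t) / 24) = t.
Proof. by field. Qed.

Lemma Im_natM (n : nat) tau : complex.Im (n%:R * tau) = n%:R * complex.Im tau.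
Proof. exact: (ImMint n tau). Qed.

Lemma Im_natM_gt0 (n : nat) tau : (0 < n)%N -> 0 < complex.Im tau ->
  0 < complex.Im (n%:R * tau).
Proof. by move=> n0 t0; rewrite Im_natM mulr_gt0 // ltr0n. Qed.

Lemma eta_neq0 tau : 0 < complex.Im tau -> eta tau != 0.
Proof.
move=> t0; rewrite etaE; apply: mulf_neq0 (qexp_neq0 _) _.
exact/euler_neq0/normc_qexp_lt1.
Qed.

Lemma th4_eta tau : 0 < complex.Im tau ->
  th4 (2%:R * tau) = eta tau ^+ 8 / eta (2%:R * tau) ^+ 4.
Proof.
move=> t0; have t2 := Im_natM_gt0 (isT : (0 < 2)%N) t0.
have e1 : 2%:R * tau / 2 = tau by exact: double_div2.
have e2 : qexp (2%:R * tau / 24) = qexp (tau / 24) ^+ 2 by rewrite -qexpMn mulrA.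
have D0 := euler_neq0 (normc_qexp_lt1 t2).
have E := theta4_eta_algebra (euler (qexp tau)) (qexp_neq0 (tau / 24)) D0.
by rewrite !etaE e2 E /th4 e1 -qexpMn.
Qed.

Lemma th2_eta tau : 0 < complex.Im tau ->
  th2 (2%:R * tau) = 16 * (eta (4%:R * tau) ^+ 8 / eta (2%:R * tau) ^+ 4).
Proof.
move=> t0; have t2 := Im_natM_gt0 (isT : (0 < 2)%N) t0.
have e1 : 2%:R * tau / 2 = tau by exact: double_div2.
have e2 : qexp (4%:R * tau / 24) = qexp (2%:R * tau / 24) ^+ 2.
  by rewrite -qexpMn !mulrA -natrM.
have e3 : qexp tau = qexp (2%:R * tau / 24) ^+ 12 by rewrite -qexpMn twelve_twentyfourths.
have D0 := euler_neq0 (normc_qexp_lt1 t2).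
have E := theta2_eta_algebra 16 (euler (qexp (4%:R * tau))) (qexp_neq0 (2%:R * tau / 24)) D0.
by rewrite !etaE e2 -E -e3 /th2 e1 -!qexpMn.
Qed.

Section Level.
Variable n : nat.

Definition eta_monomial (e : nat -> int) tau : C :=
  \prod_(i < n.+1) eta ((2 ^ i)%N%:R * tau) ^ e i.

Lemma eta_monomialE e : eta_monomial e = eta_quotient (2 ^ n) (fun d => e (logn 2 d)).
Proof.
apply: funext => tau; rewrite /eta_quotient /eta_monomial.
rewrite (perm_big [seq (2 ^ i)%N | i <- iota 0 n.+1]); last first.
  apply: uniq_perm (divisors_uniq _) _ _.
    by rewrite map_inj_uniq ?iota_uniq //; exact: expnI.
  move=> d; rewrite -dvdn_divisors ?expn_gt0 //; apply/idP/mapP.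
    by move=> /(dvdn_pfactor _ _ (isT : prime 2))[m hm ->]; exists m => //; rewrite mem_iota.
  by case=> i; rewrite mem_iota => hi ->; apply: dvdn_exp2l.
rewrite big_map -[iota 0 _]/(index_iota 0 n.+1) big_mkord.
by apply: eq_bigr => i _; rewrite pfactorK.
Qed.

(** The level is fixed, so that products and inverses stay in the class. *)
Definition monomial g := exists (c : C) (e : nat -> int),
  forall tau, 0 < complex.Im tau -> g tau = c * eta_monomial e tau.

Let pow2_gt0 i : (0 < 2 ^ i)%N. Proof. by rewrite expn_gt0. Qed.

Lemma monomial_cst (c : C) : monomial (fun=> c).
Proof.
exists c, (fun=> 0) => tau _.
by rewrite /eta_monomial big1 ?mulr1 // => i _; rewrite expr0z.
Qed.

Lemma monomialM g h : monomial g -> monomial h -> monomial (fun tau => g tau * h tau).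
Proof.
move=> [c [e he]] [c' [e' he']]; exists (c * c'), (fun i => e i + e' i) => tau t0.
rewrite he // he' // mulrACA; congr (_ * _).
rewrite -big_split; apply: eq_bigr => i _; rewrite expfzDr //.
exact/eta_neq0/Im_natM_gt0.
Qed.

Lemma monomialV g : monomial g -> monomial (fun tau => (g tau)^-1).
Proof.
move=> [c [e he]]; exists c^-1, (fun i => - e i) => tau t0; rewrite he // invfM; congr (_ * _).
by rewrite /eta_monomial -prodfV; apply: eq_bigr => i _; rewrite invr_expz.
Qed.

Lemma monomialX g m : monomial g -> monomial (fun tau => g tau ^+ m).
Proof.
move=> hg; elim: m => [|m ih]; first exact: (monomial_cst 1).
have [c [e he]] := monomialM hg ih.
by exists c, e => tau t0; rewrite exprS he.
Qed.

Lemma monomial_eta j : (j <= n)%N -> monomial (fun tau => eta ((2 ^ j)%N%:R * tau)).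
Proof.
move=> jn; exists 1, (fun i => (i == j : nat)%:Z) => tau _; rewrite mul1r /eta_monomial (bigD1 (Ordinal (jn : (j < n.+1)%N))) //=.
rewrite big1 => [|i ij]; first by rewrite eqxx mulr1 expr1z.
by rewrite -[(i : nat) == j]/(i == Ordinal (jn : (j < n.+1)%N)) (negbTE ij) expr0z.
Qed.

Lemma monomial_ext g h : (forall tau, 0 < complex.Im tau -> g tau = h tau) ->
  monomial g -> monomial h.
Proof. by move=> e [c [m hm]]; exists c, m => tau t0; rewrite -e // hm. Qed.

Lemma monomial_th4 j : (j.+1 <= n)%N -> monomial (fun tau => th4 ((2 ^ j.+1)%N%:R * tau)).
Proof.
move=> jn; have := monomialM (monomialX 8 (monomial_eta (ltnW jn)))
  (monomialV (monomialX 4 (monomial_eta jn))).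
apply: monomial_ext => tau t0; have tj := Im_natM_gt0 (pow2_gt0 j) t0.
by rewrite expnS natrM -mulrA (th4_eta tj).
Qed.

Lemma monomial_th2 : (2 <= n)%N -> monomial (fun tau => th2 (2%:R * tau)).
Proof.
move=> n2; have n1 := ltnW n2.
have := monomialM (monomial_cst 16) (monomialM (monomialX 8 (monomial_eta n2))
  (monomialV (monomialX 4 (monomial_eta n1)))).
by apply: monomial_ext => tau t0; rewrite (th2_eta t0).
Qed.

Inductive span : (C -> C) -> Prop :=
| span0 f : (forall tau, 0 < complex.Im tau -> f tau = 0) -> span f
| spanS f g h (c : C) : monomial g -> span h ->
    (forall tau, 0 < complex.Im tau -> f tau = c * g tau + h tau) -> span f.

Lemma span_ext f g : (forall tau, 0 < complex.Im tau -> f tau = g tau) -> span f -> span g.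
Proof.
move=> e hf; case: hf e => [{}f h e|{}f m h c hm hh ef e].
  by apply: span0 => tau t0; rewrite -e // h.
by apply: (spanS (c := c) hm hh) => tau t0; rewrite -e // ef.
Qed.

Lemma spanD f g : span f -> span g -> span (fun tau => f tau + g tau).
Proof.
move=> hf hg; elim: hf => [{}f h|{}f m h c hm hh ih ef].
  by apply: span_ext hg => tau t0; rewrite h // add0r.
by apply: (spanS (c := c) hm ih) => tau t0; rewrite ef // addrA.
Qed.

Lemma span_monomial (c : C) g : monomial g -> span (fun tau => c * g tau).
Proof.
move=> hg; apply: (@spanS _ g (fun=> 0) c hg); first exact: span0.
by move=> tau _; rewrite addr0.
Qed.

Lemma spanM g f : monomial g -> span f -> span (fun tau => g tau * f tau).
Proof.
move=> hg hf; elim: hf => [{}f h|{}f m h c hm hh ih ef].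
  by apply: span0 => tau t0; rewrite h // mulr0.
apply: (@spanS _ _ _ c (monomialM hg hm) ih) => tau t0.
by rewrite ef // mulrDr mulrCA.
Qed.

Lemma span_sum f : span f -> exists s : seq (C * (nat -> int)),
  forall tau, 0 < complex.Im tau -> f tau = \sum_(x <- s) x.1 * eta_monomial x.2 tau.
Proof.
elim=> [{}f h|{}f g h c [d [e he]] _ [s hs] ef].
  by exists [::] => tau t0; rewrite big_nil h.
exists ((c * d, e) :: s) => tau t0.
by rewrite ef // big_cons hs // he // mulrA.
Qed.

End Level.
End EtaMonomials.

(** * Descent to level 4 and to Gamma(2) *)

Section Descent.
Variable R : realType.
Local Notation C := R[i].
Implicit Types (tau : C) (A : 'M[int]_2) (f g : C -> C) (k : int).
Variable n : nat.
Hypothesis n2 : (2 <= n)%N.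

(** By [mform_split] every form is a polynomial in [th4] and [th2], which are
    multiples of eta quotients after the substitution of [2 tau]. *)
Lemma span_Gamma2 (m : nat) f : mform Gamma2 (2 * m%:Z) f -> span n (fun tau => f (2%:R * tau)).
Proof.
elim: m f => [|m ih] f hf; have [c [g [hg e]]] := mform_split hf.
  apply: (@span_ext _ _ (fun=> c * 1)); last first.
    exact/span_monomial/monomial_cst.
  move=> tau t0; have t2 := Im_natM_gt0 (isT : (0 < 2)%N) t0.
  by rewrite e // expr0 (mform_weightN2 hg t2) mulr0 addr0.
have {}hg : span n (fun tau => g (2%:R * tau)).
  by apply: ih; have -> : 2 * m%:Z = 2 * m.+1%:Z - 2 by lia.
have n1 : (1 <= n)%N := ltnW n2.
have h4 := monomialX m.+1 (monomial_th4 R n1).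
have := spanD (span_monomial c h4) (spanM (monomial_th2 R n2) hg).
by apply: span_ext => tau t0; rewrite e // Im_natM_gt0.
Qed.

Definition Gamma0b (N : nat) A : bool := A 1 0 \in dvdz N%:Z.

Lemma slash_scale k f (x y : nat) tau : slash k (mat2 x 0 0 y) f tau =
  y%:R ^ (- k) * f (x%:R * tau / y%:R).
Proof. by rewrite /slash /moebius /automorphy !mat2E mul0r add0r addr0. Qed.

(** Conjugation by [tau -> tau / 2] maps [Gamma(2)] into [Gamma_0(4)]. *)
Lemma mform_half f k : mform (Gamma0b 4) k f -> mform Gamma2 k (fun tau => f (tau / 2%:R)).
Proof.
move=> hf; pose D := mat2 1 0 0 2.
have dD : \det D = 2 by rewrite det2E !mat2E.
have two : (2%:R : C) != 0 by rewrite pnatr_eq0.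
have eF tau : f (tau / 2%:R) = 2%:R ^ k * slash k D f tau.
  by rewrite (slash_scale k f 1 2) mulrA -expfzDr // subrr expr0z !mul1r.
have eA A tau : SL2Z A -> 0 < complex.Im tau ->
    slash k A (fun tau => f (tau / 2%:R)) tau = 2%:R ^ k * slash k (D *m A) f tau.
  move=> hA t0; rewrite slashM ?SL2Z_det // -slashZ.
  by apply: slash_ext; rewrite ?SL2Z_det.
split=> [A hA /andP[/negbNE/dvdzP[b hb] /negbNE/dvdzP[c hc]] tau t0|A hA].
  have e := SL2Z_entries hA; rewrite hb hc in e.
  pose A' := mat2 (A 0 0) b (2 * A 1 0) (A 1 1).
  have hA' : SL2Z A' by rewrite /SL2Z /= det2E !mat2E; lia.
  have eDA : D *m A = A' *m D.
    by apply: eq_mat2; rewrite !(mul2E, mat2E) ?hb; lia.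
  have gA' : Gamma0b 4 A' by rewrite /Gamma0b mat2E hc; apply/dvdzP; exists c; lia.
  by rewrite eA // eDA (slash_coset hf hA' gA') ?dD // eF.
have dDA : 0 < \det (D *m A) by rewrite det_mulmx dD (hA : \det A = 1).
have := goodZ (2%:R ^ k) (good_slash hf.2 dDA).
by apply: good_ext => tau t0; rewrite eA.
Qed.

(** The matrix [-1] belongs to the group and acts by [-1] in odd weight. *)
Lemma mform_odd f k : mform (Gamma0b 4) (2 * k + 1) f -> forall tau, 0 < complex.Im tau -> f tau = 0.
Proof.
move=> [inv _] tau t0; pose A := mat2 (-1) 0 0 (-1).
have hA : SL2Z A by rewrite /SL2Z /= det2E !mat2E.
have gA : Gamma0b 4 A by rewrite /Gamma0b mat2E dvdz0.
have := inv A hA gA tau t0; rewrite /slash /moebius /automorphy !mat2E mul0r !addr0 !add0r.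
have -> : - (2 * k + 1) = 2 * (- k - 1) + 1 by lia.
have e1 : ((-1)%:~R : C) = - 1 by [].
rewrite e1 sign_odd !mulN1r opp_div_opp1 => /eqP; exact: opp_self_eq0.
Qed.

Lemma span_level4 f k : mform (Gamma0b 4) k f -> span n f.
Proof.
move=> hf; have [m [ek|ek]] : exists m, k = 2 * m \/ k = 2 * m + 1.
- by exists (divz k 2); lia.
- rewrite ek in hf; have hF := mform_half hf.
  have eF tau : f tau = f (2%:R * tau / 2%:R) by rewrite double_div2.
  case: m hF {ek hf} => m hF.
    by apply: span_ext (span_Gamma2 hF) => tau _; rewrite -eF.
  apply: span0 => tau t0; have t2 := Im_natM_gt0 (isT : (0 < 2)%N) t0.
  by rewrite eF; rewrite NegzE mulrN in hF; exact: (mform_weight_neg hF t2).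
by rewrite ek in hf; exact: (span0 _ (mform_odd hf)).
Qed.

Section Step.
Variable j : nat.
Let N := (2 ^ j.+1)%N.

Let evenN : exists M : nat, N = (2 * M)%N. Proof. by exists (2 ^ j)%N; rewrite -expnS. Qed.

Let N0 : N%:Z != 0. Proof. by rewrite eqz_nat /N expn_eq0. Qed.

(** Conjugation by [tau -> N tau] turns the elements of [Gamma_0(N)] into matrices
    with even upper right entry. By [th4_slash] the function [th4 (N tau)] therefore
    transforms under the character of [Gamma_0(N)] with kernel [Gamma_0(2N)]. *)
Lemma th4_scaled A (q : int) tau : SL2Z A -> A 1 0 = q * N -> 0 < complex.Im tau ->
  slash 2 A (fun t => th4 (N%:R * t)) tau = (-1) ^+ oddz q * th4 (N%:R * tau).
Proof.
move=> hA eq t0; pose E := mat2 N 0 0 1; pose A' := mat2 (A 0 0) (N%:Z * A 0 1) q (A 1 1).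
have Npos : (0 < N)%N by rewrite expn_gt0.
have dE : \det E = N by rewrite det2E !mat2E; lia.
have eh t : th4 (N%:R * t) = slash 2 E (@th4 R) t.
  by rewrite (slash_scale 2 _ N 1) exp1rz mul1r divr1.
have hA' : SL2Z A'.
  by have := SL2Z_entries hA; rewrite /SL2Z /= det2E !mat2E eq => <-; lia.
have eEA : E *m A = A' *m E by apply: eq_mat2; rewrite !(mul2E, mat2E) ?eq; lia.
have e01 : ~~ oddz (A' 0 1).
  by have [M eM] := evenN; rewrite mat2E eM PoszM -mulrA oddzM.
have dE0 : \det E != 0 by rewrite dE.
have dEp : 0 < \det E by rewrite dE.
rewrite (slash_ext 2 (SL2Z_det hA).2 t0 (fun t _ => eh t)).
have dA0 := (SL2Z_det hA).1.
rewrite -(slashM 2 E _ dA0 t0) eEA (slashM 2 A' _ dE0 t0).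
by rewrite (slash_ext _ dEp t0 (th4_slash hA' e01)) slashZ mat2E -eh.
Qed.

Lemma good_th4_scaled A : SL2Z A -> good (slash 2 A (fun t : C => th4 (N%:R * t))).
Proof.
move=> hA; pose E := mat2 N 0 0 1.
have Npos : (0 < N)%N by rewrite expn_gt0.
have dE : \det E = N by rewrite det2E !mat2E; lia.
have dEA : 0 < \det (E *m A) by rewrite det_mulmx dE (hA : \det A = 1) mulr1.
have := good_slash (mform_th4 R).2 dEA; apply: good_ext => tau t0.
rewrite slashM ?SL2Z_det //; apply: slash_ext; rewrite ?SL2Z_det // => t _.
by rewrite (slash_scale 2 _ N 1) exp1rz mul1r divr1.
Qed.

(** [Gamma_0(2N)] has index 2 in [Gamma_0(N)]. The part of [f] that is invariant
    under [Gamma_0(N)] and the part that changes sign are both of level [N], the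
    second one after multiplication by [th4 (N tau)]. *)
Lemma mform_descent f k : mform (Gamma0b (2 * N)) k f -> exists f1 f2,
  [/\ mform (Gamma0b N) k f1, mform (Gamma0b N) (2 + k) f2 &
    forall tau, 0 < complex.Im tau -> f tau = 2^-1 * f1 tau + 2^-1 * ((th4 (N%:R * tau))^-1 * f2 tau)].
Proof.
move=> hf; pose V := mat2 1 0 N 1; pose fV := slash k V f.
have hV : SL2Z V by rewrite /SL2Z /= det2E !mat2E mulr1 mul0r subr0.
have [M eM] := evenN.
have dvd2 (q : int) : oddz q = ~~ ((2 * N)%N%:Z %| q * N)%Z.
  by rewrite PoszM dvdz_mul2r //.
have act A (q : int) tau : SL2Z A -> A 1 0 = q * N -> 0 < complex.Im tau ->
    slash k A f tau = if oddz q then fV tau else f tau.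
  move=> hA eq t0; case: ifP => oq; last first.
    by apply: hf.1 => //; apply/negPn; rewrite /Gamma0b eq -dvd2 oq.
  have hD : SL2Z (A *m adj2 V) := SL2Z_mul hA (SL2Z_adj hV).
  have -> : A = (A *m adj2 V) *m V by rewrite -mulmxA adj2_mul // mulmx1.
  rewrite (slash_coset hf hD) ?SL2Z_det //.
  have od : oddz (A 1 1).
    have := oddz_det hA; rewrite eq eM PoszM !oddzM !andbF addbF.
    by case/andP.
  have e10 : (A *m adj2 V) 1 0 = (q - A 1 1) * N by rewrite !(mul2E, mat2E) eq; lia.
  by apply/negPn; rewrite /Gamma0b e10 -dvd2 oddzD oddzN oq od.
have actV A (q : int) tau : SL2Z A -> A 1 0 = q * N -> 0 < complex.Im tau ->
    slash k A fV tau = if oddz q then f tau else fV tau.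
  move=> hA eq t0; rewrite -slashM ?SL2Z_det // (act _ (q + A 0 0)) //.
    have oa : oddz (A 0 0).
      have := oddz_det hA; rewrite eq eM PoszM !oddzM !andbF addbF.
      by case/andP.
    by rewrite oddzD oa; case: (oddz q).
    exact: SL2Z_mul.
  by rewrite !(mul2E, mat2E) eq; lia.
have gV A : SL2Z A -> good (slash k A fV).
  move=> hA; have := hf.2 _ (SL2Z_mul hV hA); apply: good_ext => tau t0.
  by rewrite slashM ?SL2Z_det.
pose g tau := f tau + (-1) * fV tau.
have gg A : SL2Z A -> good (slash k A g).
  move=> hA; have := goodD (hf.2 A hA) (goodZ (-1) (gV A hA)); apply: good_ext => tau t0.
  by rewrite slashD slashZ.
have g_act A (q : int) tau : SL2Z A -> A 1 0 = q * N -> 0 < complex.Im tau ->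
    slash k A g tau = (-1) ^+ oddz q * g tau.
  move=> hA eq t0; rewrite slashD slashZ (act A q) // (actV A q) // /g.
  case: (oddz q); rewrite ?expr1 ?expr0 ?mul1r // mulN1r opprD; rewrite !mulN1r opprK.
  exact: addrC.
exists (fun tau => f tau + fV tau), (fun tau => th4 (N%:R * tau) * g tau); split.
- split=> [A hA /dvdzP[q eq] tau t0|A hA].
    by rewrite slashD (act A q) // (actV A q) //; case: (oddz q); rewrite // addrC.
  by have := goodD (hf.2 A hA) (gV A hA); apply: good_ext => tau t0; rewrite slashD.
- split=> [A hA /dvdzP[q eq] tau t0|A hA].
    rewrite slash_prod ?SL2Z_det // (th4_scaled hA eq t0) (g_act A q) //.
    by rewrite mulrACA -signr_addb addbb expr0 mul1r.
  have := goodM (good_th4_scaled hA) (gg A hA); apply: good_ext => tau t0.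
  by rewrite [in RHS]slash_prod ?SL2Z_det.
move=> tau t0; have Npos : (0 < N)%N by rewrite expn_gt0.
have h0 := th4_neq0 (Im_natM_gt0 Npos t0).
by rewrite mulKf // /g mulN1r; exact: half_sum_difference.
Qed.

End Step.

Lemma span_level j k f : (2 <= j <= n)%N -> mform (Gamma0b (2 ^ j)) k f -> span n f.
Proof.
case: j => [|[|j]] //; elim: j k f => [|j ih] k f hj hf; first exact: span_level4 hf.
have jn : (j.+2 <= n)%N by lia.
rewrite expnS in hf.
have [f1 [f2 [h1 h2 e]]] := mform_descent (j := j.+1) hf.
have jn' : (2 <= j.+2 <= n)%N by lia.
have s1 := ih _ _ jn' h1; have s2 := ih _ _ jn' h2.
have c := monomial_cst n (2^-1 : C).
have hV := monomialV (monomial_th4 R jn).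
apply: span_ext (spanD (spanM c s1) (spanM c (spanM hV s2))) => tau t0.
by rewrite e.
Qed.

End Descent.

Unset Implicit Arguments.

Theorem corollary3p7 (R : realType) (n : nat) (hn : (2 <= n)%N) (k : int)
    (f : R[i] -> R[i]) (hf : modular_form (2 ^ n)%N k f) :
  exists (r : nat) (c : 'I_r -> R[i]) (g : 'I_r -> R[i] -> R[i]),
    (forall j, is_eta_quotient (g j)) /\
    (forall tau : R[i], upper_half_plane tau ->
       f tau = \sum_(j < r) c j * g j tau).
Proof.
have N0 : (0 < 2 ^ n)%N by rewrite expn_gt0.
have hF : mform (Gamma0b (2 ^ n)) k f.
  split=> [A hA hN tau t0|A hA]; first exact: modular_form_invariant hf A (conj hA hN) tau t0.
  by exists (2 ^ n)%N; [exact: N0|exact/(regular_series N0)/(modular_form_cusps hf)].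
have nn : (2 <= n <= n)%N by rewrite hn leqnn.
have [s hs] := span_sum (span_level hn nn hF).
pose x0 : R[i] * (nat -> int) := (0, fun=> 0).
exists (size s), (fun j => (nth x0 s j).1), (fun j => eta_monomial n (nth x0 s j).2); split.
  by move=> j; exists (2 ^ n)%N, (fun d => (nth x0 s j).2 (logn 2 d)); rewrite eta_monomialE.
by move=> tau t0; rewrite hs // (big_nth x0) big_mkord.
Qed.
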